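(* For $\beta\ge2$ let $\boldsymbol u\in K^s$ and $\boldsymbol u_h\in K_h^s$ be the solutions of $$a^s(\boldsymbol u,\boldsymbol v-\boldsymbol u)\ge F(\boldsymbol v-\boldsymbol u)\quad\text{for all }\boldsymbol v\in K^s$$ and $$a^s(\boldsymbol u_h,\boldsymbol v_h-\boldsymbol u_h)\ge F(\boldsymbol v_h-\boldsymbol u_h)\quad\text{for all }\boldsymbol v_h\in K_h^s,$$ respectively. Then there holds the reliability estimate $$\|\boldsymbol u-\boldsymbol u_h\|_U\le C_{\mathrm{rel}}\,\eta$$ with a constant $C_{\mathrm{rel}}>0$ that depends on $\Omega$ but not on $\mathcal T$ or $\beta$, where $\eta\ge 0$ is given by $$\eta^2=\sum_{T\in\mathcal T}\eta(T)^2+\sum_{E\in\mathcal S_\Gamma}\eta(E)^2,\qquad \eta(T)^2=\beta\,\|R_T^{-1}\iota_T^*(L-B\boldsymbol u_h)\|_{V(T)}^2,\qquad \eta(E)^2=\langle\gamma_{\boldsymbol n}\boldsymbol u_h,\gamma_0\boldsymbol u_h\rangle_E .$$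
   Context: Domain and mesh. $\Omega\subset\mathbb R^d$ ($d\in\{2,3\}$) is a bounded simply connected Lipschitz domain with boundary $\Gamma=\partial\Omega$ and outer unit normal $\boldsymbol n=\boldsymbol n_\Omega$; $f\in L^2(\Omega)$. $(\cdot,\cdot)$ and $\|\cdot\|$ are the $L^2(\Omega)$ inner product and norm; $\langle\cdot,\cdot\rangle_{\partial\omega}$ is the (extended) $L^2(\partial\omega)$ duality. $\mathcal T$ is a finite conforming mesh of $\Omega$ of open simplices $T$, $\bigcup_{T\in\mathcal T}\overline T=\overline\Omega$; $\boldsymbol n_T$ is the outer unit normal on $\partial T$; $\mathcal S=\{\partial T: T\in\mathcal T\}$ is the skeleton; $\mathcal S_\Gamma=\{\partial T\cap\Gamma:T\in\mathcal T\}$ is the induced boundary mesh. $\nabla_{\mathcal T}$, $\mathrm{div}_{\mathcal T}$ are the $\mathcal T$-piecewise gradient and divergence. Spaces. $H^1(\mathcal T)=\{w\in L^2(\Omega): w|_T\in H^1(T)\ \forall T\in\mathcal T\}$, $\boldsymbol H(\mathrm{div},\mathcal T)=\{\boldsymbol q\in L^2(\Omega)^d:\boldsymbol q|_T\in\boldsymbol H(\mathrm{div},T)\ \forall T\in\mathcal T\}$. $H^{1/2}(\mathcal S)$ is the set of $\widehat u\in\prod_{T}H^{1/2}(\partial T)$ for which there is $w\in H^1(\Omega)$ with $\widehat u|_{\partial T}=w|_{\partial T}$ for all $T$; $H^{-1/2}(\mathcal S)$ is the set of $\widehat\sigma\in\prod_T H^{-1/2}(\partial T)$ for which there is $\boldsymbol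 q\in\boldsymbol H(\mathrm{div},\Omega)$ with $\widehat\sigma|_{\partial T}=(\boldsymbol q\cdot\boldsymbol n_T)|_{\partial T}$ for all $T$. Norms: $\|\widehat u\|_{1/2,\mathcal S}$ is the infimum of $(\|w\|^2+\|\nabla w\|^2)^{1/2}$ over all such $w$; $\|\widehat\sigma\|_{-1/2,\mathcal S}$ is the infimum of $(\|\boldsymbol q\|^2+\|\mathrm{div}\,\boldsymbol q\|^2)^{1/2}$ over all such $\boldsymbol q$. The restrictions to $\Gamma$ are $\widehat u|_\Gamma:=w|_\Gamma\in H^{1/2}(\Gamma)$ and $\widehat\sigma|_\Gamma:=(\boldsymbol q\cdot\boldsymbol n_\Omega)|_\Gamma\in H^{-1/2}(\Gamma)$ (independent of the chosen $w$, $\boldsymbol q$). Set $\langle\widehat u,\boldsymbol\tau\cdot\boldsymbol n\rangle_{\mathcal S}=\sum_T\langle\widehat u|_{\partial T},\boldsymbol\tau\cdot\boldsymbol n_T\rangle_{\partial T}$ and $\langle\widehat\sigma,v\rangle_{\mathcal S}=\sum_T\langle\widehat\sigma|_{\partial T},v\rangle_{\partial T}$. $U=L^2(\Omega)\times L^2(\Omega)^d\times H^{1/2}(\mathcal S)\times H^{-1/2}(\mathcal S)$ with $\|(u,\boldsymbol\sigma,\widehat u,\widehat\sigma)\|_U^2=\|u\|^2+\|\boldsymbol\sigma\|^2+\|\widehat u\|_{1/2,\mathcal S}^2+\|\widehat\sigma\|_{-1/2,\mathcal S}^2$; $V=H^1(\mathcal T)\times\boldsymbol H(\mathrm{div},\mathcal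 T)$ with $\|(v,\boldsymbol\tau)\|_V^2=\|v\|^2+\|\nabla_{\mathcal T}v\|^2+\|\boldsymbol\tau\|^2+\|\mathrm{div}_{\mathcal T}\boldsymbol\tau\|^2$ and the inner product $(\cdot,\cdot)_V$ inducing it. Forms. For $\boldsymbol u=(u,\boldsymbol\sigma,\widehat u,\widehat\sigma)\in U$, $\boldsymbol v=(v,\boldsymbol\tau)\in V$: $b(\boldsymbol u,\boldsymbol v)=(\boldsymbol\sigma,\nabla_{\mathcal T}v)+(u,v)-\langle\widehat\sigma,v\rangle_{\mathcal S}+(\boldsymbol\sigma,\boldsymbol\tau)+(u,\mathrm{div}_{\mathcal T}\boldsymbol\tau)-\langle\widehat u,\boldsymbol\tau\cdot\boldsymbol n\rangle_{\mathcal S}$, $L(\boldsymbol v)=(f,v)$. $B:U\to V'$ is the operator induced by $b$, $(B\boldsymbol u)(\boldsymbol v)=b(\boldsymbol u,\boldsymbol v)$. The operator $\Theta:U\to V$ is defined by $(\Theta\boldsymbol u,\boldsymbol v)_V=b(\boldsymbol u,\boldsymbol v)$ for all $\boldsymbol v\in V$, and $\Theta_\beta:=\beta\Theta$. Trace operators: $\gamma_0\boldsymbol u=\widehat u|_\Gamma$, $\gamma_{\boldsymbol n}\boldsymbol u=\widehat\sigma|_\Gamma$. For $\boldsymbol u,\boldsymbol v\in U$: $a^s(\boldsymbol u,\boldsymbol v)=b(\boldsymbol u,\Theta_\beta\boldsymbol v)+\tfrac12(\langle\gamma_{\boldsymbol n}\boldsymbol u,\gamma_0\boldsymbol v\rangle_\Gamma+\langle\gamma_{\boldsymbol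 n}\boldsymbol v,\gamma_0\boldsymbol u\rangle_\Gamma)$, $F(\boldsymbol v)=L(\Theta_\beta\boldsymbol v)$. Orderings and cones. $\widehat v\ge0$ in $H^{1/2}(\Gamma)$ means that $\widehat v$ is the weak $H^{1/2}(\Gamma)$-limit of a sequence of non-negative Lipschitz continuous functions on $\Gamma$. $\widehat\sigma\ge0$ in $H^{-1/2}(\Gamma)$ means $\langle\widehat\sigma,\widehat v\rangle_\Gamma\ge0$ for all $\widehat v\in H^{1/2}(\Gamma)$ with $\widehat v\ge0$. $K^s=\{\boldsymbol u\in U:\gamma_0\boldsymbol u\ge0,\ \gamma_{\boldsymbol n}\boldsymbol u\ge0\}$. Discrete spaces. $U_h=P^0(\mathcal T)\times[P^0(\mathcal T)]^d\times S^1(\mathcal S)\times P^0(\mathcal S)\subset U$, where $P^0(\mathcal T)$ are the $\mathcal T$-element-wise constants, $P^0(\mathcal S)\subset H^{-1/2}(\mathcal S)$ consists of those elements that are constant on each facet of each $\partial T$, and $S^1(\mathcal S)\subset H^{1/2}(\mathcal S)$ consists of the globally continuous functions on the skeleton that are affine on each facet. $K_h^s=K^s\cap U_h$. Estimator notation. $V(T)=H^1(T)\times\boldsymbol H(\mathrm{div},T)$ with canonical norm $\|(v,\boldsymbol\tau)\|_{V(T)}^2=\|v\|_T^2+\|\nabla v\|_T^2+\|\boldsymbol\tau\|_T^2+\|\mathrm{div}\,\boldsymbol\tau\|_T^2$ ($\|\cdot\|_T$ the $L^2(T)$ norm), $R_T:V(T)\to(V(T))'$ the Riesz isomorphism, $\iota_T:V(T)\to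 V$ the canonical embedding (extension by zero) and $\iota_T^*:V'\to(V(T))'$ its dual. $\langle\cdot,\cdot\rangle_E$ is the $L^2(E)$ inner product. *)

(* Defs.v *)
From HB Require Import structures.
From mathcomp Require Import all_boot all_order all_algebra.
From mathcomp Require Import all_classical all_reals all_analysis.
Set Implicit Arguments.
Unset Strict Implicit.
Unset Printing Implicit Defensive.
Import Order.TTheory GRing.Theory Num.Theory.
Import numFieldNormedType.Exports.
Local Open Scope classical_set_scope.
Local Open Scope ring_scope.

(* R^n is 'rV[R]_n, with the sigma-algebra generated by the coordinates. *)
Definition rV_display : measure_display -> measure_display.
Proof. exact. Qed.

Section measurable_rV.
Context {R : realType}.
Variable n : nat.

Let coors : 'I_n -> 'rV[R]_n -> R := fun i x => x 0 i.

Let rV_set0 : g_sigma_preimage coors set0.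
Proof. exact: sigma_algebra0. Qed.

Let rV_setC A : g_sigma_preimage coors A -> g_sigma_preimage coors (~` A).
Proof. exact: sigma_algebraC. Qed.

Let rV_bigcup (F : _^nat) : (forall i, g_sigma_preimage coors (F i)) ->
  g_sigma_preimage coors (\bigcup_i (F i)).
Proof. exact: sigma_algebra_bigcup. Qed.

HB.instance Definition _ := @isMeasurable.Build (rV_display default_measure_display)
  'rV[R]_n (g_sigma_preimage coors) rV_set0 rV_setC rV_bigcup.

End measurable_rV.

Section leb.
Variable R : realType.

Lemma measurable_coord n (i : 'I_n) :
  measurable_fun [set: 'rV[R]_n] (fun x => x 0 i).
Proof.
move=> _ Y mY; rewrite setTI; apply: sub_sigma_algebra => /=.
rewrite -bigcup_seq/=; exists i => /=; first by rewrite mem_index_enum.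
by exists Y => //; rewrite setTI.
Qed.

Lemma measurable_fun_rV d (T : measurableType d) n (f : T -> 'rV[R]_n) :
  (forall i, measurable_fun [set: T] (fun x => f x 0 i)) ->
  measurable_fun [set: T] f.
Proof.
move=> mf _ A mA; rewrite setTI.
suff : measurable `<=` image_set_system [set: T] f measurable.
  by move=> /(_ _ mA); rewrite /image_set_system /= setTI.
apply: smallest_sub; first exact: (sigma_algebra_image _ (sigma_algebra_measurable T)).
rewrite -bigcup_seq/=; apply: bigcup_sub => i _ B [Y mY <-].
rewrite /image_set_system /= !setTI.
by rewrite -[X in measurable X]setTI; exact: mf.
Qed.

Section cons.
Variables (n : nat) (mu : {sigma_finite_measure set 'rV[R]_n -> \bar R}).

Definition rV_cons (p : measurableTypeR R * 'rV[R]_n) : 'rV[R]_n.+1 :=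
  row_mx (\row_(_ < 1) p.1) p.2.

Lemma measurable_rV_cons : measurable_fun [set: measurableTypeR R * 'rV[R]_n] rV_cons.
Proof.
apply: measurable_fun_rV => i; rewrite /rV_cons.
case: (@splitP 1 n i) => j ij.
  rewrite (_ : (fun _ => _) = fst); first exact: measurable_fst.
  apply/funext => x; have -> : i = lshift n j by apply/val_inj.
  by rewrite (@row_mxEl _ 1 1) mxE.
rewrite (_ : (fun _ => _) = (fun y : 'rV[R]_n => y 0 j) \o snd).
  by apply: measurableT_comp; [exact: measurable_coord|exact: measurable_snd].
apply/funext => x; have -> : i = rshift 1 j by apply/val_inj.
by rewrite (@row_mxEr _ 1 1).
Qed.

Definition cons_measure : set 'rV[R]_n.+1 -> \bar R :=
  pushforward (lebesgue_measure \x mu)%E rV_cons.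

Let cons_measure0 : cons_measure set0 = 0%E.
Proof. by rewrite /cons_measure /pushforward preimage_set0 measure0. Qed.

Let mpre A : measurable A -> measurable (rV_cons @^-1` A).
Proof.
move=> mA; rewrite -[X in measurable X]setTI.
exact: measurable_rV_cons.
Qed.

Let cons_measure_ge0 A : (0 <= cons_measure A)%E.
Proof. by rewrite /cons_measure /pushforward measure_ge0. Qed.

Let cons_measure_sigma_additive : semi_sigma_additive cons_measure.
Proof.
move=> F mF tF mUF; rewrite /cons_measure /pushforward preimage_bigcup.
apply: measure_semi_sigma_additive.
- by move=> k; exact: mpre.
- apply/trivIsetP => /= i j _ _ ij; rewrite -preimage_setI.
  by move/trivIsetP : tF => /(_ _ _ _ _ ij) ->//; rewrite preimage_set0.
- by rewrite -preimage_bigcup; exact: mpre.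
Qed.

HB.instance Definition _ := isMeasure.Build _ _ _ cons_measure
  cons_measure0 cons_measure_ge0 cons_measure_sigma_additive.

Let cons_measure_sigma_finite : sigma_finite [set: 'rV[R]_n.+1] cons_measure.
Proof.
have /sigma_finiteP[F [TF ndF Foo]] := sigma_finiteT (@lebesgue_measure R).
have /sigma_finiteP[G [TG ndG Goo]] := sigma_finiteT mu.
pose unc (x : 'rV[R]_n.+1) : measurableTypeR R * 'rV[R]_n := (x 0 0, rsubmx (x : 'rV_(1 + n))).
have consK : cancel rV_cons unc.
  move=> [a b]; rewrite /unc /rV_cons; congr (_, _); last by rewrite row_mxKr.
  have -> : 0 = lshift n (ord0 : 'I_1) by apply/val_inj.
  by rewrite (@row_mxEl _ 1 1) mxE.
have munc : measurable_fun [set: 'rV[R]_n.+1] unc.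
  apply/measurable_fun_pairP; split.
    exact: measurable_coord.
  apply: measurable_fun_rV => i.
  rewrite (_ : (fun _ => _) = fun x : 'rV[R]_n.+1 => x 0 (rshift 1 i : 'I_(1 + n))).
    exact: measurable_coord.
  by apply/funext => x /=; rewrite mxE.
exists (fun k => unc @^-1` (F k `*` G k)).
  apply/esym; rewrite -subTset => x _.
  have [k _ Fx] : (\bigcup_k F k) (unc x).1 by rewrite -TF.
  have [l _ Gx] : (\bigcup_k G k) (unc x).2 by rewrite -TG.
  exists (maxn k l) => //; split.
  - by move: Fx; exact/subsetPset/ndF/leq_maxl.
  - by move: Gx; exact/subsetPset/ndG/leq_maxr.
move=> k; have [? ?] := Foo k; have [? ?] := Goo k; split.
  rewrite -[X in measurable X]setTI; apply: munc => //; exact: measurableX.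
rewrite /cons_measure /pushforward -comp_preimage.
rewrite (_ : unc \o rV_cons = id); last by apply/funext => x /=; rewrite consK.
by rewrite preimage_id product_measure1E// lte_mul_pinfty// ge0_fin_numE.
Qed.

HB.instance Definition _ := Measure_isSigmaFinite.Build _ _ _ cons_measure
  cons_measure_sigma_finite.
End cons.

(* Lebesgue measure on R^n *)
Fixpoint leb (n : nat) : {sigma_finite_measure set 'rV[R]_n -> \bar R} :=
  match n with
  | 0 => dirac (0 : 'rV[R]_0)
  | n.+1 => cons_measure (leb n)
  end.
End leb.

(* In this file [xget 0 P] selects an element of [P]; it is only applied to
   sets [P] with at most one element up to the relevant identification
   (equality almost everywhere, equality of traces, equality on a domain). *)

Section domains.
Variables (R : realType) (n : nat).
Local Notation E := 'rV[R]_n.+1.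

Definition dotv (x y : E) : R := \sum_i x 0 i * y 0 i.

Definition bdry (A : set E) : set E := closure A `\` A°.

(* Near each boundary point, A lies below the graph of a Lipschitz function
   over the hyperplane orthogonal to a unit vector e; this function of n
   variables is encoded as a function on R^(n+1) that is constant along e. *)
Definition lipschitz_boundary (A : set E) :=
  forall x, bdry A x -> exists (e : E) (g : E -> R) (eps : R),
    [/\ dotv e e = 1, lipschitz g, forall y t, g (y + t *: e) = g y, 0 < eps &
        forall y, ball x eps y -> (A y <-> dotv y e < g y)].

Definition null_homotopic_loops (A : set E) :=
  let I : set R := `[0, 1]%classic in
  forall c : R -> E, {within I, continuous c} ->
    (forall t, I t -> A (c t)) -> c 0 = c 1 ->
  exists H : R * R -> E,
    [/\ {within I `*` I, continuous H},
        forall p, (I `*` I) p -> A (H p),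
        forall t, I t -> H (t, 0) = c t /\ H (t, 1) = c 0 &
        forall s, I s -> H (0, s) = c 0 /\ H (1, s) = c 0].

Definition simply_connected (A : set E) :=
  connected A /\ null_homotopic_loops A.

Definition lipschitz_domain (A : set E) :=
  [/\ open A, A !=set0, connected A, bounded_set A & lipschitz_boundary A].

End domains.

Section sobolev.
Variables (R : realType) (n : nat).
Local Notation E := 'rV[R]_n.+1.
Local Notation mu := (leb R n.+1).
Implicit Types (A : set E) (v w : E -> R) (q : E -> E).

(* Elements of L^2(A), H^1(A), H(div,A) are represented by functions on the
   whole space, whose values outside of A are irrelevant. *)
Definition zext (V : zmodType) A (f : E -> V) : E -> V := patch (fun=> 0) A f.

Definition L2 A v := zext A v \in Lfun mu 2%:E.
Definition L2v A q := forall i, L2 A (fun x => q x 0 i).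

Definition ip A v w : R := \int[mu]_(x in A) (v x * w x).
Definition ipv A (p q : E -> E) : R := \int[mu]_(x in A) dotv (p x) (q x).

Definition partial (i : 'I_n.+1) v : E -> R := 'D_(delta_mx 0 i) v.

Fixpoint Ck (k : nat) v : Prop :=
  continuous v /\
  if k is k'.+1 then forall i,
    (forall x, derivable v x (delta_mx 0 i)) /\ Ck k' (partial i v)
  else True.

Definition test_function A v :=
  (forall k, Ck k v) /\
  exists K : set E, [/\ compact K, K `<=` A & forall x, ~ K x -> v x = 0].

Definition is_grad A v q := L2v A q /\
  forall phi, test_function A phi -> forall i,
    ip A v (partial i phi) = - ip A (fun x => q x 0 i) phi.

Definition is_div A q v := L2 A v /\
  forall phi, test_function A phi ->
    ipv A q (fun x => \row_i partial i phi x) = - ip A v phi.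

Definition grad A v : E -> E := xget 0 [set q | is_grad A v q].
Definition div A q : E -> R := xget 0 [set v | is_div A q v].

Definition H1 A v := L2 A v /\ exists q, is_grad A v q.
Definition Hdiv A q := L2v A q /\ exists v, is_div A q v.

Definition ipH1 A v w := ip A v w + ipv A (grad A v) (grad A w).
Definition ipHdiv A (p q : E -> E) := ipv A p q + ip A (div A p) (div A q).
Definition normH1 A v := Num.sqrt (ipH1 A v v).
Definition normHdiv A q := Num.sqrt (ipHdiv A q q).

(* H^1_0(A): the closure of the test functions in H^1(A) *)
Definition H10 A v := H1 A v /\
  exists phi : nat -> E -> R, (forall k, test_function A (phi k)) /\
    normH1 A (v - phi k) @[k --> \oo] --> 0.

(* H^{1/2}(dA), the space of the traces of H^1(A), is the quotient
   H^1(A)/H^1_0(A): an element v|_dA is represented by v, and v|_dA = w|_dA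
   reads [eq_trace A v w]. *)
Definition eq_trace A v w := H10 A (v - w).

(* v|_dA is the pointwise restriction to dA of the function phi, which is
   Lipschitz on dA. *)
Definition trace_is A v (phi : E -> R) := H1 A v /\
  exists z, [/\ [lipschitz z x | x in closure A],
    forall x, bdry A x -> z x = phi x & eq_trace A v z].

(* H^{-1/2}(dA), the dual of H^{1/2}(dA): functionals on H^1(A) that vanish
   on H^1_0(A). *)
Definition Hmhalf A (l : (E -> R) -> R) :=
  [/\ forall (c : R) v w, H1 A v -> H1 A w -> l (c *: v + w) = c * l v + l w,
      forall v, H10 A v -> l v = 0 &
      exists C, forall v, H1 A v -> `|l v| <= C * normH1 A v].

(* <q.n, v>_dA for the normal component q.n in H^{-1/2}(dA) of q in
   H(div,A), through Green's formula *)
Definition normal_trace A q v : R := ipv A q (grad A v) + ip A (div A q) v.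

(* v|_dA >= 0: it is the weak limit of non-negative Lipschitz functions
   phi k on dA, whose classes in H^{1/2}(dA) are represented by w k. *)
Definition trace_ge0 A v :=
  exists (phi w : nat -> E -> R),
    (forall k, [/\ [lipschitz (phi k) x | x in bdry A],
       forall x, bdry A x -> 0 <= phi k x & trace_is A (w k) (phi k)]) /\
    forall l, Hmhalf A l -> l (w k) @[k --> \oo] --> l v.

Definition dual_ge0 A (l : (E -> R) -> R) :=
  forall v, H1 A v -> trace_ge0 A v -> 0 <= l v.

End sobolev.

Section simplices.
Variables (R : realType) (n : nat).
Local Notation E := 'rV[R]_n.+1.

Definition hull k (p : 'I_k.+1 -> E) (I : set 'I_k.+1) : set E :=
  [set x | exists t : 'I_k.+1 -> R,
    [/\ forall i, 0 <= t i, forall i, ~ I i -> t i = 0, \sum_i t i = 1 &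
        x = \sum_i t i *: p i]].

Definition edges k (p : 'I_k.+1 -> E) : 'M[R]_(k, n.+1) :=
  \matrix_(j < k) (p (lift ord0 j) - p ord0).

(* the open simplex with vertices p i *)
Definition cell (p : 'I_n.+2 -> E) : set E :=
  [set x | exists t : 'I_n.+2 -> R,
    [/\ forall i, 0 < t i, \sum_i t i = 1 & x = \sum_i t i *: p i]].

Definition ref_simplex k : set 'rV[R]_k :=
  [set t | (forall j, 0 <= t 0 j) /\ \sum_j t 0 j <= 1].

Definition simplex_map k (p : 'I_k.+1 -> E) (t : 'rV[R]_k) : E :=
  p ord0 + t *m edges p.

(* k-dimensional surface integral over the k-simplex with vertices p i *)
Definition simplex_int k (p : 'I_k.+1 -> E) (g : E -> R) : R :=
  Num.sqrt (\det (edges p *m (edges p)^T)) *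
  \int[leb R k]_(t in @ref_simplex k) g (simplex_map p t).

Definition simplex_L2 k (p : 'I_k.+1 -> E) (g : E -> R) :=
  patch (fun=> 0) (@ref_simplex k) (g \o simplex_map p) \in Lfun (leb R k) 2%:E.

(* vertices of the facet opposite to the vertex p k *)
Definition facet (p : 'I_n.+2 -> E) (k : 'I_n.+2) : 'I_n.+1 -> E :=
  fun j => p (lift k j).

Definition bdry_int (p : 'I_n.+2 -> E) (g : E -> R) : R :=
  \sum_k simplex_int (facet p k) g.

End simplices.

Section dpg.
Variables (R : realType) (n : nat).
Local Notation E := 'rV[R]_n.+1.
Variables (Omega : set E) (N : nat) (a : 'I_N -> 'I_n.+2 -> E).

Local Notation T i := (cell (a i)).
Local Notation Gamma := (bdry Omega).

Definition conforming_mesh :=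
  [/\ forall i, edges (a i) \in unitmx,
      forall i j, T i = T j -> i = j,
      forall i, T i `<=` Omega,
      \bigcup_i closure (T i) = closure Omega &
      forall i j, closure (T i) `&` closure (T j) =
        hull (a i) [set k | exists l, a i k = a j l]].

(* Elements of H^{1/2}(S) are represented by families (w_i) of w_i in
   H^1(T i), standing for the traces w_i|_dT i. *)
Definition lift0 (uhat : 'I_N -> E -> R) (w : E -> R) :=
  H1 Omega w /\ forall i, eq_trace (T i) (uhat i) w.
Definition Hhalf_skel uhat :=
  (forall i, H1 (T i) (uhat i)) /\ exists w, lift0 uhat w.
Definition norm_half uhat : R := inf [set normH1 Omega w | w in lift0 uhat].

(* Elements of H^{-1/2}(S) are families of elements of H^{-1/2}(dT i), that
   is, of functionals on H^1(T i), relevant on H^1(T i) only. *)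
Definition liftn (shat : 'I_N -> (E -> R) -> R) (q : E -> E) :=
  Hdiv Omega q /\
  forall i v, H1 (T i) v -> shat i v = normal_trace (T i) q v.
Definition Hmhalf_skel shat := exists q, liftn shat q.
Definition norm_mhalf shat : R := inf [set normHdiv Omega q | q in liftn shat].

Definition spaceU : Type :=
  ((E -> R) * (E -> E) * ('I_N -> E -> R) * ('I_N -> (E -> R) -> R))%type.
Implicit Types x y : spaceU.
Definition fldU x : E -> R := x.1.1.1.
Definition fluxU x : E -> E := x.1.1.2.
Definition trU x : 'I_N -> E -> R := x.1.2.
Definition ntrU x : 'I_N -> (E -> R) -> R := x.2.

Definition inU x :=
  [/\ L2 Omega (fldU x), L2v Omega (fluxU x), Hhalf_skel (trU x) &
      Hmhalf_skel (ntrU x)].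

Definition normU x : R := Num.sqrt
  (ip Omega (fldU x) (fldU x) + ipv Omega (fluxU x) (fluxU x) +
   norm_half (trU x) ^+ 2 + norm_mhalf (ntrU x) ^+ 2).

Definition spaceV : Type := ((E -> R) * (E -> E))%type.
Implicit Types z t : spaceV.

Definition inVT i z := H1 (T i) z.1 /\ Hdiv (T i) z.2.
Definition inV z :=
  [/\ L2 Omega z.1, L2v Omega z.2 & forall i, inVT i z].

(* piecewise gradient and divergence *)
Definition pgrad (v : E -> R) : E -> E := \sum_i zext (T i) (grad (T i) v).
Definition pdiv (q : E -> E) : E -> R := \sum_i zext (T i) (div (T i) q).

Definition ipV z t : R :=
  ip Omega z.1 t.1 + ipv Omega (pgrad z.1) (pgrad t.1) +
  ipv Omega z.2 t.2 + ip Omega (pdiv z.2) (pdiv t.2).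

Definition bform x z : R :=
  ipv Omega (fluxU x) (pgrad z.1) + ip Omega (fldU x) z.1
  - \sum_i ntrU x i z.1
  + ipv Omega (fluxU x) z.2 + ip Omega (fldU x) (pdiv z.2)
  - \sum_i normal_trace (T i) z.2 (trU x i).

Definition Theta x : spaceV :=
  xget 0 [set t | inV t /\ forall z, inV z -> ipV t z = bform x z].
Definition Theta_ (beta : R) x : spaceV := beta *: Theta x.

(* the traces on Gamma: gamma0 x is a representative in H^1(Omega) of an
   element of H^{1/2}(Gamma), gamman x is a functional on H^1(Omega) *)
Definition gamma0 x : E -> R := xget 0 [set w | lift0 (trU x) w].
Definition gamman x : (E -> R) -> R :=
  normal_trace Omega (xget 0 [set q | liftn (ntrU x) q]).

Definition a_s beta x y : R :=
  bform x (Theta_ beta y) +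
  2^-1 * (gamman x (gamma0 y) + gamman y (gamma0 x)).

Definition Lform (f : E -> R) z : R := ip Omega f z.1.
Definition Fform f beta y : R := Lform f (Theta_ beta y).

Definition Ks x :=
  [/\ inU x, trace_ge0 Omega (gamma0 x) & dual_ge0 Omega (gamman x)].

Definition P0 (V : Type) (v : E -> V) :=
  exists c : 'I_N -> V, forall i (p : E), T i p -> v p = c i.

Definition S1_skel (uhat : 'I_N -> E -> R) :=
  exists phi : E -> R,
    [/\ {within \bigcup_i bdry (T i), continuous phi},
        forall i k, exists (c : E) (e : R), forall p : E,
          hull (facet (a i) k) setT p -> phi p = dotv c p + e &
        forall i, trace_is (T i) (uhat i) phi].

(* On each dT i, the functional is the L^2(dT i) pairing with a function
   that is constant on each facet. *)
Definition P0_skel (shat : 'I_N -> (E -> R) -> R) :=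
  exists c : 'I_N -> 'I_n.+2 -> R, forall i v,
    [lipschitz v x | x in closure (T i)] ->
    shat i v = \sum_k c i k * simplex_int (facet (a i) k) v.

Definition inUh x :=
  [/\ inU x, P0 (fldU x), P0 (fluxU x), S1_skel (trU x) & P0_skel (ntrU x)].

Definition Khs x := Ks x /\ inUh x.

Definition ipVT i z t : R := ipH1 (T i) z.1 t.1 + ipHdiv (T i) z.2 t.2.
Definition normVT i z : R := Num.sqrt (ipVT i z z).
Definition iota_ i z : spaceV := (zext (T i) z.1, zext (T i) z.2).
Definition riesz_inv i (l : spaceV -> R) : spaceV :=
  xget 0 [set t | inVT i t /\ forall z, inVT i z -> ipVT i t z = l z].

Definition eta2_cell f beta x i : R :=
  beta * normVT i (riesz_inv i (fun z => Lform f (iota_ i z) - bform x (iota_ i z))) ^+ 2.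

(* gamma0 x and gamman x as functions on Gamma, when they are functions *)
Definition gamma0_fun x : E -> R :=
  xget 0 [set phi | [lipschitz phi y | y in Gamma] /\
                    trace_is Omega (gamma0 x) phi].
Definition gamman_fun x : E -> R :=
  xget 0 [set s |
    (forall i k, simplex_L2 (facet (a i) k) (zext Gamma s)) /\
    forall v, [lipschitz v y | y in closure Omega] ->
      gamman x v = \sum_i bdry_int (a i) (zext Gamma (s * v))].

(* The boundary elements E = dT i `&` Gamma are indexed by i: two different
   cells can only share such a set when its surface measure vanishes. *)
Definition eta2_bdry x i : R :=
  bdry_int (a i) (zext Gamma (gamman_fun x * gamma0_fun x)).

End dpg.

(* Main.v *)
(* Crel = 4 works. Let D(x, y) = <gamma_n x, gamma_0 y>_Gamma, which is a sum over
   the cells. For x = (u, sigma, uhat, shat) and Theta x = (v, tau), the function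
   m = u - div_T tau is in H^1(Omega), with gradient sigma - tau and trace uhat,
   and p = sigma - grad_T v is in H(div, Omega), with divergence u - v and normal
   trace shat. Hence D(x, x) = (p, grad m) + (div p, m) is at least
   |m|_1^2 / 2 - |Theta x|^2, and |x|_U^2 <= 5 |m|_1^2 + 6 |Theta x|^2. In the
   variational inequality for u tested with u_h, the cone conditions make
   D(u, u_h) and D(u_h, u) non-negative and the residual is bounded cell by cell
   through the Riesz map; with x = u - u_h and beta >= 2 this leaves
   |m|_1^2 + |Theta x|^2 <= 2 eta^2.
   The boundary part of eta^2 is D(u_h, u_h): gamma_0 u_h is the trace of a single
   Lipschitz function on the closure of Omega, since any two simplices of a
   conforming mesh are separated linearly in the distance to their common face,
   and gamma_n u_h is a signed combination of the surface measures of the facets,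
   which vanishes inside Omega because it kills test functions and has a bounded
   density with respect to the sum of these surface measures. *)
From HB Require Import structures.
Require Import Defs.
From mathcomp Require Import all_boot all_order all_algebra.
From mathcomp Require Import all_classical all_reals all_analysis.
From mathcomp Require Import measurable_realfun ring lra.
Set Implicit Arguments.
Unset Strict Implicit.
Unset Printing Implicit Defensive.
Import Order.TTheory GRing.Theory Num.Theory.
Import numFieldNormedType.Exports.
Local Open Scope classical_set_scope.
Local Open Scope ring_scope.

(** * Semi-inner products *)

(** The trace norms are infima over liftings, so bounding the norm of x only requires one lifting of
    each trace, and Theta x provides both: its equation, tested with functions supported in one
    cell, is Green's formula for m and for p. No trace, inverse or Poincare inequality enters, which
    is why no constant sees the mesh or the domain. The work lies elsewhere. Functions are
    representatives, and gradients and divergences are chosen ones, so the forms are only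
    semi-definite and identities between gradients hold up to null vectors; [semi_inner] is the
    common frame, and existence always comes from the minimisation in [riesz_min]. That m has the
    trace uhat on a cell rests on the fact that an H^1 function on which all normal traces vanish
    belongs to H^1_0. In the boundary term, gamma_n u_h is explicit on Lipschitz functions only,
    while the estimator selects some density and some trace function: it must be shown that such
    selections exist and that any of them gives the pairing D(u_h, u_h). *)

Section semi_inner.
Variables (R : realType) (W : lmodType R).
Implicit Types (X S : set W) (B : W -> W -> R).

Record subspace X : Prop := Subspace {
  sub0 : X 0;
  subL : forall c x y, X x -> X y -> X (c *: x + y) }.

Lemma subD X x y : subspace X -> X x -> X y -> X (x + y).
Proof. by move=> sX Xx Xy; rewrite -(scale1r x); exact: subL. Qed.
Lemma subZ X c x : subspace X -> X x -> X (c *: x).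
Proof. by move=> sX Xx; rewrite -(addr0 (c *: x)); apply: subL => //; exact: sub0. Qed.
Lemma subB X x y : subspace X -> X x -> X y -> X (x - y).
Proof. by move=> sX Xx Xy; rewrite addrC -scaleN1r; exact: subL. Qed.

(** Definiteness is left out: elements are functions, not classes, so those vanishing almost
    everywhere are null vectors. The laws are asked on X only, because off X the integrals may be
    undefined and take default values. *)
Record semi_inner X B : Prop := SemiInner {
  siX :> subspace X;
  siL : forall c x y z, X x -> X y -> X z -> B (c *: x + y) z = c * B x z + B y z;
  siC : forall x y, X x -> X y -> B x y = B y x;
  si_ge0 : forall x, X x -> 0 <= B x x }.

Section theory.
Variables (X : set W) (B : W -> W -> R).
Hypothesis BX : semi_inner X B.

Lemma siD x y z : X x -> X y -> X z -> B (x + y) z = B x z + B y z.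
Proof. by move=> Xx Xy Xz; rewrite -[x in LHS]scale1r (siL BX) // mul1r. Qed.
Lemma si0 z : X z -> B 0 z = 0.
Proof.
move=> Xz; have X0 := sub0 BX.
by have := siD X0 X0 Xz; rewrite addr0 => /eqP; rewrite -subr_eq0 opprD addNKr oppr_eq0 => /eqP.
Qed.
Lemma siZ c x z : X x -> X z -> B (c *: x) z = c * B x z.
Proof.
move=> Xx Xz; rewrite -[c *: x]addr0 (siL BX) // ?si0 ?addr0 //; exact: sub0 BX.
Qed.
Lemma siN x z : X x -> X z -> B (- x) z = - B x z.
Proof. by move=> Xx Xz; rewrite -scaleN1r siZ // mulN1r. Qed.
Lemma siBl x y z : X x -> X y -> X z -> B (x - y) z = B x z - B y z.
Proof.
move=> Xx Xy Xz; rewrite siD ?siN //; rewrite -scaleN1r; exact: (subZ _ BX).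
Qed.
Lemma siDr x y z : X x -> X y -> X z -> B z (x + y) = B z x + B z y.
Proof.
move=> Xx Xy Xz; have Xxy := subD BX Xx Xy.
by rewrite (siC BX Xz Xxy) siD // (siC BX Xx Xz) (siC BX Xy Xz).
Qed.
Lemma siZr c x z : X x -> X z -> B z (c *: x) = c * B z x.
Proof.
move=> Xx Xz; have Xcx := subZ c BX Xx.
by rewrite (siC BX Xz Xcx) siZ // (siC BX Xx Xz).
Qed.
Lemma si_sqrD c x y : X x -> X y ->
  B (c *: x + y) (c *: x + y) = c ^+ 2 * B x x + 2 * c * B x y + B y y.
Proof.
move=> Xx Xy; have Xcx := subZ c BX Xx.
have Xs := subD BX Xcx Xy.
by rewrite siD // !siDr // !siZ // !siZr // (siC BX Xy Xx); ring.
Qed.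

Lemma si_sqrB x y : X x -> X y -> B (x - y) (x - y) = B x x - 2 * B x y + B y y.
Proof.
by move=> Xx Xy; rewrite addrC -scaleN1r si_sqrD // (siC BX Xy Xx) //; ring.
Qed.

Lemma si_CS x y : X x -> X y -> B x y ^+ 2 <= B x x * B y y.
Proof.
move=> Xx Xy.
have H t : 0 <= t ^+ 2 * B x x + 2 * t * B x y + B y y.
  by rewrite -si_sqrD //; apply: (si_ge0 BX); exact: (subL BX).
have := si_ge0 BX Xx; rewrite le_eqVlt => /orP[/eqP bx0|bx0].
  rewrite -bx0 mul0r; have [->|bxy] := eqVneq (B x y) 0; first by rewrite expr0n.
  (* In the degenerate case the quadratic is affine in t, and this t gives it the value -1. *)
  have := H (- (B y y + 1) / (2 * B x y)); rewrite -bx0 mulr0 add0r.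
  rewrite (_ : 2 * _ * _ = - (B y y + 1)); last by field.
  by rewrite opprD addrAC addNr add0r ler0N1.
have := H (- B x y / B x x).
rewrite (_ : _ + _ = B y y - (B x y ^+ 2 / B x x)); last by field; rewrite gt_eqF.
by rewrite subr_ge0 ler_pdivrMr // mulrC.
Qed.

Lemma si_null x z : X x -> X z -> B x x = 0 -> B x z = 0.
Proof.
move=> Xx Xz bx; have := si_CS Xx Xz; rewrite bx mul0r => h.
by apply/eqP; rewrite -sqrf_eq0 eq_le h sqr_ge0.
Qed.

Lemma si_sqrD_le x y : X x -> X y -> B (x + y) (x + y) <= 2 * B x x + 2 * B y y.
Proof.
move=> Xx Xy; have /(si_ge0 BX) := subB BX Xx Xy; rewrite si_sqrB //.
by have := si_sqrD 1 Xx Xy; rewrite scale1r => ->; lra.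
Qed.

End theory.

Definition si_cvg B (s : nat -> W) (t : W) := forall e, 0 < e ->
  exists N, forall n, (N <= n)%N -> B (t - s n) (t - s n) <= e.

Definition complete_in S X B := forall s : nat -> W, (forall k, S (s k)) ->
  (forall e, 0 < e -> exists N, forall m n, (N <= m)%N -> (N <= n)%N ->
     B (s m - s n) (s m - s n) <= e) ->
  exists2 t, X t & si_cvg B s t.

(** Minimises [J x = B x x - 2 * l x], as in the direct proof of the Riesz theorem. S need not be
    closed in X: the representative t is only a limit of elements of S, and the conclusion keeps
    that sequence. With the test functions as S it yields projections onto H^1_0 and weak
    derivatives; with S = X it is the usual representation theorem. *)
Lemma riesz_min X S B (l : W -> R) (C : R) : semi_inner X B -> subspace S ->
  S `<=` X -> complete_in S X B ->
  (forall c x y, S x -> S y -> l (c *: x + y) = c * l x + l y) ->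
  (forall x, S x -> l x ^+ 2 <= C * B x x) ->
  exists t, [/\ X t, forall z, S z -> B t z = l z &
    exists s, (forall k : nat, S (s k)) /\ si_cvg B s t].
Proof.
move=> BX sS SX cS lL lC.
have l0 : l 0 = 0.
  have := lL 1 0 0 (sub0 sS) (sub0 sS); rewrite scaler0 addr0 mul1r => /eqP.
  by rewrite -subr_eq0 opprD addNKr oppr_eq0 => /eqP.
have lZ c x : S x -> l (c *: x) = c * l x.
  by move=> Sx; rewrite -[c *: x]addr0 lL ?l0 ?addr0 //; exact: sub0.
pose J x := B x x - 2 * l x.
have Jlb x : S x -> - `|C| <= J x.
  move=> Sx; rewrite /J; have b0 := si_ge0 BX (SX _ Sx).
  have h : l x ^+ 2 <= `|C| * B x x.
    by apply: le_trans (lC _ Sx) _; rewrite ler_wpM2r // ler_norm.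
  suff : 2 * l x <= B x x + `|C| by lra.
  rewrite leNgt; apply/negP => h2.
  have c0 := normr_ge0 C.
  have : (B x x + `|C|) ^+ 2 < (2 * l x) ^+ 2 by rewrite ltr_pXn2r // nnegrE; lra.
  by have := sqr_ge0 (B x x - `|C|); nra.
have SJ0 : [set J x | x in S] !=set0 by exists (J 0), 0 => //; exact: sub0.
have lbJ : has_lbound [set J x | x in S] by exists (- `|C|) => _ [x Sx <-]; exact: Jlb.
pose d := inf [set J x | x in S].
have dJ x : S x -> d <= J x by move=> Sx; apply: ge_inf => //; exists x.
have /choice[s Hs] k : exists x, S x /\ J x <= d + k.+1%:R^-1.
  have e0 : 0 < (k.+1%:R : R)^-1 by rewrite invr_gt0.
  have [_ [x Sx <-] Jx] := inf_adherent e0 (conj SJ0 lbJ).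
  by exists x; split => //; exact: ltW.
have Ss k := (Hs k).1; have Js k := (Hs k).2.
have Bs m n : B (s m - s n) (s m - s n) <= 2 * m.+1%:R^-1 + 2 * n.+1%:R^-1.
  have Xm := SX _ (Ss m); have Xn := SX _ (Ss n).
  (* The midpoint lies in S, so [J] is at least d there; the parallelogram identity then makes a
     minimising sequence Cauchy. *)
  have Sh : S (2^-1 *: s m + 2^-1 *: s n) by apply: subL => //; exact: subZ.
  have := dJ _ Sh; rewrite /J; have Xn2 := subZ 2^-1 BX Xn; have Sn2 := subZ 2^-1 sS (Ss n).
  rewrite (si_sqrD BX) //.
  rewrite lL // lZ // !(siZ BX) // !(siZr BX) // (si_sqrB BX) //.
  have := Js m; have := Js n; rewrite /J => h1 h2 h3.
  move: (m.+1%:R^-1) (n.+1%:R^-1) h1 h2 h3 => i j h1 h2 h3; lra.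
have inv_small e : 0 < e -> exists N, forall n, (N <= n)%N -> (n.+1%:R : R)^-1 <= e.
  move=> e0; exists (Num.truncn e^-1) => n hn.
  rewrite invf_ple ?posrE //.
  have := truncnS_gt e^-1 => h; apply/ltW; apply: lt_le_trans h _.
  by rewrite ler_nat.
have [t Xt ts] : exists2 t, X t & si_cvg B s t.
  apply: cS => // e e0; have e40 : 0 < e / 4 by rewrite divr_gt0.
  have [N hN] := inv_small _ e40.
  exists N => m n /hN hm /hN hn; apply: le_trans (Bs m n) _; move: (m.+1%:R^-1) (n.+1%:R^-1) hm hn => i j hm hn; lra.
exists t; split => //; last by exists s.
move=> z Sz; have Xz := SX _ Sz; apply/eqP; rewrite -subr_eq0; set r := B t z - l z.
have b0 := si_ge0 BX Xz; set b := B z z in b0.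
(* First variation of [J] in the direction z. As t may lie outside S, [J] is compared at s k and at
   s k + c z for large k, and t enters only through its closeness to s k. *)
have key c : 0 <= 2 * c * r + c ^+ 2 * b.
  rewrite leNgt; apply/negP => h.
  (* The product e K bounds the total error: e for the defect of s k as a minimiser, and 2 |c| e (b
     + 1) for replacing s k by t in the linear term. The choice of e makes it half of the assumed
     gap. *)
  pose K := 1 + 2 * `|c| * (b + 1); have c0 := normr_ge0 c.
  have K0 : 0 < K by rewrite /K; nra.
  pose e := - (2 * c * r + c ^+ 2 * b) / (2 * K).
  have e0 : 0 < e by rewrite divr_gt0 //; lra.
  have [N1 h1] := inv_small _ e0; have [N2 h2] := ts _ (exprn_gt0 2 e0).
  pose k := maxn N1 N2; have {h1} h1 := h1 k (leq_maxl _ _).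
  have {h2} h2 := h2 k (leq_maxr _ _).
  have Xk := SX _ (Ss k).
  have Sk : S (c *: z + s k) by exact: subL.
  have := dJ _ Sk; have := Js k; rewrite /J (si_sqrD BX) // lL //.
  have Xtk := subB BX Xt Xk.
  have := si_CS BX Xtk Xz; rewrite (siBl BX) // (siC BX Xz Xk) -/b.
  set p := B (s k) z; set q := B (s k) (s k); set D := B _ (_ - _) in h2 * => h3 h4 h5.
  have h6 : `|B t z - p| <= e * (b + 1).
    rewrite -(ler_pXn2r (ltn0Sn 1)) ?nnegrE ?normr_ge0 //; last by nra.
    rewrite real_normK ?num_real //; apply: le_trans h3 _.
    rewrite exprMn; apply: ler_pM => //; [exact: (si_ge0 BX) |nra].
  have h7 : 2 * c * (B t z - p) >= - (2 * `|c| * (e * (b + 1))).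
    have : `|2 * c * (B t z - p)| <= 2 * `|c| * (e * (b + 1)).
      by rewrite !normrM (ger0_norm (x := 2)) // ler_wpM2l // mulr_ge0.
    by rewrite ler_norml => /andP[].
  have eK : e * K * 2 = - (2 * c * r + c ^+ 2 * b).
    by rewrite /e; field; rewrite gt_eqF.
  have h8 : 0 <= c ^+ 2 * b + 2 * c * r + e * K.
    rewrite /K /r; move: (k.+1%:R^-1) h1 h4 => i h1 h4; lra.
  have : 0 < e * K by rewrite mulr_gt0.
  lra.
have [//|r0] := eqVneq r 0.
(* The expression becomes -r^2 (b + 2) / (b + 1)^2, negative for nonzero r; b + 1 in place of b
   avoids a division by 0 when z is null. *)
have := key (- r / (b + 1)).
rewrite (_ : _ + _ = - (r ^+ 2 * (b + 2) / (b + 1) ^+ 2)); last by field; lra.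
rewrite oppr_ge0 leNgt => /negP[]; rewrite divr_gt0 //.
  by rewrite mulr_gt0 //; [rewrite exprn_even_gt0|lra].
by rewrite exprn_gt0; lra.
Qed.

End semi_inner.

(** * Square-integrable functions *)

Section L2_complete.
Context d (T : measurableType d) (R : realType) (mu : {measure set T -> \bar R}).
Implicit Types f g : T -> R.
Local Notation sqi := (fun f => f \in Lfun mu 2%:E).

Lemma Lfun2P f : f \in Lfun mu 2%:E <->
  measurable_fun setT f /\ (\int[mu]_x (f x ^+ 2)%:E < +oo)%E.
Proof.
split=> [fL|[mf fi]].
  move: (fL); rewrite inE => /andP[/[!inE]/= mf _]; split => //.
  exact: (integrable_lty measurableT (Lfun2_integrable_sqr fL)).
apply/andP; rewrite !inE /=; split => //.
rewrite /finite_norm unlock /= poweR_lty //.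
by under eq_integral => x _ do rewrite powR_mulrn // real_normK ?num_real //.
Qed.

Lemma Lfun2M_integrable f g : f \in Lfun mu 2%:E -> g \in Lfun mu 2%:E ->
  mu.-integrable setT (EFin \o (fun x => f x * g x)).
Proof. by move=> fL gL; apply/Lfun1_integrable; exact: Lfun2_mul_Lfun1. Qed.

Definition ip2 f g : R := \int[mu]_x (f x * g x).

Lemma L2_semi_inner : semi_inner [set f : T -> R | f \in Lfun mu 2%:E] ip2.
Proof.
have sL : subspace [set f : T -> R | f \in Lfun mu 2%:E].
  have le12 : (1 <= 2%:E :> \bar R)%E by rewrite lee_fin ler1n.
  have [h0 hL] := Lfun_submod_closed mu le12.
  by split => [|c x y xL yL] //=; apply: hL.
split => //=.
- move=> c f g h fL gL hL.
  rewrite /ip2 -RintegralZl //; last exact: Lfun2M_integrable.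
  rewrite -RintegralD //; first last.
  + exact: Lfun2M_integrable.
  + have cf : c *: f \in Lfun mu 2%:E by apply: (subZ c sL).
    have := Lfun2M_integrable cf hL; apply: eq_integrable => // x _ /=.
    by rewrite -mulrA.
  by apply: eq_Rintegral => x _ /=; rewrite mulrDl mulrA.
- by move=> f g _ _; apply: eq_Rintegral => x _; rewrite mulrC.
- by move=> f _; apply: Rintegral_ge0 => x _; rewrite -expr2 sqr_ge0.
Qed.

Lemma ip2_EFin f : f \in Lfun mu 2%:E -> (ip2 f f)%:E = (\int[mu]_x (f x ^+ 2)%:E)%E.
Proof.
move=> fL; rewrite /ip2 /Rintegral fineK; last first.
  exact: (integrable_fin_num measurableT (Lfun2M_integrable fL fL)).
by apply: eq_integral => x _; rewrite expr2.
Qed.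

(** Riesz-Fischer. A subsequence g whose steps have squared norm at most 8^-j makes the series G of
    4^j |g_(j+1) - g_j|^2 integrable. Where G is finite the steps are O(2^-j), so g converges there,
    and Fatou's lemma turns this almost everywhere convergence into convergence in norm. *)
Lemma L2_complete : complete_in [set f : T -> R | f \in Lfun mu 2%:E]
  [set f : T -> R | f \in Lfun mu 2%:E] ip2.
Proof.
move=> s sL sC; have BX := L2_semi_inner.
have mL f : f \in Lfun mu 2%:E -> measurable_fun setT f by move=> /Lfun2P[].
have sBL m n : s m - s n \in Lfun mu 2%:E by exact: (subB BX).
have /choice[M hM] j : exists N, forall m n, (N <= m)%N -> (N <= n)%N ->
   ip2 (s m - s n) (s m - s n) <= 8^-1 ^+ j by apply: sC; exact: exprn_gt0.
have ms j : measurable_fun setT (s j) by apply: mL; exact: sL.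
(* Partial sums make the indices increase and dominate both M j and j; the bound by j serves when
   Fatou's lemma is applied. *)
pose p j := (\sum_(i < j.+1) (M i).+1)%N.
have pM j : (M j <= p j)%N.
  by rewrite /p big_ord_recr /= (leq_trans (leqnSn _)) ?leq_addl.
have pid j : (j <= p j)%N.
  elim: j => // j ih; rewrite /p big_ord_recr /= addnS ltnS.
  exact: leq_trans ih (leq_addr _ _).
have pp j : (p j <= p j.+1)%N by rewrite /p [X in (_ <= X)%N]big_ord_recr /= leq_addr.
have pj j k : (j <= k)%N -> (p j <= p k)%N.
  by move=> /subnK <-; elim: (k - j)%N => // i ih; exact: leq_trans ih (pp _).
pose g j := s (p j).
have gm j k : (j <= k)%N -> ip2 (g k - s (p j)) (g k - s (p j)) <= 8^-1 ^+ j.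
  by move=> jk; apply: hM; [exact: leq_trans (pM _) (pj _ _ jk)|exact: pM].
pose G x := (\sum_(0 <= j <oo) (4 ^+ j * (g j.+1 x - g j x) ^+ 2)%:E)%E.
have md j : measurable_fun setT (fun x => g j.+1 x - g j x).
  by apply: measurable_funB; exact: ms.
have mt j : measurable_fun setT (fun x => (4 ^+ j * (g j.+1 x - g j x) ^+ 2)%:E).
  by apply/measurable_EFinP; apply: measurable_funM => //; exact: measurable_funX.
have t0 j x : (0 <= (4 ^+ j * (g j.+1 x - g j x) ^+ 2)%:E)%E.
  by rewrite lee_fin; apply: mulr_ge0; [exact: exprn_ge0|exact: sqr_ge0].
have mG : measurable_fun setT G.
  by apply: (@ge0_emeasurable_sum _ _ _ _ _ xpredT) => // j x _ _; exact: t0.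
have G0 x : (0 <= G x)%E by apply: nneseries_ge0.
have GI : (\int[mu]_x G x < +oo)%E.
  rewrite /G integral_nneseries //.
  apply: (@le_lt_trans _ _ (\sum_(0 <= j <oo) (2 / (2 ^ (j + 1))%:R : R)%:E)%E).
    apply: lee_nneseries => j _; first by move=> _; exact: integral_ge0.
    under eq_integral => x _ do rewrite EFinM.
    rewrite integralZl //; last exact: (Lfun2_integrable_sqr (sBL _ _)).
    rewrite -(ip2_EFin (sBL _ _)) -EFinM lee_fin.
    rewrite (_ : 2 / _ = 4 ^+ j * 8^-1 ^+ j); last first.
      rewrite -exprMn addn1 expnS natrM invfM mulrA divff ?mul1r // natrX -exprVn.
      by congr (_ ^+ _); lra.
    by rewrite ler_pM2l ?exprn_gt0 //; apply: gm.
  have /cvg_lim h := @cvg_geometric_eseries_half R 2 0.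
  by rewrite [ltLHS]h ?ltry.
pose D := G @^-1` [set x | (x < +oo)%E].
have mD : measurable D.
  rewrite -[D]setTI; apply: mG => //.
  rewrite (_ : [set x | _] = [set` Interval -oo%O (BLeft +oo%E)]); first exact: emeasurable_itv.
  by apply/seteqP; split => x /=; rewrite in_itv.
have DN : mu (~` D) = 0%E.
  have iG : mu.-integrable setT G.
    apply/integrableP; split => //; rewrite (eq_integral G) //.
    by move=> x _; rewrite gee0_abs.
  have [N [mN N0 NG]] := integrable_ae measurableT iG.
  apply: (subset_measure0 _ mN _ N0); first exact: measurableC.
  move=> x Dx; apply: NG => /= h; apply: Dx; rewrite /D /=.
  by have := h I; rewrite ge0_fin_numE.
have gD x : D x -> cvgn (fun j => g j x).
  rewrite /D /= => Gx.
  have Gfin : G x \is a fin_num by rewrite ge0_fin_numE.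
  pose K := fine (G x); have GK : G x = K%:E by rewrite fineK.
  have tK j : 4 ^+ j * (g j.+1 x - g j x) ^+ 2 <= K.
    rewrite -lee_fin -GK /G.
    apply: le_trans (nneseries_lim_ge j.+1 _); last by move=> *; exact: t0.
    by rewrite big_nat_recr //= leeDr // sume_ge0.
  have K0 : 0 <= K by apply: le_trans (tK 0%N); rewrite mul1r sqr_ge0.
  (* Since K <= (K + 1)^2, the constant K + 1 spares a square root. *)
  have dK j : `|g j.+1 x - g j x| <= geometric (K + 1) 2^-1 j.
    rewrite /geometric /= -(ler_pXn2r (ltn0Sn 1)) ?nnegrE ?normr_ge0 //; last first.
      by rewrite mulr_ge0 ?exprn_ge0 ?addr_ge0.
    rewrite real_normK ?num_real // exprMn -exprM mulnC exprM.
    rewrite (_ : 2^-1 ^+ 2 = 4^-1); last by rewrite expr2; lra.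
    rewrite exprVn; apply: (@le_trans _ _ (K / 4 ^+ j)).
      by rewrite ler_pdivlMr ?exprn_gt0 // mulrC.
    by rewrite ler_wpM2r ?invr_ge0 ?exprn_ge0 //; nra.
  have : cvgn (series (fun j => g j.+1 x - g j x)).
    apply: normed_cvg; apply: (series_le_cvg _ _ dK) => //.
      by move=> j; rewrite mulr_ge0 ?exprn_ge0 ?addr_ge0.
    by apply: is_cvg_geometric_series; rewrite ger0_norm ?invr_ge0 // invf_lt1 // ltr1n.
  move=> sc; have -> : (fun j => g j x) = (fun j => g 0%N x) + series (fun j => g j.+1 x - g j x).
    apply/funext => j; rewrite /GRing.add /= /series /=.
    by rewrite telescope_sumr // addrC subrK.
  by apply: is_cvgD => //; exact: is_cvg_cst.
(* Cut to D, the sequence converges at every point, so f is measurable as an everywhere limit. *)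
pose h j := patch (fun=> 0) D (g j).
have mh j : measurable_fun setT (h j).
  by apply/(measurable_restrictT _ mD); apply: measurable_funTS; exact: ms.
have hcv x : cvgn (fun j => h j x).
  have [Dx|Dx] := pselect (D x).
    rewrite (_ : (fun j => h j x) = g ^~ x); first exact: gD.
    by apply/funext => j; rewrite /h /patch mem_set.
  rewrite (_ : (fun j => h j x) = (fun=> 0)); first exact: is_cvg_cst.
  by apply/funext => j; rewrite /h /patch memNset.
pose f x := limn (fun j => h j x).
have mf : measurable_fun setT f.
  by apply: (measurable_fun_cvg mh) => x _; exact: hcv.
have fD x : D x -> g ^~ x @ \oo --> f x.
  move=> Dx; rewrite /f (_ : (fun j => h j x) = g ^~ x); first exact: gD.
  by apply/funext => j; rewrite /h /patch mem_set.
have key e : 0 < e -> exists N, forall m, (N <= m)%N ->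
   (\int[mu]_x ((f x - s m x) ^+ 2)%:E <= e%:E)%E.
  move=> e0; have [N hN] := sC _ e0; exists N => m hm.
  have mfs j : measurable_fun setT (fun x => ((g j x - s m x) ^+ 2)%:E).
    by apply/measurable_EFinP/measurable_funX/measurable_funB; exact: ms.
  have mfm : measurable_fun setT (fun x => ((f x - s m x) ^+ 2)%:E).
    by apply/measurable_EFinP/measurable_funX/measurable_funB => //; exact: ms.
  rewrite (ge0_negligible_integral (measurableC mD) measurableT mfm _ DN); last first.
    by move=> x _; rewrite lee_fin sqr_ge0.
  rewrite setTD setCK.
  rewrite (eq_integral (fun x => limn_einf (fun j => ((g j x - s m x) ^+ 2)%:E))); last first.
    move=> x /set_mem /fD fx; apply/esym.
    have : (fun j => ((g j x - s m x) ^+ 2)%:E) @ \oo --> ((f x - s m x) ^+ 2)%:E.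
      apply: cvg_EFin; first by apply: nearW.
      by apply: cvgM; apply: cvgB => //; exact: cvg_cst.
    by move=> /cvg_limn_einf_sup[].
  apply: le_trans (fatou mu mD _ _) _.
  - by move=> j; apply: measurable_funTS; exact: mfs.
  - by move=> j x _; rewrite lee_fin sqr_ge0.
  rewrite limn_einf_lim; apply: lime_le; first exact: is_cvg_einfs.
  near=> j; apply: (@le_trans _ _ (\int[mu]_(x in D) ((g j x - s m x) ^+ 2)%:E)%E).
    by apply: ereal_inf_lbound; exists j => /=.
  apply: (@le_trans _ _ (\int[mu]_x ((g j x - s m x) ^+ 2)%:E)%E).
    apply: ge0_subset_integral => //.
    by move=> x _; rewrite lee_fin sqr_ge0.
  rewrite -(ip2_EFin (sBL _ _)) lee_fin; apply: hN => //.
  apply: leq_trans (pid j); near: j; exact: nbhs_infty_ge.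
have fsL : exists N, forall m, (N <= m)%N -> f - s m \in Lfun mu 2%:E.
  have [N hN] := key _ ltr01; exists N => m hm; apply/Lfun2P; split.
    by apply: measurable_funB => //; exact: ms.
  by apply: le_lt_trans (hN _ hm) _; rewrite ltry.
have fL : f \in Lfun mu 2%:E.
  have [N hN] := fsL; rewrite -(subrK (s N) f).
  by apply: (subD BX) => /=; [exact: hN|exact: sL].
exists f => // e /key[N hN]; exists N => m /hN.
by rewrite -lee_fin ip2_EFin //; apply: (subB BX) => //; exact: sL.
Unshelve. all: by end_near.
Qed.
End L2_complete.

(** * Lebesgue measure on R^n *)

Section boxes.
Variables (R : realType) (n : nat).
Implicit Types (a b x : 'rV[R]_n) (A : set 'rV[R]_n).

Definition box a b : set 'rV[R]_n := [set x | forall i, a 0 i < x 0 i < b 0 i].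
Definition cbox a b : set 'rV[R]_n := [set x | forall i, a 0 i <= x 0 i <= b 0 i].

Lemma box_cbox a b : box a b `<=` cbox a b.
Proof. by move=> x abx i; have /andP[? ?] := abx i; rewrite !ltW. Qed.

Lemma measurable_coord_lt i (c : R) : measurable [set x : 'rV[R]_n | x 0 i < c].
Proof.
rewrite (_ : [set x | _] = setT `&` (fun x : 'rV[R]_n => x 0 i) @^-1` [set` `]-oo, c[]).
  by apply: measurable_coord => //; exact: measurable_itv.
by rewrite setTI; apply/seteqP; split => x /=; rewrite in_itv.
Qed.

Lemma measurable_coord_gt i (c : R) : measurable [set x : 'rV[R]_n | c < x 0 i].
Proof.
rewrite (_ : [set x | _] = setT `&` (fun x : 'rV[R]_n => x 0 i) @^-1` [set` `]c, +oo[]).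
  by apply: measurable_coord => //; exact: measurable_itv.
by rewrite setTI; apply/seteqP; split => x /=; rewrite in_itv /= andbT.
Qed.

Lemma measurable_box a b : measurable (box a b).
Proof.
rewrite (_ : box a b = \bigcap_(i in setT)
  ([set x : 'rV[R]_n | a 0 i < x 0 i] `&` [set x : 'rV[R]_n | x 0 i < b 0 i])).
  apply: fin_bigcap_measurable => // i _.
  by apply: measurableI; [exact: measurable_coord_gt|exact: measurable_coord_lt].
apply/seteqP; split => [x abx i _|x abx i]; first by have /andP[] := abx i.
by have [] := abx i I => /= -> ->.
Qed.

Lemma rV_ballP x (e : R) y : ball x e y <-> 0 < e /\ forall i, `|x 0 i - y 0 i| < e.
Proof.
split=> [[e0 h]|[e0 h]]; split => // i; first exact: h.
by move=> j; rewrite (ord1 i); exact: h.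
Qed.

Lemma rV_norm_lt x (e : R) : 0 < e -> (`|x| < e) <-> (forall i, `|x 0 i| < e).
Proof.
move=> e0; have -> : (`|x| < e) <-> ball x e 0.
  by rewrite -ball_normE /ball_ /= subr0.
rewrite rV_ballP; split=> [[_ h] i|h]; last by split => // i; rewrite mxE subr0.
by have := h i; rewrite mxE subr0.
Qed.

Lemma rV_norm_le x (e : R) : 0 <= e -> (`|x| <= e) <-> (forall i, `|x 0 i| <= e).
Proof.
move=> e0; split=> [h i|h].
  apply/ler_addgt0Pl => d d0; apply/ltW.
  have de : 0 < d + e by rewrite ltr_pwDl.
  by apply: (rV_norm_lt x de).1; apply: le_lt_trans h _; rewrite ltrDr.
apply/ler_addgt0Pl => d d0; apply/ltW.
have de : 0 < d + e by rewrite ltr_pwDl.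
by apply/(rV_norm_lt x de) => i; apply: le_lt_trans (h i) _; rewrite ltrDr.
Qed.

Lemma coord_le_norm x i : `|x 0 i| <= `|x|.
Proof. exact: (rV_norm_le x (normr_ge0 _)).1. Qed.

Definition ratv (p : 'rV[rat]_n) : 'rV[R]_n := map_mx ratr p.

(** Indexed by all pairs of rational corners, hence countable: a pair whose closed box leaves A
    gives the empty set. The closed box is required to lie in A so that the bump functions of the
    box are test functions on A. *)
Definition boxin A (pq : 'rV[rat]_n * 'rV[rat]_n) :=
  [set x | box (ratv pq.1) (ratv pq.2) x /\ cbox (ratv pq.1) (ratv pq.2) `<=` A].

Lemma open_bigcup_box A : open A -> A = \bigcup_pq boxin A pq.
Proof.
move=> oA; apply/seteqP; split=> [x Ax|x [pq _ [abx sA]]]; last exact/sA/box_cbox.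
have /nbhs_ballP[e /= e0 eA] := open_nbhs_nbhs (conj oA Ax).
have /choice[p hp] i : exists q : rat, x 0 i - e < ratr q < x 0 i.
  have /rat_in_itvoo[q] : x 0 i - e < x 0 i by rewrite ltrBlDr ltrDl.
  by rewrite in_itv; exists q.
have /choice[q hq] i : exists q : rat, x 0 i < ratr q < x 0 i + e.
  have /rat_in_itvoo[r] : x 0 i < x 0 i + e by rewrite ltrDl.
  by rewrite in_itv; exists r.
exists (\row_i p i, \row_i q i) => //; split=> [i|y abx] /=.
  by rewrite !mxE; have /andP[_ ->] := hp i; have /andP[-> _] := hq i.
apply: eA; apply/rV_ballP; split => // i; have := abx i; rewrite !mxE => /andP[h1 h2].
have /andP[h3 h4] := hp i; have /andP[h5 h6] := hq i.
by rewrite ltr_norml; apply/andP; split; lra.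
Qed.

Lemma measurable_boxin A pq : measurable (boxin A pq).
Proof.
have [sA|sA] := pselect (cbox (ratv pq.1) (ratv pq.2) `<=` A).
  rewrite (_ : boxin _ _ = box (ratv pq.1) (ratv pq.2)); first exact: measurable_box.
  by apply/seteqP; split => x // [].
by rewrite (_ : boxin _ _ = set0) //; apply/seteqP; split => x // [].
Qed.

Lemma open_measurable_rV A : open A -> measurable A.
Proof.
move=> /open_bigcup_box ->; apply: countable_bigcupT_measurable => // pq.
exact: measurable_boxin.
Qed.

Lemma closed_measurable_rV A : closed A -> measurable A.
Proof.
move=> cA; rewrite -[A]setCK; apply: measurableC; apply: open_measurable_rV.
exact: closed_openC.
Qed.

Lemma continuous_measurable_rV (f : 'rV[R]_n -> R) : continuous f ->
  measurable_fun setT f.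
Proof.
move=> /continuousP cf.
apply: (measurability _ (RGenOInfty.measurableE R)).
move=> _ [_ [x ->] <-]; rewrite setTI; apply: open_measurable_rV; apply: cf.
by rewrite set_itvE; exact: open_gt.
Qed.

(** Boxes form a pi-system exhausting the space, so two measures finite on boxes agree once they
    agree on boxes. The half-space c < x_i is the union over k of the boxes with lower bound c in
    direction i and bounds -k, k otherwise. *)
Lemma measurable_rVE :
  @measurable _ 'rV[R]_n = <<s [set B | exists a b, B = box a b] >>.
Proof.
apply/seteqP; split; last first.
  apply: smallest_sub; first exact: sigma_algebra_measurable.
  by move=> _ [a [b ->]]; exact: measurable_box.
set G := [set B | _].
have mc (i : 'I_n) : measurable_fun [set: g_sigma_algebraType G]
    (fun x : g_sigma_algebraType G => (x : 'rV[R]_n) 0 i).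
  apply: (measurability _ (RGenOInfty.measurableE R)).
  move=> _ [_ [c ->] <-]; rewrite setTI.
  rewrite (_ : _ @^-1` _ = \bigcup_k box (\row_j if j == i then c else - k%:R)
     (\row_j k%:R) :> set (g_sigma_algebraType G)).
    by apply: bigcupT_measurable => k; apply: sub_sigma_algebra; do 2 eexists.
  apply/seteqP; split=> [x /=|x [k _ /(_ i)]]; last first.
    by rewrite !mxE eqxx /= in_itv /= andbT => /andP[].
  rewrite in_itv /= andbT => cx; exists (Num.truncn `|x|).+1 => // j.
  have xk : `|(x : 'rV[R]_n) 0 j| < (Num.truncn `|x|).+1%:R.
    by apply: le_lt_trans (coord_le_norm _ _) (truncnS_gt _).
  rewrite !mxE; move: xk; rewrite ltr_norml => /andP[h1 h2]; rewrite h2 andbT.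
  by case: eqP => [->|].
apply: smallest_sub; first exact: smallest_sigma_algebra.
rewrite -bigcup_seq /=; apply: bigcup_sub => i _ _ [Y mY <-].
exact: (mc i measurableT Y mY).
Qed.

Lemma boxI a b c e : box a b `&` box c e =
  box (\row_i Num.max (a 0 i) (c 0 i)) (\row_i Num.min (b 0 i) (e 0 i)).
Proof.
apply/seteqP; split=> x.
  move=> [h1 h2] i; have /andP[? ?] := h1 i; have /andP[? ?] := h2 i.
  by rewrite !mxE gt_max lt_min; apply/andP; split; apply/andP.
by move=> h; split=> i; have := h i; rewrite !mxE gt_max lt_min => /andP[/andP[h1 h2] /andP[h3 h4]]; apply/andP.
Qed.

Lemma box_setI : setI_closed [set B | exists a b, B = box a b].
Proof. by move=> _ _ [a [b ->]] [c [e ->]]; rewrite boxI; do 2 eexists. Qed.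

Definition kbox (k : nat) : set 'rV[R]_n := box (const_mx (- k%:R)) (const_mx k%:R).

Lemma bigcup_kbox : \bigcup_k kbox k = setT.
Proof.
apply/seteqP; split => // x _; exists (Num.truncn `|x|).+1 => // j.
rewrite !mxE -ltr_norml.
by apply: le_lt_trans (coord_le_norm _ _) (truncnS_gt _).
Qed.

Lemma box_measure_unique (m1 m2 : {measure set 'rV[R]_n -> \bar R}) :
  (forall a b, m1 (box a b) = m2 (box a b)) ->
  (forall a b, m1 (box a b) < +oo)%E ->
  forall A, measurable A -> m1 A = m2 A.
Proof.
move=> m12 m1oo A mA.
apply: (measure_unique _ kbox measurable_rVE box_setI _ bigcup_kbox) => //.
- by move=> k; do 2 eexists.
- by move=> _ [a [b ->]].
- by move=> k; exact: m1oo.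
Qed.

End boxes.

Definition image_measure d d' (T1 : measurableType d) (T2 : measurableType d')
    (R : realType) (m : {measure set T1 -> \bar R}) (f : T1 -> T2)
    (mf : measurable_fun setT f) : {measure set T2 -> \bar R} :=
  measure_function_pushforward__canonical__measure_function_Measure m mf.

Section lebesgue_rV.
Variable R : realType.
Local Notation mu n := (leb R n).

Lemma rV_cons0 n (t : R) (y : 'rV[R]_n) : rV_cons (t, y) 0 0 = t.
Proof.
have -> : 0 = lshift n (ord0 : 'I_1) by apply/val_inj.
by rewrite /rV_cons (@row_mxEl _ 1 1) mxE.
Qed.

Lemma rV_consS n (t : R) (y : 'rV[R]_n) i : rV_cons (t, y) 0 (lift ord0 i) = y 0 i.
Proof.
have -> : lift ord0 i = rshift 1 i by apply/val_inj.
by rewrite /rV_cons (@row_mxEr _ 1 1).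
Qed.

Definition tailv n (x : 'rV[R]_n.+1) : 'rV[R]_n := \row_i x 0 (lift ord0 i).

Lemma tailvD n (x y : 'rV[R]_n.+1) : tailv (x + y) = tailv x + tailv y.
Proof. by apply/rowP => i; rewrite !mxE. Qed.

Lemma leb_box_cons n (a b : 'rV[R]_n.+1) :
  mu n.+1 (box a b) = (lebesgue_measure (`]a 0%R 0%R, b 0%R 0%R[%classic : set R) *
    mu n (box (tailv a) (tailv b)))%E.
Proof.
rewrite [LHS]/= /cons_measure /pushforward.
rewrite (_ : _ @^-1` _ = `]a 0 0, b 0 0[%classic `*` box (tailv a) (tailv b)).
  by rewrite product_measure1E //; exact: measurable_box.
apply/seteqP; split=> [[t y] h|[t y] [/= h1 h2] i].
  split=> /=; first by have := h ord0; rewrite rV_cons0 in_itv.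
  by move=> i; have := h (lift ord0 i); rewrite rV_consS !mxE.
case: (unliftP ord0 i) => [j ->|->].
  by have := h2 j; rewrite rV_consS !mxE.
by move: h1; rewrite rV_cons0 in_itv.
Qed.

Lemma leb_box_fin n (a b : 'rV[R]_n) : (mu n (box a b) < +oo)%E.
Proof.
elim: n a b => [|n ih] a b; first by rewrite /= diracE ltry.
rewrite leb_box_cons lte_mul_pinfty //.
rewrite ge0_fin_numE // lebesgue_measure_itv /=.
by case: ifP => // _; rewrite -EFinB ltry.
Qed.

Lemma leb_box_shift n (a b h : 'rV[R]_n) : mu n (box (a + h) (b + h)) = mu n (box a b).
Proof.
elim: n a b h => [|n ih] a b h.
  by congr (mu 0 _); apply/seteqP; split => x _ [].
rewrite !leb_box_cons !lebesgue_measure_itv /= !lte_fin !mxE ltrD2r.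
congr (_ * _)%E; first by case: ifP => // _; rewrite -!EFinB; congr EFin; ring.
by rewrite !tailvD ih.
Qed.

Lemma measurable_shift n (h : 'rV[R]_n) : measurable_fun setT (fun x : 'rV[R]_n => x + h).
Proof.
apply: measurable_fun_rV => i.
under eq_fun do rewrite mxE.
by apply: measurable_funD => //; exact: measurable_coord.
Qed.

Lemma leb_shift n (h : 'rV[R]_n) (A : set 'rV[R]_n) : measurable A ->
  mu n [set x | A (x + h)] = mu n A.
Proof.
move=> mA; apply: (@box_measure_unique _ _ (image_measure (mu n) (measurable_shift h))) => // a b.
- rewrite /= /pushforward (_ : _ @^-1` _ = box (a - h) (b - h)).
    exact: leb_box_shift.
  by apply/seteqP; split => x /= abx i; have := abx i; rewrite !mxE ltrBlDr ltrBrDr.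
- rewrite /= /pushforward (_ : _ @^-1` _ = box (a - h) (b - h)).
    exact: leb_box_fin.
  by apply/seteqP; split => x /= abx i; have := abx i; rewrite !mxE ltrBlDr ltrBrDr.
Qed.

Lemma ge0_integral_shift n (h : 'rV[R]_n) (f : 'rV[R]_n -> \bar R) :
  measurable_fun setT f -> (forall x, 0 <= f x)%E ->
  (\int[mu n]_x f (x + h)%R = \int[mu n]_x f x)%E.
Proof.
move=> mf f0.
have := ge0_integral_pushforward (measurable_shift h) (mu n) measurableT mf (fun x _ => f0 x).
rewrite preimage_setT => <-.
apply: (@eq_measure_integral _ _ _ _ (mu n) (image_measure (mu n) (measurable_shift h))).
by move=> A mA _; exact: leb_shift.
Qed.

Lemma Rintegral_shift n (h : 'rV[R]_n) (f : 'rV[R]_n -> R) :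
  measurable_fun setT f -> \int[mu n]_x f (x + h) = \int[mu n]_x f x.
Proof.
move=> /measurable_EFinP mf; rewrite /Rintegral; congr fine.
rewrite [LHS]integralE [RHS]integralE.
congr (_ - _)%E; [rewrite -(ge0_integral_shift h (measurable_funepos mf)) //
                 |rewrite -(ge0_integral_shift h (measurable_funeneg mf)) //].
- by apply: eq_integral => x _; rewrite !funeposE.
- by apply: eq_integral => x _; rewrite !funenegE.
Qed.

(** A bounded piece of the hyperplane has infinitely many disjoint translates along e, all of the
    same measure and inside one bounded box, so its measure is 0. *)
Lemma leb_hyperplane n (l : 'rV[R]_n -> R) (r : R) (e : 'rV[R]_n) :
  measurable_fun setT l -> l e != 0 -> (forall x t, l (x + t *: e) = l x + t * l e) ->
  mu n [set x | l x = r] = 0%E.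
Proof.
move=> ml le0 lD; set H := [set x | l x = r].
have mH : measurable H by rewrite -[H]setTI; exact: (ml measurableT _ (measurable_set1 r)).
pose M k := H `&` @kbox R n k.
have mM k : measurable (M k) by apply: measurableI => //; exact: measurable_box.
have M0 k : mu n (M k) = 0%E.
  (* Distinct shifts bounded by 1: the translates are disjoint and stay in a fixed box. *)
  pose t j : R := j.+1%:R^-1.
  pose F j := [set x | M k (x + t j *: e)].
  have mF j : measurable (F j).
    rewrite -[F j]setTI; exact: (measurable_shift (t j *: e)).
  have FM j : mu n (F j) = mu n (M k) by exact: leb_shift.
  have tF : trivIset setT F.
    move=> i j _ _ [x [[+ _] [+ _]]]; rewrite /H /= !lD => h1 h2.
    have /(mulIf le0) : t i * l e = t j * l e by apply: (addrI (l x)); rewrite h1 h2.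
    by move=> /invr_inj/eqP; rewrite eqr_nat eqSS => /eqP.
  have FB j : F j `<=` box (const_mx (- k%:R) - const_mx `|e|) (const_mx k%:R + const_mx `|e|).
    move=> x [_ h] i; have := h i; rewrite !mxE => /andP[h1 h2].
    have : `|t j * e 0 i| <= `|e|.
      rewrite normrM -[leRHS]mul1r ler_pM // ?coord_le_norm //.
      by rewrite ger0_norm ?invr_ge0 // invf_le1 // ler1n.
    by rewrite ler_norml => /andP[h3 h4]; apply/andP; split; lra.
  have sF : (mu n (\bigcup_j F j) < +oo)%E.
    apply: (@le_lt_trans _ _ (mu n (box (const_mx (- k%:R) - const_mx `|e|) (const_mx k%:R + const_mx `|e|)))); last exact: leb_box_fin.
    apply: le_measure; rewrite ?inE; [exact: bigcupT_measurable|exact: measurable_box|].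
    by apply: bigcup_sub => j _; exact: FB.
  move: sF; rewrite measure_semi_bigcup //; last exact: bigcupT_measurable.
  have := measure_ge0 (mu n) (M k); rewrite le_eqVlt => /orP[/eqP <- //|M0].
  have -> : (\sum_(0 <= j <oo) mu n (F j) = \sum_(0 <= j <oo) mu n (M k))%E.
    by apply: eq_eseriesr => j _; exact: FM.
  set S := limn _ => Soo.
  have le_S N : (\sum_(0 <= i < N) mu n (M k) <= S)%E by apply: nneseries_lim_ge.
  have Mfin : mu n (M k) \is a fin_num.
    rewrite ge0_fin_numE //; apply: le_lt_trans Soo.
    by have := le_S 1%N; rewrite big_nat1.
  have Sfin : S \is a fin_num by rewrite ge0_fin_numE // nneseries_ge0.
  have [q qE] : exists q, mu n (M k) = q%:E by exists (fine (mu n (M k))); rewrite fineK.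
  have [s sE] : exists s, S = s%:E by exists (fine S); rewrite fineK.
  have {}M0 : (0 < mu n (M k))%E := M0; rewrite qE lte_fin in M0.
  (* More than s / q copies of measure q exceed the total s. *)
  have := le_S (Num.truncn (s / q)).+1.
  rewrite sE qE sumEFin lee_fin sumr_const_nat subn0 -mulr_natl => h.
  have := truncnS_gt (s / q); rewrite ltr_pdivrMr // => h2.
  by have := lt_le_trans h2 h; rewrite ltxx.
apply/eqP; rewrite -measure_le0.
have -> : H = \bigcup_k M k by rewrite -setI_bigcupr bigcup_kbox setIT.
apply: le_trans (measure_sigma_subadditive _ mM _ (@subset_refl _ _)) _.
  exact: bigcupT_measurable.
by rewrite eseries0 // => k _ _; exact: M0.
Qed.

End lebesgue_rV.

(** * Test functions *)

Section smooth.
Variable R : realType.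
Implicit Types f g : R -> R.

(** The last derivative need not be continuous, so [sm k.+1] is what gives k continuous derivatives;
    in exchange, stability under sums, products and affine substitutions is a plain induction. *)
Fixpoint sm (k : nat) f : Prop :=
  if k is k'.+1 then exists f', (forall x : R, is_derive x 1 f (f' x)) /\ sm k' f'
  else True.

Lemma smW k f : sm k.+1 f -> sm k f.
Proof. by elim: k f => [//|k ih] f [f' [df /ih sf']]; exists f'. Qed.

Lemma sm_cst k (c : R) : sm k (cst c).
Proof.
elim: k c => [//|k ih] c; exists (cst 0); split; last exact: ih.
by move=> x; exact: is_derive_cst.
Qed.

Lemma smD k f g : sm k f -> sm k g -> sm k (f + g).
Proof.
elim: k f g => [//|k ih] f g [f' [df sf']] [g' [dg sg']].
by exists (f' + g'); split; [move=> x; exact: is_deriveD|exact: ih].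
Qed.

Lemma smM k f g : sm k f -> sm k g -> sm k (f * g).
Proof.
elim: k f g => [//|k ih] f g sf sg; have [f' [df sf']] := sf; have [g' [dg sg']] := sg.
exists (f * g' + g * f'); split; first by move=> x; exact: is_deriveM.
by apply: smD; apply: ih => //; exact: smW.
Qed.

Lemma sm_comp_affine k f (c d : R) : sm k f -> sm k (fun x => f (c * x + d)).
Proof.
elim: k f => [//|k ih] f [f' [df sf']].
exists ((fun x => f' (c * x + d)) * cst c); split; last first.
  by apply: smM; [exact: ih|exact: sm_cst].
move=> x; apply: (@is_derive1_comp _ f (fun x => c * x + d)) => //.
have h : is_derive x 1 ((c \*: id) + cst d) (c *: 1 + 0) by apply: is_deriveD.
by apply: is_derive_eq h _; rewrite addr0 /GRing.scale /= mulr1.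
Qed.

Lemma sm_continuous k f : sm k.+1 f -> continuous f.
Proof.
move=> [f' [df _]] x; apply/differentiable_continuous/derivable1_diffP.
by have [] := df x.
Qed.

(* x^-j exp(-1/x), extended by 0: a family closed under differentiation *)
Definition flat (j : nat) (x : R) : R :=
  if 0 < x then x^-1 ^+ j * expR (- x^-1) else 0.

(** From exp y >= y^(j+1) / (j+1)! at y = 1/x. This linear bound gives continuity at 0, and
    continuity of the next function of the family gives differentiability there. *)
Lemma flat_le j x : `|flat j x| <= j.+1`!%:R * `|x|.
Proof.
rewrite /flat; case: ifPn => [x0|_]; last by rewrite normr0 mulr_ge0.
rewrite ger0_norm ?mulr_ge0 ?exprn_ge0 ?expR_ge0 ?invr_ge0 ?(ltW x0) //.
rewrite (ger0_norm (ltW x0)) expRN ler_pdivrMr ?expR_gt0 //.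
have := @expR_ge1Dxn _ x^-1 j; rewrite invr_ge0 (ltW x0) => /(_ isT) h.
have : x^-1 ^+ j.+1 / j.+1`!%:R <= expR x^-1 by apply: le_trans h; rewrite lerDr.
rewrite ler_pdivrMr ?ltr0n ?fact_gt0 // exprS => {}h.
have -> : x^-1 ^+ j = x * (x^-1 * x^-1 ^+ j) by rewrite mulVKf ?gt_eqF.
by rewrite -[leRHS]mulrA [leRHS]mulrCA ler_wpM2l ?(ltW x0) // [leRHS]mulrC.
Qed.

Lemma flatS j x : flat j x = flat j.+1 x * x.
Proof.
rewrite /flat; case: ifPn => x0; last by rewrite mul0r.
by rewrite exprS; move: (x^-1 ^+ j) => y; field; rewrite gt_eqF.
Qed.

Lemma flat_cont0 j : {for 0, continuous (flat j)}.
Proof.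
have f0 : flat j 0 = 0 by rewrite /flat ltxx.
apply/cvgrPdist_le => e e0; rewrite f0.
near=> t; rewrite sub0r normrN; apply: le_trans (flat_le _ _) _.
rewrite -ler_pdivlMl ?ltr0n ?fact_gt0 //.
near: t; apply: (@cvgr0_norm_le _ _ _ _ _ id) => //.
by rewrite mulr_gt0 // invr_gt0 ltr0n fact_gt0.
Unshelve. all: by end_near. Qed.

Lemma flat_derive j (x : R) : is_derive x 1 (flat j) (flat j.+2 x - j%:R * flat j.+1 x).
Proof.
have [x0|x0|->] := ltgtP x 0.
- have -> : flat j.+2 x - j%:R * flat j.+1 x = 0.
    by rewrite /flat ltNge (ltW x0) /= mulr0 subr0.
  have h : is_derive x (1 : R) (cst (0 : R)) (0 : R) by exact: is_derive_cst.
  apply: near_eq_is_derive h; near=> y; rewrite /flat ltNge (_ : y <= 0) //.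
  by apply/ltW; near: y; exact: lt_nbhsl.
- have dV : is_derive x 1 (fun y : R => (id y)^-1) (- x ^- 2 *: (1 : R)).
    by apply: is_deriveV; rewrite gt_eqF.
  have dE : is_derive x 1 (expR \o (- (fun y : R => (id y)^-1))) (expR (- x^-1) * - (- x ^- 2 *: (1 : R))).
    by apply: is_derive1_comp.
  have := is_deriveM (is_deriveX j dV) dE.
  set D := (X in is_derive _ _ _ X) => h.
  have -> : flat j.+2 x - j%:R * flat j.+1 x = D.
    rewrite /D /flat x0 /GRing.scale /= !fctE.
    case: (j) => [|i] /=; first by field; rewrite gt_eqF.
    rewrite !exprS !expr0 -natr1; move: (x^-1 ^+ i) (i%:R) => y c.
    by field; rewrite gt_eqF.
  apply: near_eq_is_derive h; near=> y; rewrite /flat (_ : 0 < y) ?fctE //.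
  by near: y; exact: lt_nbhsr.
(* At 0 the slope function of [flat j] is [flat j.+1] by [flatS], and it is continuous there with
   value 0. *)
- apply/is_derive1_caratheodory; exists (flat j.+1); split.
  + by move=> z; rewrite subr0 {2}/flat ltxx subr0 flatS.
  + exact: flat_cont0.
  + by rewrite /flat ltxx mulr0 subr0.
Unshelve. all: by end_near. Qed.

Lemma sm_flat k j : sm k (flat j).
Proof.
elim: k j => [//|k ih] j; exists (flat j.+2 + cst (- j%:R) * flat j.+1); split.
  by move=> x; apply: is_derive_eq (flat_derive j x) _; rewrite !fctE mulNr.
by apply: smD; [exact: ih|apply: smM; [exact: sm_cst|exact: ih]].
Qed.

End smooth.

Section bump.
Variables (R : realType) (n : nat).
Local Notation E := 'rV[R]_n.+1.
Implicit Types (a b x : E) (A : set E).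

Lemma coord_cont i : continuous (fun x : E => x 0 i).
Proof. exact: coord_continuous. Qed.

Lemma continuous_prod_coord (F : 'I_n.+1 -> R -> R) (P : pred 'I_n.+1) :
  (forall i, continuous (F i)) -> continuous (fun x : E => \prod_(i | P i) F i (x 0 i)).
Proof.
move=> cF; apply: continuous_big => [x|i _ x]; first exact: mul_continuous.
by apply: continuous_comp; [exact: coord_cont|exact: cF].
Qed.

Lemma is_derive_prod_coord (F : 'I_n.+1 -> R -> R) (F' : R -> R) j x :
  (forall t : R, is_derive t 1 (F j) (F' t)) ->
  is_derive x (delta_mx 0 j) (fun x : E => \prod_i F i (x 0 i))
    (\prod_i (if i == j then F' else F i) (x 0 i)).
Proof.
move=> dF; set P := \prod_(i | i != j) F i (x 0 i).
have [dj dj'] := dF (x 0 j).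
have pE (y : E) : \prod_i F i (y 0 i) = F j (y 0 j) * \prod_(i | i != j) F i (y 0 i).
  by rewrite (bigD1 j).
have cv : (fun h : R => h^-1 *: ((fun x : E => \prod_i F i (x 0 i)) (h *: delta_mx 0 j + x) -
    \prod_i F i (x 0 i))) @ 0^' --> F' (x 0 j) * P.
  have -> : (fun h : R => h^-1 *: ((fun x : E => \prod_i F i (x 0 i)) (h *: delta_mx 0 j + x) -
     \prod_i F i (x 0 i))) =
     (fun h : R => h^-1 *: ((F j \o shift (x 0 j)) (h *: 1) - F j (x 0 j)) * P).
    apply/funext => h /=; rewrite !pE -/P !mxE !eqxx /= mulr1.
    rewrite (eq_bigr (fun i => F i (x 0 i))); last first.
      by move=> i /negPf ij; rewrite !mxE ij andbF mulr0 add0r.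
    by rewrite -/P -mulrBl /GRing.scale /= mulr1 mulrA.
  apply: cvgM; last exact: cvg_cst.
  by rewrite -dj'; exact: dj.
have -> : \prod_i (if i == j then F' else F i) (x 0 i) = F' (x 0 j) * P.
  rewrite (bigD1 j) //= eqxx; congr (_ * _).
  by apply: eq_bigr => i /negPf ->.
apply: DeriveDef; first by apply/cvg_ex; eexists; exact: cv.
by apply: cvg_lim => //; exact: cv.
Qed.

Lemma sm_prod_Ck k (F : 'I_n.+1 -> R -> R) : (forall i, sm k.+1 (F i)) ->
  Ck k (fun x : E => \prod_i F i (x 0 i)).
Proof.
elim: k F => [|k ih] F sF /=; split => //.
- by apply: continuous_prod_coord => i; exact: sm_continuous (sF i).
- by apply: continuous_prod_coord => i; exact: sm_continuous (sF i).
move=> j; have [F' [dF sF']] := sF j; split.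
  by move=> x; have [] := is_derive_prod_coord x dF.
rewrite (_ : partial j _ = fun x : E => \prod_i (if i == j then F' else F i) (x 0 i)).
  by apply: (ih (fun i => if i == j then F' else F i)) => i; case: eqP => _; [exact: sF'|exact: (smW (sF i))].
by apply/funext => x; have [_ <-] := is_derive_prod_coord x dF.
Qed.

(** The factor m.+1 magnifies the distances to the ends s and t inside exp(-1/.), so that these
    smooth functions increase with m to the indicator of the open interval: test functions thus
    detect the measure of boxes. *)
Definition bump1 (s t : R) (m : nat) (y : R) : R :=
  flat 0 (m.+1%:R * y + - (m.+1%:R * s)) * flat 0 (- m.+1%:R * y + m.+1%:R * t).

Definition bump a b m x : R := \prod_i bump1 (a 0 i) (b 0 i) m (x 0 i).

Lemma flat_itv (t : R) : 0 <= flat 0 t <= 1.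
Proof.
rewrite /flat; case: ifPn => t0; last by rewrite lexx ler01.
by rewrite mul1r expR_ge0 -expR0 ler_expR oppr_le0 invr_ge0 ltW.
Qed.

Lemma bump1_itv s t m y : 0 <= bump1 s t m y <= 1.
Proof.
have /andP[h1 h2] := flat_itv (m.+1%:R * y + - (m.+1%:R * s)).
have /andP[h3 h4] := flat_itv (- m.+1%:R * y + m.+1%:R * t).
by rewrite /bump1 mulr_ge0 //= mulr_ile1.
Qed.

Lemma bump_ge0 a b m x : 0 <= bump a b m x.
Proof. by apply: prodr_ge0 => i _; have /andP[] := bump1_itv (a 0 i) (b 0 i) m (x 0 i). Qed.

Lemma bump_le1 a b m x : bump a b m x <= 1.
Proof. by apply: prodr_ile1 => i _; exact: bump1_itv. Qed.

Lemma bump_out a b m x : ~ box a b x -> bump a b m x = 0.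
Proof.
move=> nx; have [i nxi] : exists i, ~ (a 0 i < x 0 i < b 0 i) by apply/existsNP.
rewrite /bump (bigD1 i) //= /bump1 /flat -mulrBr mulNr [- _ + _]addrC -mulrBr.
rewrite !pmulr_rgt0 // !subr_gt0.
case: ltP => h1; last by rewrite !mul0r.
case: ltP => h2; last by rewrite mulr0 mul0r.
by exfalso; apply: nxi; rewrite h1 h2.
Qed.

Lemma flat_cvg1 (t : R) : 0 < t -> flat 0 (m.+1%:R * t) @[m --> \oo] --> (1 : R).
Proof.
move=> t0; rewrite -[X in _ --> X](expR0 R).
rewrite (_ : (fun m => _) = expR \o (fun m => - (t^-1 * harmonic m))).
  apply: cvg_comp; last exact: continuous_expR.
  rewrite -oppr0 -(mulr0 t^-1); apply: cvgN; apply: cvgM; first exact: cvg_cst.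
  exact: cvg_harmonic.
by apply/funext => m; rewrite /flat pmulr_rgt0 // t0 mul1r /= invfM mulrC.
Qed.

Lemma bump_cvg a b x : bump a b m x @[m --> \oo] --> (\1_(box a b) x : R).
Proof.
have [abx|nabx] := pselect (box a b x); last first.
  rewrite indicE memNset //= (_ : (fun m => _) = fun=> 0); first exact: cvg_cst.
  by apply/funext => m; rewrite bump_out.
rewrite indicE mem_set //= (_ : 1%:R = \prod_(i < n.+1) (1 : R)); last by rewrite big1.
apply: cvg_big => [y|i _]; first exact: mul_continuous.
have /andP[h1 h2] := abx i; rewrite -[1]mul1r; apply: cvgM.
  under eq_fun do rewrite -mulrBr; apply: flat_cvg1; by rewrite subr_gt0.
under eq_fun do rewrite mulNr addrC -mulrBr; apply: flat_cvg1; by rewrite subr_gt0.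
Qed.

Lemma cbox_compact a b : compact (cbox a b).
Proof.
apply: bounded_closed_compact.
  exists (`|a| + `|b|); split => // M hM x abx; apply/rV_norm_le.
    by apply/ltW; apply: le_lt_trans hM; rewrite addr_ge0.
  move=> i; have /andP[h1 h2] := abx i.
  have := coord_le_norm a i; have := coord_le_norm b i.
  by rewrite !ler_norml => /andP[h3 h4] /andP[h5 h6]; apply/andP; split; lra.
rewrite (_ : cbox a b = \bigcap_(i in setT)
   ((fun x : E => x 0 i) @^-1` [set` `[a 0 i, b 0 i]])); last first.
  apply/seteqP; split => x h i; first by move=> _; rewrite /= in_itv; exact: h.
  by have := h i I; rewrite /= in_itv.
apply: closed_bigI => i _; apply: preimage_closed; last exact: interval_closed.
by move=> y _; exact: coord_cont.
Qed.

Lemma bump_test a b A m : cbox a b `<=` A -> test_function A (bump a b m).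
Proof.
move=> abA; split.
  move=> k; apply: (@sm_prod_Ck k (fun i => bump1 (a 0 i) (b 0 i) m)) => i.
  exact: (smM (sm_comp_affine m.+1%:R (- (m.+1%:R * a 0 i)) (sm_flat _ k.+1 0))
    (sm_comp_affine (- m.+1%:R) (m.+1%:R * b 0 i) (sm_flat _ k.+1 0))).
exists (cbox a b); split => //; first exact: cbox_compact.
by move=> x nx; apply: bump_out => abx; apply: nx; exact: box_cbox.
Qed.

End bump.

Section density.
Context d (T : measurableType d) (R : realType) (mu : {measure set T -> \bar R}).
Variable f : T -> \bar R.
Hypotheses (mf : measurable_fun setT f) (f0 : forall x, (0 <= f x)%E).

(** Measurability and positivity are arguments of the set function, so that the measure structure
    attached to it finds their proofs in the term. *)
Definition density of measurable_fun setT f & (forall x, (0 <= f x)%E) :=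
  fun A : set T => (\int[mu]_(x in A) f x)%E.

Let density0 : density mf f0 set0 = 0%E.
Proof. by rewrite /density integral_set0. Qed.

Let density_ge0 A : (0 <= density mf f0 A)%E.
Proof. exact: integral_ge0. Qed.

Let density_sigma_additive : semi_sigma_additive (density mf f0).
Proof.
move=> F mF tF mUF; rewrite /density ge0_integral_bigcup //.
  by apply: is_cvg_nneseries => n _ _; exact: integral_ge0.
exact: measurable_funTS.
Qed.

HB.instance Definition _ := isMeasure.Build _ _ _ (density mf f0)
  density0 density_ge0 density_sigma_additive.
End density.

(** * The fundamental lemma of the calculus of variations *)

Section fundamental_lemma.
Variables (R : realType) (n : nat).
Local Notation E := 'rV[R]_n.+1.
Local Notation mu := (leb R n.+1).

(** B is cut along a countable cover of A by rational boxes, made disjoint. Inside one such box the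
    restricted measures are determined by their values on smaller boxes, whose closed boxes still
    lie in A. *)
Lemma box_in_measure_unique (A : set E) (m1 m2 : {measure set E -> \bar R}) :
  open A -> (m1 setT < +oo)%E ->
  (forall a b, cbox a b `<=` A -> m1 (box a b) = m2 (box a b)) ->
  forall B, measurable B -> B `<=` A -> m1 B = m2 B.
Proof.
move=> oA m1oo m12.
have H pq B : measurable B -> m1 (B `&` boxin A pq) = m2 (B `&` boxin A pq).
  move=> mB; have mb := measurable_boxin A pq.
  apply: (@box_measure_unique _ _ (mrestr m1 mb) (mrestr m2 mb)) => // a b; last first.
    rewrite /= /mrestr; apply: le_lt_trans m1oo.
    by apply: le_measure; rewrite ?inE //; apply: measurableI => //; exact: measurable_box.
  rewrite /= /mrestr.
  have [sA|nsA] := pselect (cbox (ratv R pq.1) (ratv R pq.2) `<=` A); last first.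
    by rewrite (_ : _ `&` _ = set0) ?measure0 //; apply/seteqP; split => x // [_ []].
  rewrite (_ : boxin A pq = box (ratv R pq.1) (ratv R pq.2)); last first.
    by apply/seteqP; split => x // [].
  rewrite boxI; apply: m12 => x h; apply: sA => i; have := h i.
  by rewrite !mxE ge_max le_min => /andP[/andP[_ ->] /andP[_ ->]].
move=> B mB BA.
pose K k := if unpickle k is Some pq then boxin A pq else set0.
have mK k : measurable (K k) by rewrite /K; case: unpickle => // pq; exact: measurable_boxin.
have BE : B = \bigcup_k (B `&` seqDU K k).
  rewrite -setI_bigcupr -seqDU_bigcup_eq; apply/esym/setIidl => x /BA.
  by rewrite {1}(open_bigcup_box oA) => -[pq _ h]; exists (pickle pq) => //; rewrite /K pickleK.
have mD k : measurable (B `&` seqDU K k).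
  by apply: measurableI => //; exact: seqDU_measurable.
have tD : trivIset setT (fun k => B `&` seqDU K k).
  by apply: trivIset_setIl; exact: trivIset_seqDU.
have mU : measurable (\bigcup_k (B `&` seqDU K k)) by exact: bigcupT_measurable.
rewrite BE !measure_semi_bigcup //; apply: eq_eseriesr => k _.
have sK : B `&` seqDU K k `<=` K k by move=> x [_ h]; exact: subset_seqDU h.
rewrite -(setIidl sK) /K; case: unpickle => [pq|]; last by rewrite setI0 !measure0.
exact: H.
Qed.

Lemma integral_box0 (A : set E) (G : E -> R) (a b : E) :
  mu.-integrable setT (EFin \o G) -> cbox a b `<=` A ->
  (forall phi, test_function A phi -> \int[mu]_x (G x * phi x) = 0) ->
  (\int[mu]_(x in box a b) (G x)%:E = 0)%E.
Proof.
move=> iG abA hG.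
have mG := measurable_int _ iG.
have mphi m : measurable_fun setT (bump a b m).
  have [/(_ 0%N)[c _] _] := bump_test m (fun x (h : cbox a b x) => h).
  exact: continuous_measurable_rV.
have mf_ m : measurable_fun setT (fun x => (G x * bump a b m x)%:E).
  by apply/measurable_EFinP/measurable_funM => //; exact/measurable_EFinP.
have mf : measurable_fun setT (fun x => (G x * \1_(box a b) x)%:E).
  apply/measurable_EFinP/measurable_funM; first exact/measurable_EFinP.
  exact: measurable_indic (measurable_box _ _).
have ff : {ae mu, forall x, setT x -> (G x * bump a b m x)%:E @[m --> \oo] --> (G x * \1_(box a b) x)%:E}.
  apply: aeW => x _; apply: cvg_EFin; first exact: nearW.
  by apply: cvgM; [exact: cvg_cst|exact: bump_cvg].
have fG : {ae mu, forall x m, setT x -> (`|(G x * bump a b m x)%:E| <= (abse \o (EFin \o G)) x)%E}.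
  apply: aeW => x m _ /=; rewrite lee_fin normrM -[leRHS]mulr1 ler_pM //.
  by rewrite ger0_norm ?bump_ge0 ?bump_le1.
have [_ _ cv] := dominated_convergence measurableT mf_ mf ff (integrable_abse iG) fG.
rewrite integral_mkcond.
rewrite (eq_integral (fun x => (G x * \1_(box a b) x)%:E)); last first.
  move=> x _; rewrite /patch indicE; case: ifP => _; by rewrite ?mulr1 ?mulr0.
have cv0 : (fun m => \int[mu]_x (G x * bump a b m x)%:E)%E @ \oo --> 0%E.
  rewrite (_ : (fun m => _) = fun=> 0%E); first exact: cvg_cst.
  apply/funext => m; have := hG _ (bump_test m abA); rewrite /Rintegral => h0.
  apply/eqP; rewrite -fine_eq0 ?h0 //.
  apply: (integrable_fin_num measurableT); apply: le_integrable (integrable_abse iG) => //.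
  move=> x _ /=; rewrite lee_fin normr_id normrM -[leRHS]mulr1 ler_pM //.
  by rewrite ger0_norm ?bump_ge0 ?bump_le1.
by apply/esym; apply: cvg_unique cv0 cv.
Qed.

(** The measures with densities G^+ and G^- agree on boxes in A, hence on all measurable subsets of
    A. The second vanishes on the set G > 0 and the first on G < 0, so both parts of G integrate to
    0. *)
Lemma test_orthogonal_eq0 (A : set E) (G : E -> R) : open A ->
  mu.-integrable setT (EFin \o G) -> (forall x, ~ A x -> G x = 0) ->
  (forall phi, test_function A phi -> \int[mu]_x (G x * phi x) = 0) ->
  ae_eq mu setT (EFin \o G) (cst 0%E).
Proof.
move=> oA iG GA hG.
have mG := measurable_int _ iG.
have mp := measurable_funepos mG; have mn := measurable_funeneg mG.
pose m1 : {measure set E -> \bar R} := density mu mp (funepos_ge0 _).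
pose m2 : {measure set E -> \bar R} := density mu mn (funeneg_ge0 _).
have Afin B : measurable B -> (\int[mu]_(x in B) (EFin \o G)^\+ x \is a fin_num)%E.
  move=> mB; apply: (integrable_fin_num mB); apply: integrable_funepos => //.
  exact: integrableS iG.
have m12 B : measurable B -> B `<=` A -> m1 B = m2 B.
  apply: (box_in_measure_unique oA).
    by have := Afin _ measurableT; rewrite ge0_fin_numE //; exact: integral_ge0.
  move=> a b abA; rewrite /m1 /m2 /= /density.
  have := integral_box0 iG abA hG; rewrite [LHS]integralE => /eqP.
  by rewrite sube_eq ?add0e ?Afin // ?fin_num_adde_defl; [move/eqP|exact: measurable_box..].
have mA := open_measurable_rV oA.
have mfG : measurable_fun setT G by exact/measurable_EFinP.
have GA' x : G x != 0 -> A x by move=> Gx; apply: contrapT => /GA /eqP; apply/negP.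
pose P := G @^-1` `]0, +oo[%classic; pose N := G @^-1` `]-oo, 0[%classic.
have mP : measurable P by rewrite -[P]setTI; apply: mfG => //; exact: measurable_itv.
have mN : measurable N by rewrite -[N]setTI; apply: mfG => //; exact: measurable_itv.
have PA : P `<=` A.
  by move=> x; rewrite /P /= in_itv /= andbT => Gx; apply: GA'; rewrite gt_eqF.
have NA : N `<=` A.
  by move=> x; rewrite /N /= in_itv /= => Gx; apply: GA'; rewrite lt_eqF.
have P0 : (\int[mu]_x (EFin \o G)^\+ x = 0)%E.
  transitivity (m1 P); last first.
    rewrite m12 // /m2 /= /density integral0_eq // => x; rewrite /P /= in_itv /= andbT => Gx.
    by rewrite funenegE /=; apply/max_idPr; rewrite lee_fin oppr_le0 ltW.
  rewrite /m1 /= /density [RHS]integral_mkcond; apply: eq_integral => x _.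
  rewrite /patch; case: ifPn => // /negP; rewrite inE /P /= in_itv /= andbT => /negP.
  by rewrite -leNgt => Gx; rewrite funeposE; apply/max_idPr; rewrite lee_fin.
have N0 : (\int[mu]_x (EFin \o G)^\- x = 0)%E.
  transitivity (m2 N); last first.
    rewrite -m12 // /m1 /= /density integral0_eq // => x; rewrite /N /= in_itv /= => Gx.
    by rewrite funeposE /=; apply/max_idPr; rewrite lee_fin ltW.
  rewrite /m2 /= /density [RHS]integral_mkcond; apply: eq_integral => x _.
  rewrite /patch; case: ifPn => // /negP; rewrite inE /N /= in_itv /= => /negP.
  by rewrite -leNgt => Gx; rewrite funenegE /=; apply/max_idPr; rewrite lee_fin oppr_le0.
apply/(ae_eq_integral_abs _ measurableT mG).
under eq_integral => x _ do rewrite -/((abse \o (EFin \o G)) x) fune_abse.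
by rewrite ge0_integralD // P0 N0 adde0.
Qed.

End fundamental_lemma.

Section lipschitz.
Variables (R : realType) (V : normedModType R).

Lemma lipP (A : set V) (f : V -> R) : [lipschitz f x | x in A] <->
  exists L, 0 <= L /\ forall x y, A x -> A y -> `|f x - f y| <= L * `|x - y|.
Proof.
split=> [[M [_ hM]]|[L [L0 hL]]].
  exists (`|M| + 1); split; first by rewrite addr_ge0.
  move=> x y Ax Ay; apply: (hM (`|M| + 1) _ (x, y)) => //.
  by rewrite (le_lt_trans (ler_norm M)) // ltrDl.
by exists L; split => [|M LM [x y] [/= Ax Ay]]; rewrite ?num_real //;
  apply: le_trans (hL _ _ Ax Ay) _; rewrite ler_wpM2r // ltW.
Qed.

End lipschitz.

Lemma indic_integrable d (T : measurableType d) (R : realType)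
    (mu : {measure set T -> \bar R}) (A : set T) (c : R) :
  measurable A -> (mu A < +oo)%E -> mu.-integrable setT (EFin \o (fun x => c * \1_A x)).
Proof.
move=> mA muA.
have i1 : mu.-integrable setT (EFin \o (\1_A : T -> R)).
  apply/integrableP; split; first exact/measurable_EFinP.
  rewrite (eq_integral (fun x => (\1_A x)%:E)) ?integral_indic ?setIT //.
  by move=> x _ /=; rewrite ger0_norm.
by have := integrableZl measurableT c i1; apply: eq_integrable.
Qed.

Section test_functions.
Variables (R : realType) (n : nat).
Local Notation E := 'rV[R]_n.+1.
Local Notation mu := (leb R n.+1).
Local Notation e_ i := (delta_mx 0 i : E).

Definition rbox (r : R) : set E := cbox (const_mx (- r)) (const_mx r).

Lemma rboxP r x : 0 <= r -> rbox r x <-> `|x| <= r.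
Proof.
move=> r0; rewrite rV_norm_le //; split=> h i; have := h i;
  by rewrite /= !mxE ler_norml.
Qed.

Lemma leb_rbox r : (mu (rbox r) < +oo)%E.
Proof.
apply: le_lt_trans (leb_box_fin (const_mx (- (r + 1))) (const_mx (r + 1))).
apply: le_measure; rewrite ?inE; [|exact: measurable_box|].
  by apply: closed_measurable_rV; apply: compact_closed; [exact: norm_hausdorff|exact: cbox_compact].
by move=> x h i; have := h i; rewrite !mxE => /andP[h1 h2]; apply/andP; split; lra.
Qed.

Lemma measurable_rbox r : measurable (rbox r).
Proof.
by apply: closed_measurable_rV; apply: compact_closed; [exact: norm_hausdorff|exact: cbox_compact].
Qed.

Lemma bounded_support_integrable (f : E -> R) r M : measurable_fun setT f ->
  (forall x, r < `|x| -> f x = 0) -> (forall x, `|f x| <= M) -> 0 <= r ->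
  mu.-integrable setT (EFin \o f).
Proof.
move=> mf fr fM r0.
have iM : mu.-integrable setT (EFin \o (fun x => M * \1_(rbox r) x)).
  by apply: indic_integrable; [exact: measurable_rbox|exact: leb_rbox].
apply: le_integrable iM => //; first exact/measurable_EFinP.
move=> x _ /=; rewrite lee_fin indicE.
have M0 : 0 <= M by apply: le_trans (fM x).
case: (boolP (x \in rbox r)) => [_|/negP xr]; first by rewrite mulr1 (ger0_norm M0).
rewrite mulr0 fr ?normr0 //; rewrite ltNge; apply/negP => h.
by apply: xr; rewrite inE; apply/rboxP.
Qed.

Lemma continuous_support_bounded (f : E -> R) r : 0 <= r -> continuous f ->
  (forall x, r < `|x| -> f x = 0) -> exists M, 0 <= M /\ forall x, `|f x| <= M.
Proof.
move=> r0 cf fr.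
have cK : compact (f @` rbox r).
  by apply: continuous_compact; [exact: continuous_subspaceT|exact: cbox_compact].
have [M [_ hM]] := compact_bounded cK.
exists (`|M| + 1); split; first by rewrite addr_ge0.
move=> x; have [xr|xr] := leP `|x| r; last by rewrite fr // normr0 addr_ge0.
apply: hM; first by rewrite (le_lt_trans (ler_norm M)) // ltrDl.
by exists x => //; apply/rboxP.
Qed.

Lemma is_derive_line (f : E -> R) (e x : E) (t : R) :
  (forall y, derivable f y e) ->
  is_derive t 1 (fun s => f (x + s *: e)) ('D_e f (x + t *: e)).
Proof.
move=> df.
have cv : (fun h : R => h^-1 *: (((fun s => f (x + s *: e)) \o shift t) (h *: (1 : R)) - f (x + t *: e)))
    @ 0^' --> 'D_e f (x + t *: e).
  rewrite (_ : (fun h : R => _) = fun h => h^-1 *: ((f \o shift (x + t *: e)) (h *: e) - f (x + t *: e))).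
    exact: df.
  apply/funext => h /=; congr (_ *: (f _ - _)).
  by rewrite [h *: (1 : R)]mulr1 scalerDl addrCA.
apply: DeriveDef; first by apply/cvg_ex; eexists; exact: cv.
by apply: cvg_lim => //; exact: cv.
Qed.

Lemma line_lipschitz (f : E -> R) (e : E) M : 
  (forall y, derivable f y e) -> (forall y, `|'D_e f y| <= M) ->
  forall x t, `|f (x + t *: e) - f x| <= M * `|t|.
Proof.
move=> df dM.
have key x t : 0 <= t -> `|f (x + t *: e) - f x| <= M * `|t|.
  move=> t0.
  have dg s := is_derive_line x s df.
  have [c _] := @MVT_segment R (fun s => f (x + s *: e)) (fun s => 'D_e f (x + s *: e)) 0 t t0
    (fun s _ => dg s) (continuous_subspaceT (fun s => differentiable_continuous
       ((derivable1_diffP _ _).1 (@ex_derive _ _ _ _ _ _ _ (dg s))))).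
  by rewrite scale0r addr0 subr0 => ->; rewrite normrM ler_wpM2r.
move=> x t; have [|t0] := leP 0 t; first exact: key.
have := key (x + t *: e) (- t); rewrite oppr_ge0 (ltW t0) => /(_ isT).
by rewrite normrN scaleNr addrK distrC.
Qed.

(** Moving from y to x one coordinate at a time costs at most M |x - y| per step, whence the factor
    n + 1. *)
Lemma coord_lipschitz (f : E -> R) M :
  (forall i x t, `|f (x + t *: e_ i) - f x| <= M * `|t|) ->
  forall x y, `|f x - f y| <= n.+1%:R * M * `|x - y|.
Proof.
move=> fM x y; have M0 : 0 <= M.
  by have := fM 0 0 1; rewrite normr1 mulr1; apply: le_trans.
have key s : `|f (y + \sum_(i <- s) (x - y) 0 i *: e_ i) - f y| <= (size s)%:R * M * `|x - y|.
  elim: s => [|i s ih]; first by rewrite big_nil addr0 subrr normr0 !mul0r.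
  rewrite big_cons addrCA addrC.
  set z := y + _ in ih *; rewrite -[_ - f y](subrKA (f z)).
  apply: le_trans (ler_normD _ _) _; rewrite [(size _)%:R]/= -natr1 mulrDl mulrDl mul1r [leRHS]addrC.
  apply: lerD => //; apply: le_trans (fM _ _ _) _.
  by rewrite ler_wpM2l // coord_le_norm.
have := key (enum 'I_n.+1).
by rewrite big_enum /= -row_sum_delta addrCA subrr addr0 size_enum_ord.
Qed.

(** One radius and one constant serve phi and its first derivatives together; they supply the
    dominating functions for the passages to the limit. *)
Record test_bounds (phi : E -> R) (r M : R) : Prop := TestBounds {
  tb_r0 : 0 <= r;
  tb_M0 : 0 <= M;
  tb_cont : continuous phi;
  tb_supp : forall x, r < `|x| -> phi x = 0;
  tb_le : forall x, `|phi x| <= M;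
  tb_dcont : forall i, continuous (partial i phi);
  tb_der : forall i x, derivable phi x (e_ i);
  tb_dsupp : forall i x, r < `|x| -> partial i phi x = 0;
  tb_dle : forall i x, `|partial i phi x| <= M;
  tb_line : forall i x t, `|phi (x + t *: e_ i) - phi x| <= M * `|t| }.

Lemma test_boundsP (A : set E) phi : test_function A phi -> exists r M, test_bounds phi r M.
Proof.
move=> [Cphi [K [cK _ phiK]]].
have [cphi dphi] := Cphi 1%N.
have [M0 [_ hM0]] := compact_bounded cK.
pose r := `|M0| + 1; have r0 : 0 <= r by rewrite addr_ge0.
have supp x : r < `|x| -> phi x = 0.
  move=> rx; apply: phiK => Kx; have hr : M0 < r by rewrite (le_lt_trans (ler_norm M0)) // ltrDl.
  by have := hM0 r hr x Kx; rewrite /= leNgt rx.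
have dsupp i x : r < `|x| -> partial i phi x = 0.
  move=> rx; rewrite /partial (@near_eq_derive _ _ _ _ (cst 0)) ?derive_cst //.
  near=> y; apply: supp; near: y.
  have := @norm_continuous _ _ x; move/cvgr_gt; exact.
have dcont i : continuous (partial i phi) by have [_ []] := dphi i.
have [M1 [M10 hM1]] := continuous_support_bounded r0 cphi supp.
have /choice[Mi hMi] i := continuous_support_bounded r0 (dcont i) (dsupp i).
pose M := M1 + \sum_i Mi i.
have s0 : 0 <= \sum_i Mi i by apply: sumr_ge0 => i _; have [] := hMi i.
have dM i x : `|partial i phi x| <= M.
  apply: le_trans ((hMi i).2 x) _; rewrite /M (bigD1 i) //= addrCA lerDl addr_ge0 //.
  by apply: sumr_ge0 => j _; have [] := hMi j.
have der i x : derivable phi x (e_ i) by have [] := dphi i.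
exists r, M; split => //.
- by rewrite addr_ge0.
- by move=> x; apply: le_trans (hM1 x) _; rewrite lerDl.
- by move=> i; apply: line_lipschitz => //; exact: dM.
Unshelve. all: by end_near. Qed.

Lemma test_lipschitz (A : set E) phi : test_function A phi -> lipschitz phi.
Proof.
move=> /test_boundsP[r [M tb]]; apply/lipP; exists (n.+1%:R * M); split.
  by rewrite mulr_ge0 // (tb_M0 tb).
by move=> x y _ _; apply: coord_lipschitz; exact: tb_line tb.
Qed.

End test_functions.

Lemma Rdominated d (T : measurableType d) (R : realType)
    (mu : {measure set T -> \bar R}) (f_ : nat -> T -> R) (f g : T -> R) :
  (forall k, measurable_fun setT (f_ k)) -> measurable_fun setT f ->
  (forall x, f_ ^~ x @ \oo --> f x) -> mu.-integrable setT (EFin \o g) ->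
  (forall k x, `|f_ k x| <= g x) ->
  \int[mu]_x f_ k x @[k --> \oo] --> \int[mu]_x f x.
Proof.
move=> mf_ mf cf ig fg.
have mf_' k : measurable_fun setT (fun x => (f_ k x)%:E) by exact/measurable_EFinP.
have mf' : measurable_fun setT (fun x => (f x)%:E) by exact/measurable_EFinP.
have cf' : {ae mu, forall x, setT x -> (f_ k x)%:E @[k --> \oo] --> (f x)%:E}.
  by apply: aeW => x _; apply: cvg_EFin; [exact: nearW|exact: cf].
have fg' : {ae mu, forall x k, setT x -> (`|(f_ k x)%:E| <= (EFin \o g) x)%E}.
  by apply: aeW => x k _ /=; rewrite lee_fin.
have [If _ cv] := dominated_convergence measurableT mf_' mf' cf' ig fg'.
have fin : (\int[mu]_x (f x)%:E)%E \is a fin_num by exact: integrable_fin_num.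
rewrite -(fineK fin) in cv; exact: (fine_cvg cv).
Qed.

(** * Weak derivatives through difference quotients *)

Section difference_quotients.
Variables (R : realType) (n : nat).
Local Notation E := 'rV[R]_n.+1.
Local Notation mu := (leb R n.+1).
Local Notation e_ i := (delta_mx 0 i : E).
Implicit Types (v phi psi : E -> R).

Lemma norm_delta i : `|e_ i| <= 1.
Proof.
apply/rV_norm_le => // j; rewrite mxE /=.
by case: eqP => _; rewrite ?normr1 ?normr0.
Qed.

Lemma compact_support_integrable v phi r : 0 <= r -> continuous v ->
  continuous phi -> (forall x, r < `|x| -> phi x = 0) ->
  mu.-integrable setT (EFin \o (fun x => v x * phi x)).
Proof.
move=> r0 cv cphi phir.
have cf : continuous (fun x => v x * phi x) by move=> x; apply: continuousM; [exact: cv|exact: cphi].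
have fr x : r < `|x| -> v x * phi x = 0 by move=> /phir ->; rewrite mulr0.
have [M [_ hM]] := continuous_support_bounded r0 cf fr.
by apply: (bounded_support_integrable _ fr hM r0); exact: continuous_measurable_rV.
Qed.

Lemma continuous_line v (e : E) (t : R) : continuous v -> continuous (fun x : E => v (x + t *: e)).
Proof.
move=> cv x; pose s : E -> E := fun y => y + t *: e.
have cs : continuous s.
  by move=> y; exact: (@cvgD R E E (nbhs y) _ id (cst (t *: e)) y (t *: e) cvg_id (cvg_cst _)).
by apply: (@continuous_comp _ _ _ s v); [exact: cs|exact: cv].
Qed.

(** As v is merely continuous, the limit rests on phi: its quotients are bounded by M and, because
    [|h k| <= 1], supported in the ball of radius r + 1, on which v is bounded. *)
Lemma dq_cvg v phi r M i (h : nat -> R) : continuous v -> test_bounds phi r M ->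
  (forall k, h k != 0) -> (forall k, `|h k| <= 1) -> h k @[k --> \oo] --> 0 ->
  \int[mu]_x (v x * ((h k)^-1 * (phi (x + h k *: e_ i) - phi x))) @[k --> \oo] -->
  \int[mu]_x (v x * partial i phi x).
Proof.
move=> cv tb h0 h1 hcv.
have r0 := tb_r0 tb; have M0 := tb_M0 tb.
have [Mv [Mv0 hMv]] : exists Mv, 0 <= Mv /\ forall x, `|x| <= r + 1 -> `|v x| <= Mv.
  have cK : compact (v @` rbox (r + 1)).
    by apply: continuous_compact; [exact: continuous_subspaceT|exact: cbox_compact].
  have [M' [_ hM]] := compact_bounded cK.
  exists (`|M'| + 1); split; first by rewrite addr_ge0.
  move=> x xr; apply: hM; first by rewrite (le_lt_trans (ler_norm _)) // ltrDl.
  by exists x => //; apply/rboxP => //; rewrite addr_ge0.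
apply: (@Rdominated _ _ _ _ _ _ (fun x => Mv * M * \1_(rbox (r + 1)) x)).
- move=> k; apply: measurable_funM; first exact: continuous_measurable_rV.
  apply: measurable_funM => //; apply: measurable_funB; apply: continuous_measurable_rV.
    by apply: continuous_line; exact: (tb_cont tb).
  exact: (tb_cont tb).
- apply: measurable_funM; apply: continuous_measurable_rV => //; exact: (tb_dcont tb).
- move=> x; apply: cvgM; first exact: cvg_cst.
  have dx : derivable phi x (e_ i) by exact: (tb_der tb).
  move: (dx) => /cvg_ex[l dl].
  have -> : partial i phi x = l by apply: cvg_lim.
  apply: (@cvg_trans _ ((fun t : R => t^-1 *: ((phi \o shift x) (t *: e_ i) - phi x)) @ (h @ \oo))).
    by apply: near_eq_cvg; near=> k; rewrite /= [x + _]addrC.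
  apply: cvg_trans dl; apply: cvg_app.
  move=> P; rewrite /= /dnbhs /within /= => hP.
  have := hcv _ hP; rewrite /nbhs /= /fmap /= => H.
  by apply: filterS H => k Pk; apply: Pk; exact: h0.
- by apply: indic_integrable; [exact: measurable_rbox|exact: leb_rbox].
- move=> k x; rewrite indicE.
  have Dle : `|(h k)^-1 * (phi (x + h k *: e_ i) - phi x)| <= M.
    rewrite normrM normfV ler_pdivrMl ?normr_gt0 // mulrC; exact: (tb_line tb).
  case: (boolP (x \in _)) => [/set_mem/rboxP xr|/negP xr].
    by rewrite mulr1 normrM ler_pM // hMv // xr // addr_ge0.
  have {}xr : r + 1 < `|x|.
    by rewrite ltNge; apply/negP => xr'; apply: xr; rewrite inE; apply/rboxP => //; rewrite addr_ge0.
  rewrite (tb_supp tb (x := x)); last by apply: lt_trans xr; rewrite ltrDl.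
  rewrite (tb_supp tb) ?subr0 ?mulr0 ?normr0 ?mulr0 //.
  have : `|h k *: e_ i| <= 1 by rewrite normrZ mulr_ile1 ?norm_delta.
  have := ler_normB (x + h k *: e_ i) (h k *: e_ i); rewrite addrK; lra.
Unshelve. all: by end_near. Qed.

(** Integration by parts for difference quotients: it is translation invariance of the Lebesgue
    measure. *)
Lemma dq_shift v phi r M i (t : R) : continuous v -> test_bounds phi r M ->
  \int[mu]_x (v x * (t^-1 * (phi (x + t *: e_ i) - phi x))) =
  \int[mu]_x (t^-1 * (v (x + (- t) *: e_ i) - v x) * phi x).
Proof.
move=> cv tb; have r0 := tb_r0 tb; have cphi := tb_cont tb.
have cvt := continuous_line (e := e_ i) (t := - t) cv.
have I1 := compact_support_integrable r0 cv cphi (tb_supp tb).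
have I2 := compact_support_integrable r0 cvt cphi (tb_supp tb).
have I3 : mu.-integrable setT (EFin \o (fun x => v x * phi (x + t *: e_ i))).
  apply: (@compact_support_integrable _ _ (r + `|t|)) => //; first by rewrite addr_ge0.
    exact: continuous_line.
  move=> x xr; apply: (tb_supp tb).
  have : `|t *: e_ i| <= `|t| by rewrite normrZ ler_piMr // norm_delta.
  have := ler_normB (x + t *: e_ i) (t *: e_ i); rewrite addrK; lra.
under eq_Rintegral => x _ do rewrite mulrCA mulrBr.
under [RHS]eq_Rintegral => x _ do rewrite -mulrA mulrBl.
rewrite RintegralZl //; last first.
  by have := integrableB measurableT I3 I1; apply: eq_integrable.
rewrite [RHS]RintegralZl //; last first.
  by have := integrableB measurableT I2 I1; apply: eq_integrable.
rewrite RintegralB // RintegralB //; congr (_ * (_ - _)).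
rewrite -(@Rintegral_shift _ _ (t *: e_ i) (fun x => v (x + (- t) *: e_ i) * phi x)); last first.
  by apply: measurable_funM; exact: continuous_measurable_rV.
by apply: eq_Rintegral => x _; rewrite scaleNr addrK.
Qed.

Lemma integration_by_parts phi psi A B i : test_function A phi -> test_function B psi ->
  \int[mu]_x (psi x * partial i phi x) = - \int[mu]_x (partial i psi x * phi x).
Proof.
move=> /test_boundsP[r [M tb]] /test_boundsP[r' [M' tb']].
have h0 k : (harmonic k : R) != 0 by rewrite /harmonic /= invr_eq0 pnatr_eq0.
have h1 k : `|harmonic k : R| <= 1 by rewrite /harmonic /= ger0_norm ?invr_ge0 // invf_le1 // ler1n.
have nh0 k : - (harmonic k : R) != 0 by rewrite oppr_eq0.
have nh1 k : `|- (harmonic k : R)| <= 1 by rewrite normrN.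
have hc : (harmonic k : R) @[k --> \oo] --> (0 : R) by exact: cvg_harmonic.
have nhc : (- harmonic k : R) @[k --> \oo] --> (0 : R) by rewrite -oppr0; exact: cvgN.
have c1 := dq_cvg (i := i) (tb_cont tb') tb h0 h1 hc.
have cNphi : continuous (fun x => - phi x) by move=> x; apply: continuousN; exact: (tb_cont tb).
have c2 := dq_cvg (i := i) cNphi tb' nh0 nh1 nhc.
have cE : \int[mu]_x (psi x * partial i phi x) = \int[mu]_x (- phi x * partial i psi x).
  have dqE k : \int[mu]_x (psi x * ((harmonic k)^-1 * (phi (x + harmonic k *: e_ i) - phi x))) =
      \int[mu]_x (- phi x * ((- harmonic k)^-1 * (psi (x + - harmonic k *: e_ i) - psi x))).
    rewrite (dq_shift _ _ (tb_cont tb') tb).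
    by apply: eq_Rintegral => x _; rewrite invrN; ring.
  move: c1; under eq_fun do rewrite dqE; move=> c1.
  exact: (cvg_unique (@Rhausdorff R) c1 c2).
have dc : continuous (partial i psi) by exact: (tb_dcont tb').
have I := compact_support_integrable (tb_r0 tb') (tb_cont tb) dc (fun x xr => tb_dsupp tb' i xr).
rewrite cE; transitivity (\int[mu]_x (- 1 * (partial i psi x * phi x))).
  by apply: eq_Rintegral => x _; ring.
have I' : mu.-integrable setT (EFin \o (fun x => partial i psi x * phi x)).
  by move: I; apply: eq_integrable => // x _ /=; rewrite mulrC.
have := RintegralZl (- 1) measurableT I'.
by rewrite [in RHS]mulN1r.
Unshelve. all: by end_near. Qed.

Lemma lipschitz_weak_bound v phi A i L : continuous v ->
  (forall x t, `|v (x + t *: e_ i) - v x| <= L * `|t|) -> test_function A phi ->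
  `|\int[mu]_x (v x * partial i phi x)| <= L * \int[mu]_x `|phi x|.
Proof.
move=> cv vL /test_boundsP[r [M tb]].
have h0 k : (harmonic k : R) != 0 by rewrite /harmonic /= invr_eq0 pnatr_eq0.
have h1 k : `|harmonic k : R| <= 1 by rewrite /harmonic /= ger0_norm ?invr_ge0 // invf_le1 // ler1n.
have c1 := dq_cvg (i := i) cv tb h0 h1 (cvg_harmonic).
have [r0 cphi] := (tb_r0 tb, tb_cont tb).
have cnphi : continuous (fun x => `|phi x|).
  by move=> x; apply: continuous_comp; [exact: cphi|exact: norm_continuous].
have Iphi : mu.-integrable setT (EFin \o (fun x => `|phi x|)).
  have c1' : continuous (cst 1 : E -> R) by exact: cst_continuous.
  have := compact_support_integrable r0 c1' cnphi.
  have nsupp x : r < `|x| -> `|phi x| = 0 by move=> /(tb_supp tb) ->; rewrite normr0.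
  by move=> /(_ nsupp); apply: eq_integrable => // x _; rewrite /= mul1r.
apply: (cvgr_to_le (cvg_norm c1)); near=> k.
rewrite (dq_shift _ _ cv tb).
have cvk := continuous_line (e := e_ i) (t := - harmonic k) cv.
have I1 : mu.-integrable setT (EFin \o (fun x => (harmonic k)^-1 * (v (x + - harmonic k *: e_ i) - v x) * phi x)).
  apply: (compact_support_integrable r0 _ cphi (tb_supp tb)).
  have c2 : continuous (fun x : E => v (x + - harmonic k *: e_ i) - v x).
    by move=> x; apply: continuousB; [exact: cvk|exact: cv].
  move=> x; apply: (@continuousM R E (cst (harmonic k)^-1) _ x); last exact: c2.
  exact: cst_continuous.
apply: le_trans (le_normr_Rintegral _ I1) _ => //.
rewrite -RintegralZl //; apply: le_Rintegral => //.
- by have := integrable_abse I1; apply: eq_integrable.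
- by have := integrableZl measurableT L Iphi; apply: eq_integrable.
move=> x _; rewrite normrM ler_wpM2r // normrM normfV ler_pdivrMl ?normr_gt0 //.
by rewrite mulrC; apply: le_trans (vL _ _) _; rewrite normrN.
Unshelve. all: by end_near. Qed.

End difference_quotients.

(** * Sobolev spaces *)

Section L2A.
Variables (R : realType) (n : nat).
Local Notation E := 'rV[R]_n.+1.
Local Notation mu := (leb R n.+1).
Implicit Types (A : set E) (v w f g : E -> R) (p q : E -> E).

Lemma zext_in (V : zmodType) A (f : E -> V) x : A x -> zext A f x = f x.
Proof. by move=> Ax; rewrite /zext /patch mem_set. Qed.

Lemma zext_out (V : zmodType) A (f : E -> V) x : ~ A x -> zext A f x = 0.
Proof. by move=> Ax; rewrite /zext /patch memNset. Qed.

Lemma funLE c (f g : E -> R) x : (c *: f + g) x = c * f x + g x.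
Proof. by []. Qed.

Lemma zextL A c v w : zext A (c *: v + w) = c *: zext A v + zext A w.
Proof.
apply/funext => x; rewrite funLE; have [Ax|Ax] := pselect (A x).
  by rewrite !zext_in.
by rewrite !zext_out // mulr0 addr0.
Qed.

Lemma zext0 A : zext A (0 : E -> R) = 0.
Proof. by apply/funext => x; rewrite /zext /patch; case: ifP. Qed.

Lemma zextB A v w : zext A (v - w) = zext A v - zext A w.
Proof. by rewrite addrC -scaleN1r zextL scaleN1r addrC. Qed.

Lemma ipE A v w : ip A v w = ip2 mu (zext A v) (zext A w).
Proof.
rewrite /ip /ip2 Rintegral_mkcond; apply: eq_Rintegral => x _.
by rewrite /zext /patch; case: ifP => _ //=; rewrite mul0r.
Qed.

Lemma eq_ip A v v' w w' : (forall x, A x -> v x = v' x) ->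
  (forall x, A x -> w x = w' x) -> ip A v w = ip A v' w'.
Proof. by move=> h1 h2; apply: eq_Rintegral => x /set_mem Ax; rewrite h1 ?h2. Qed.

Lemma eq_ipv A p p' q q' : (forall x, A x -> p x = p' x) ->
  (forall x, A x -> q x = q' x) -> ipv A p q = ipv A p' q'.
Proof. by move=> h1 h2; apply: eq_Rintegral => x /set_mem Ax; rewrite h1 ?h2. Qed.

Lemma eq_L2 A v v' : (forall x, A x -> v x = v' x) -> L2 A v -> L2 A v'.
Proof.
move=> h; rewrite /L2 (_ : zext A v' = zext A v) //; apply/funext => x.
by have [Ax|Ax] := pselect (A x); [rewrite !zext_in // h|rewrite !zext_out].
Qed.

Lemma eq_L2v A p p' : (forall x, A x -> p x = p' x) -> L2v A p -> L2v A p'.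
Proof. by move=> h hp i; apply: eq_L2 (hp i) => x Ax; rewrite h. Qed.

Lemma ip_semi A : semi_inner (L2 A) (ip A).
Proof.
have S2 := L2_semi_inner mu.
split.
- split; first by rewrite /L2 zext0; exact: (sub0 S2).
  by move=> c v w hv hw; rewrite /L2 zextL; exact: (subL S2).
- by move=> c v w z hv hw hz; rewrite !ipE zextL (siL S2).
- by move=> v w hv hw; rewrite !ipE (siC S2).
- by move=> v hv; rewrite !ipE (si_ge0 S2).
Qed.

Definition comp (p : E -> E) (i : 'I_n.+1) : E -> R := fun x => p x 0 i.

Lemma compL c p q i : comp (c *: p + q) i = c *: comp p i + comp q i.
Proof. by apply/funext => x; rewrite /comp /GRing.add /GRing.scale /= !mxE. Qed.

Lemma L2_integrable A v w : L2 A v -> L2 A w ->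
  mu.-integrable setT (EFin \o (fun x => zext A v x * zext A w x)).
Proof. exact: Lfun2M_integrable. Qed.

Lemma Rintegral_sum d (T : measurableType d) (m : {measure set T -> \bar R}) (I : finType)
    (F : I -> T -> R) : (forall i, m.-integrable setT (EFin \o F i)) ->
  \int[m]_x (\sum_i F i x) = \sum_i \int[m]_x F i x.
Proof.
move=> iF; rewrite /Rintegral.
under eq_integral do rewrite -sumEFin.
rewrite integral_sum // sum_fine // => i _.
exact: (integrable_fin_num measurableT (iF i)).
Qed.

Lemma ipvE A p q : L2v A p -> L2v A q -> ipv A p q = \sum_i ip A (comp p i) (comp q i).
Proof.
move=> hp hq; rewrite /ipv Rintegral_mkcond.
transitivity (\int[mu]_x \sum_i (zext A (comp p i) x * zext A (comp q i) x)).
  apply: eq_Rintegral => x _; rewrite /patch; case: ifPn => [/set_mem Ax|/negP Ax].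
    by apply: eq_bigr => i _; rewrite !zext_in.
  rewrite big1 // => i _; rewrite zext_out ?mul0r // => Ax'.
  by apply: Ax; rewrite inE.
rewrite Rintegral_sum; first by apply: eq_bigr => i _; rewrite ipE.
by move=> i; apply: L2_integrable; [exact: hp|exact: hq].
Qed.

Lemma L2v_sub A : subspace (L2v A).
Proof.
have S := ip_semi A; split; first by move=> i; apply: eq_L2 (sub0 S) => x _; rewrite mxE.
move=> c p q hp hq i; have := subL S c (hp i) (hq i).
by rewrite -[X in L2 A X -> _]/(c *: comp p i + comp q i) -compL.
Qed.

Lemma ipv_semi A : semi_inner (L2v A) (ipv A).
Proof.
have S := ip_semi A; have Sv := L2v_sub A; split => //.
- move=> c p q r hp hq hr; rewrite !ipvE //; last exact: (subL Sv).
  rewrite big_distrr -big_split; apply: eq_bigr => i _ /=.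
  by rewrite compL (siL S) //; [exact: hp|exact: hq|exact: hr].
- move=> p q hp hq; rewrite !ipvE //; apply: eq_bigr => i _.
  by rewrite (siC S) //; [exact: hp|exact: hq].
- move=> p hp; rewrite !ipvE //; apply: sumr_ge0 => i _; apply: (si_ge0 S); exact: hp.
Qed.

Lemma L2A_complete A : measurable A -> complete_in (L2 A) (L2 A) (ip A).
Proof.
move=> mA s hs sC.
have [||f fL fs] := @L2_complete _ _ _ mu (fun k => zext A (s k)).
- exact: hs.
- move=> e /sC[N hN]; exists N => i j hi hj.
  by have := hN i j hi hj; rewrite ipE zextB.
have mzf : measurable_fun setT (zext A f).
  by apply/(measurable_restrictT _ mA); apply: measurable_funTS; have [] := (Lfun2P _ _).1 fL.
have fA : L2 A f.
  apply/Lfun2P; split => //; have [mf] := (Lfun2P _ _).1 fL; apply: le_lt_trans.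
  apply: ge0_le_integral => //.
  - by move=> x _; rewrite lee_fin sqr_ge0.
  - by apply/measurable_EFinP/measurable_funX.
  - by apply/measurable_EFinP/measurable_funX.
  move=> x _; rewrite lee_fin; have [Ax|Ax] := pselect (A x); first by rewrite zext_in.
  by rewrite zext_out // expr0n sqr_ge0.
exists f => // e /fs[N hN]; exists N => k hk; apply: le_trans (hN _ hk).
have S2 := L2_semi_inner mu; have SA := ip_semi A.
have h1 := subB SA fA (hs k); have h2 := subB S2 fL (hs k).
rewrite ipE; apply: le_Rintegral => //; [exact: Lfun2M_integrable|exact: Lfun2M_integrable|].
move=> x _; have [Ax|Ax] := pselect (A x); last by rewrite zext_out // mul0r -expr2 sqr_ge0.
by rewrite zext_in // /GRing.add /GRing.opp /= zext_in.
Qed.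

Lemma ip_le_ipv A p i : L2v A p -> ip A (comp p i) (comp p i) <= ipv A p p.
Proof.
move=> hp; rewrite ipvE // (bigD1 i) //= lerDl; apply: sumr_ge0 => j _.
apply: (si_ge0 (ip_semi A)); exact: hp.
Qed.

Lemma compB p q i : comp (p - q) i = comp p i - comp q i.
Proof. by apply/funext => x; rewrite /comp /GRing.add /GRing.opp /= !mxE. Qed.

Lemma L2v_complete A : measurable A -> complete_in (L2v A) (L2v A) (ipv A).
Proof.
move=> mA s hs sC; have Sv := ipv_semi A.
have /choice[t ht] i : exists t, L2 A t /\ si_cvg (ip A) (fun k => comp (s k) i) t.
  have [||t ? ?] := L2A_complete mA (s := fun k => comp (s k) i); last by exists t.
  - by move=> k; exact: hs.
  - move=> e /sC[N hN]; exists N => j k hj hk; apply: le_trans (hN j k hj hk).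
    by rewrite -compB; apply: ip_le_ipv; exact: (subB Sv).
pose q x : E := \row_i t i x.
have cq i : comp q i = t i by apply/funext => x; rewrite /comp mxE.
have hq : L2v A q by move=> i; have [+ _] := ht i; rewrite -cq.
exists q => // e e0; have e1 : 0 < e / n.+1%:R by rewrite divr_gt0.
have /choice[N hN] i := (ht i).2 _ e1.
exists (\max_i N i)%N => k hk; rewrite ipvE; try exact: (subB Sv).
apply: (@le_trans _ _ (\sum_(i < n.+1) e / n.+1%:R)); last first.
  by rewrite sumr_const card_ord -[X in X <= _]mulr_natl mulrC divfK.
apply: ler_sum => i _; rewrite compB cq; apply: hN.
by apply: leq_trans hk; exact: leq_bigmax.
Qed.

End L2A.

(** * Test functions as elements of the Sobolev spaces *)

Section test_space.
Variables (R : realType) (n : nat).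
Local Notation E := 'rV[R]_n.+1.
Local Notation mu := (leb R n.+1).
Implicit Types (A : set E) (v w phi psi : E -> R) (p q : E -> E).

Lemma partial_lin i c v w : (forall x, derivable v x (delta_mx 0 i)) ->
  (forall x, derivable w x (delta_mx 0 i)) ->
  (forall x, derivable (c *: v + w) x (delta_mx 0 i)) /\
  partial i (c *: v + w) = c *: partial i v + partial i w.
Proof.
move=> dv dw; split=> [x|]; first by apply: derivableD; [exact: derivableZ|].
apply/funext => x; rewrite /partial deriveD ?deriveZ //; exact: derivableZ.
Qed.

Lemma Ck_lin k c v w : Ck k v -> Ck k w -> Ck k (c *: v + w).
Proof.
elim: k v w => [|k ih] v w /= [cv hv] [cw hw]; split=> //.
- by move=> x; apply: continuousD; [apply: continuousZr; exact: cv|exact: cw].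
- by move=> x; apply: continuousD; [apply: continuousZr; exact: cv|exact: cw].
move=> i; have [dv Dv] := hv i; have [dw Dw] := hw i.
by have [d ->] := partial_lin c dv dw; split => //; exact: ih.
Qed.

Lemma Ck0 k : Ck k (0 : E -> R).
Proof.
have d0 i : partial i (0 : E -> R) = 0.
  by apply/funext => x; rewrite /partial (derive_cst (0 : R)).
have c0 : continuous (0 : E -> R) by exact: cst_continuous.
elim: k => [|k ih] //=; split => // i; split; last by rewrite d0.
by move=> x; exact: (derivable_cst (0 : R)).
Qed.

Lemma test_sub A : subspace (test_function A).
Proof.
split.
  split; first exact: Ck0.
  by exists set0; split => //; exact: compact0.
move=> c v w [cv [K [cK KA vK]]] [cw [L [cL LA wL]]]; split.
  by move=> k; exact: Ck_lin.
exists (K `|` L); split; [exact: compactU|by move=> x [/KA|/LA]|].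
move=> x nKL; rewrite funLE vK ?wL ?mulr0 ?addr0 // => h; apply: nKL; by [left|right].
Qed.

Lemma test_partial A phi i : test_function A phi -> test_function A (partial i phi).
Proof.
move=> [cphi [K [cK KA phiK]]]; split.
  by move=> k; have [_ /(_ i)[]] := cphi k.+1.
exists K; split => // x nK.
rewrite /partial (@near_eq_derive _ _ _ _ (cst 0)) ?derive_cst //.
have oK : open (~` K) by apply: closed_openC; apply: compact_closed => //; exact: norm_hausdorff.
have := open_nbhs_nbhs (conj oK nK); apply: filterS => y nKy; exact: phiK.
Qed.

Lemma test_out A phi x : test_function A phi -> ~ A x -> phi x = 0.
Proof. by move=> [_ [K [_ KA phiK]]] nA; apply: phiK => /KA. Qed.

Lemma zext_test A phi : test_function A phi -> zext A phi = phi.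
Proof.
move=> tphi; apply/funext => x; have [Ax|Ax] := pselect (A x); first by rewrite zext_in.
by rewrite zext_out // (test_out tphi).
Qed.

Lemma test_mono A B phi : A `<=` B -> test_function A phi -> test_function B phi.
Proof.
move=> AB [cphi [K [cK KA phiK]]]; split => //; exists K; split => //.
exact: subset_trans KA AB.
Qed.

Lemma test_L2 A phi : test_function A phi -> L2 A phi.
Proof.
move=> tphi; rewrite /L2 (zext_test tphi).
have [r [M tb]] := test_boundsP tphi.
have := compact_support_integrable (tb_r0 tb) (tb_cont tb) (tb_cont tb) (tb_supp tb).
move=> I; apply/Lfun2P; split; first by apply: continuous_measurable_rV; exact: (tb_cont tb).
have := integrable_lty measurableT I.
by rewrite (eq_integral (fun x => (phi x ^+ 2)%:E)) // => x _; rewrite /= expr2.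
Qed.

Lemma ip_testE A v phi : test_function A phi -> ip A v phi = \int[mu]_x (v x * phi x).
Proof.
move=> tphi; rewrite /ip Rintegral_mkcond; apply: eq_Rintegral => x _.
by rewrite /patch; case: ifPn => // /negP; rewrite inE => nA; rewrite (test_out tphi nA) mulr0.
Qed.

Definition gradc phi : E -> E := fun x => \row_i partial i phi x.

Lemma comp_gradc phi i : comp (gradc phi) i = partial i phi.
Proof. by apply/funext => x; rewrite /comp mxE. Qed.

Lemma gradc_L2 A phi : test_function A phi -> L2v A (gradc phi).
Proof.
move=> tphi i; have := test_L2 (test_partial i tphi).
by rewrite -comp_gradc.
Qed.

Lemma is_grad_test A phi : test_function A phi -> is_grad A phi (gradc phi).
Proof.
move=> tphi; split; first exact: gradc_L2.
move=> psi tpsi i; rewrite !ip_testE //; last exact: test_partial.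
rewrite (integration_by_parts i tpsi tphi); congr (- _).
by apply: eq_Rintegral => x _; rewrite mxE.
Qed.

Lemma is_div_test A phi i : test_function A phi ->
  is_div A (fun x => phi x *: delta_mx 0 i) (partial i phi).
Proof.
move=> tphi; split; first exact: test_L2 (test_partial i tphi).
move=> psi tpsi; have [_ /(_ _ tpsi i)] := is_grad_test tphi.
rewrite -[X in ip A X psi]/(comp (gradc phi) i) comp_gradc => <-.
apply: eq_Rintegral => x _; rewrite /dotv (bigD1 i) //= !mxE !eqxx /= mulr1.
by rewrite big1 ?addr0 // => j /negPf ji; rewrite !mxE ji mulr0 mul0r.
Qed.

Lemma L2_int A v : measurable A -> (mu A < +oo)%E -> L2 A v ->
  mu.-integrable setT (EFin \o zext A v).
Proof.
move=> mA finA hv; have [mv _] := (Lfun2P _ _).1 hv.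
have I1 := indic_integrable 1 mA finA.
have I2 := L2_integrable hv hv.
have I := integrableD measurableT I1 I2.
apply: le_integrable I => //; first exact/measurable_EFinP.
move=> x _; rewrite /= lee_fin indicE; have [Ax|Ax] := pselect (A x); last first.
  by rewrite zext_out // normr0.
rewrite mem_set // mulr1 [leRHS]ger0_norm; last by rewrite -expr2 addr_ge0 ?sqr_ge0.
rewrite -expr2 -[X in _ <= _ + X]real_normK ?num_real //.
have := sqr_ge0 (`|zext A v x| - 1); have := normr_ge0 (zext A v x); nra.
Qed.

(** The fundamental lemma in the form used for uniqueness: two weak gradients or divergences of one
    function differ by a null vector, not by the zero function. *)
Lemma test_orthogonal A v : open A -> (mu A < +oo)%E -> L2 A v ->
  (forall phi, test_function A phi -> ip A v phi = 0) -> ip A v v = 0.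
Proof.
move=> oA finA hv hphi; have mA := open_measurable_rV oA.
have mv : measurable_fun setT (zext A v) by have [] := (Lfun2P _ _).1 hv.
have := @test_orthogonal_eq0 _ _ A (zext A v) oA (L2_int mA finA hv)
  (fun x nA => zext_out v nA).
move=> /(_ _)[phi tphi|N [mN N0 hN]].
  rewrite -(hphi _ tphi) ipE (zext_test tphi) /ip2.
  by [].
rewrite ipE /ip2 /Rintegral.
rewrite (ae_eq_integral (cst 0%E)) ?integral0 //.
  by apply/measurable_EFinP/measurable_funM.
exists N; split => // x /= nx; apply: hN => /= h; apply: nx => _.
by rewrite (_ : zext A v x = 0) ?mulr0 //; have := h I => -[].
Qed.

End test_space.

(** * H^1, H(div) and their traces on one open set *)

Section sobolev_spaces.
Variables (R : realType) (n : nat).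
Local Notation E := 'rV[R]_n.+1.
Local Notation mu := (leb R n.+1).
Variable A : set E.
Hypotheses (oA : open A) (finA : (mu A < +oo)%E).
Implicit Types (v w phi psi : E -> R) (p q : E -> E).

Let SA := ip_semi A.
Let SvA := ipv_semi A.

Lemma is_gradL c v w p q : L2 A v -> L2 A w -> is_grad A v p -> is_grad A w q ->
  is_grad A (c *: v + w) (c *: p + q).
Proof.
move=> hv hw [hp vp] [hq wq]; split; first exact: (subL SvA).
move=> phi tphi i; have t1 := test_L2 (test_partial i tphi); have t2 := test_L2 tphi.
rewrite (siL SA) // vp // wq //.
rewrite -[X in _ = - ip A X _]/(comp (c *: p + q) i) compL (siL SA) //; [|exact: hp|exact: hq].
by rewrite mulrN -opprD.
Qed.

Lemma is_divL c p q v w : L2v A p -> L2v A q -> is_div A p v -> is_div A q w ->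
  is_div A (c *: p + q) (c *: v + w).
Proof.
move=> hp hq [hv pv] [hw qw]; split; first exact: (subL SA).
move=> phi tphi; have t1 := gradc_L2 tphi; have t2 := test_L2 tphi.
by rewrite (siL SvA) // (siL SA) // pv // qw // mulrN -opprD.
Qed.

Lemma is_grad_unique v p q : is_grad A v p -> is_grad A v q -> ipv A (p - q) (p - q) = 0.
Proof.
move=> [hp vp] [hq vq]; have hpq := subB SvA hp hq.
rewrite ipvE // big1 // => i _; apply: test_orthogonal => //; first exact: hpq.
move=> phi tphi; have t2 := test_L2 tphi.
rewrite compB (siBl SA) //; [|exact: hp|exact: hq].
apply/eqP; rewrite subr_eq0; apply/eqP.
by apply: oppr_inj; rewrite -vp // -vq.
Qed.

Lemma is_div_unique q v w : is_div A q v -> is_div A q w -> ip A (v - w) (v - w) = 0.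
Proof.
move=> [hv qv] [hw qw]; have hvw := subB SA hv hw.
apply: test_orthogonal => // phi tphi; have t2 := test_L2 tphi.
rewrite (siBl SA) //; apply/eqP; rewrite subr_eq0; apply/eqP.
by apply: oppr_inj; rewrite -qv // -qw.
Qed.

Lemma gradP v : H1 A v -> is_grad A v (grad A v).
Proof. by move=> [_ [q vq]]; exact: (@xgetPex _ 0 [set q | is_grad A v q] (ex_intro _ q vq)). Qed.

Lemma divP q : Hdiv A q -> is_div A q (div A q).
Proof. by move=> [_ [v qv]]; exact: (@xgetPex _ 0 [set v | is_div A q v] (ex_intro _ v qv)). Qed.

Lemma H1_L2 v : H1 A v -> L2 A v. Proof. by case. Qed.
Lemma Hdiv_L2 q : Hdiv A q -> L2v A q. Proof. by case. Qed.
Lemma grad_L2 v : H1 A v -> L2v A (grad A v). Proof. by move=> /gradP[]. Qed.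
Lemma div_L2 q : Hdiv A q -> L2 A (div A q). Proof. by move=> /divP[]. Qed.

Lemma is_grad_H1 v q : L2 A v -> is_grad A v q -> H1 A v.
Proof. by move=> hv vq; split => //; exists q. Qed.
Lemma is_div_Hdiv q v : L2v A q -> is_div A q v -> Hdiv A q.
Proof. by move=> hq qv; split => //; exists v. Qed.

(** [grad A v] is a chosen weak gradient; paired with an L^2 field it may be replaced by any other
    one, their difference being null. *)
Lemma ipv_gradE v q p : L2 A v -> is_grad A v q -> L2v A p ->
  ipv A (grad A v) p = ipv A q p.
Proof.
move=> hv vq hp; have hg := gradP (is_grad_H1 hv vq).
have := is_grad_unique hg vq; have [h1 _] := hg; have [h2 _] := vq.
move=> /(si_null SvA (subB SvA h1 h2) hp); rewrite (siBl SvA) // => /eqP.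
by rewrite subr_eq0 => /eqP.
Qed.

Lemma ip_divE q v w : L2v A q -> is_div A q v -> L2 A w -> ip A (div A q) w = ip A v w.
Proof.
move=> hq qv hw; have hg := divP (is_div_Hdiv hq qv).
have := is_div_unique hg qv; have [h1 _] := hg; have [h2 _] := qv.
move=> /(si_null SA (subB SA h1 h2) hw); rewrite (siBl SA) // => /eqP.
by rewrite subr_eq0 => /eqP.
Qed.

Lemma H1_sub : subspace (H1 A).
Proof.
split.
  split; first exact: (sub0 SA).
  exists 0; split; first exact: (sub0 SvA).
  move=> phi tphi i; have t1 := test_L2 (test_partial i tphi); have t2 := test_L2 tphi.
  rewrite (si0 SA) // (_ : (fun x => _) = 0); first by rewrite (si0 SA) ?oppr0.
  by apply/funext => x; rewrite mxE.
move=> c v w [hv [p vp]] [hw [q wq]]; split; first exact: (subL SA).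
by exists (c *: p + q); exact: is_gradL.
Qed.

Lemma Hdiv_sub : subspace (Hdiv A).
Proof.
split.
  split; first exact: (sub0 SvA).
  exists 0; split; first exact: (sub0 SA).
  move=> phi tphi; have t1 := gradc_L2 tphi; have t2 := test_L2 tphi.
  by rewrite (si0 SvA) // (si0 SA) ?oppr0.
move=> c p q [hp [v pv]] [hq [w qw]]; split; first exact: (subL SvA).
by exists (c *: v + w); exact: is_divL.
Qed.

Lemma ipv_gradL c v w p : H1 A v -> H1 A w -> L2v A p ->
  ipv A (grad A (c *: v + w)) p = c * ipv A (grad A v) p + ipv A (grad A w) p.
Proof.
move=> hv hw hp; have L := is_gradL c (H1_L2 hv) (H1_L2 hw) (gradP hv) (gradP hw).
rewrite (ipv_gradE _ L) //; last by apply: (subL SA); exact: H1_L2.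
by rewrite (siL SvA) //; exact: grad_L2.
Qed.

Lemma ip_divL c p q w : Hdiv A p -> Hdiv A q -> L2 A w ->
  ip A (div A (c *: p + q)) w = c * ip A (div A p) w + ip A (div A q) w.
Proof.
move=> hp hq hw; have L := is_divL c (Hdiv_L2 hp) (Hdiv_L2 hq) (divP hp) (divP hq).
rewrite (ip_divE _ L) //; last by apply: (subL SvA); exact: Hdiv_L2.
by rewrite (siL SA) //; exact: div_L2.
Qed.

(** The chosen gradient need not be additive pointwise; bilinearity survives because it enters only
    through integrals against L^2 fields. *)
Lemma ipH1_semi : semi_inner (H1 A) (ipH1 A).
Proof.
split; first exact: H1_sub.
- move=> c v w z hv hw hz; rewrite /ipH1.
  rewrite (siL SA c (H1_L2 hv) (H1_L2 hw) (H1_L2 hz)) (ipv_gradL c hv hw (grad_L2 hz)) mulrDr.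
  exact: addrACA.
- move=> v w hv hw; rewrite /ipH1 (siC SA); try exact: H1_L2.
  by rewrite (siC SvA) //; exact: grad_L2.
- move=> v hv; rewrite /ipH1 addr_ge0 //; first by apply: (si_ge0 SA); exact: H1_L2.
  by apply: (si_ge0 SvA); exact: grad_L2.
Qed.

Lemma ipHdiv_semi : semi_inner (Hdiv A) (ipHdiv A).
Proof.
split; first exact: Hdiv_sub.
- move=> c p q r hp hq hr; rewrite /ipHdiv.
  rewrite (siL SvA c (Hdiv_L2 hp) (Hdiv_L2 hq) (Hdiv_L2 hr)) (ip_divL c hp hq (div_L2 hr)) mulrDr.
  exact: addrACA.
- move=> p q hp hq; rewrite /ipHdiv (siC SvA); try exact: Hdiv_L2.
  by rewrite (siC SA) //; exact: div_L2.
- move=> p hp; rewrite /ipHdiv addr_ge0 //; first by apply: (si_ge0 SvA); exact: Hdiv_L2.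
  by apply: (si_ge0 SA); exact: div_L2.
Qed.

Lemma ipH1E v p w q : L2 A v -> is_grad A v p -> L2 A w -> is_grad A w q ->
  ipH1 A v w = ip A v w + ipv A p q.
Proof.
move=> hv vp hw wq; have [hp _] := vp; have [hq _] := wq.
rewrite /ipH1 (ipv_gradE hv vp); last by exact: grad_L2 (is_grad_H1 hw wq).
rewrite (siC SvA hp (grad_L2 (is_grad_H1 hw wq))) (ipv_gradE hw wq) //.
by rewrite (siC SvA hq hp).
Qed.

Lemma ipHdivE p v q w : L2v A p -> is_div A p v -> L2v A q -> is_div A q w ->
  ipHdiv A p q = ipv A p q + ip A v w.
Proof.
move=> hp pv hq qw; have [hv _] := pv; have [hw _] := qw.
rewrite /ipHdiv (ip_divE hp pv); last by exact: div_L2 (is_div_Hdiv hq qw).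
rewrite (siC SA hv (div_L2 (is_div_Hdiv hq qw))) (ip_divE hq qw) //.
by rewrite (siC SA hw hv).
Qed.

Lemma si_cvg_ip (W : lmodType R) (X : set W) B (s : nat -> W) t z : semi_inner X B ->
  (forall k, X (s k)) -> X t -> X z -> si_cvg B s t -> B (s k) z @[k --> \oo] --> B t z.
Proof.
move=> BX Xs Xt Xz st; apply/cvgrPdist_le => e e0.
have b0 := si_ge0 BX Xz.
have d0 : 0 < e ^+ 2 / (B z z + 1) by rewrite divr_gt0 ?exprn_gt0 // ltr_pwDr.
have [N hN] := st _ d0; exists N => // k /= Nk.
rewrite -(siBl BX) // -(ler_pXn2r (ltn0Sn 1)) ?nnegrE ?normr_ge0 ?(ltW e0) //.
rewrite real_normK ?num_real //; apply: le_trans (si_CS BX (subB BX Xt (Xs k)) Xz) _.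
apply: le_trans (ler_wpM2r b0 (hN k Nk)) _.
rewrite -mulrA ler_piMr ?sqr_ge0 // mulrC ler_pdivrMr ?mul1r ?ltr_pwDr //.
by rewrite lerDl.
Qed.

Lemma cvg_lim_eq (u u' : nat -> R) (l l' : R) : u @ \oo --> l -> u' @ \oo --> l' ->
  (forall k, u k = u' k) -> l = l'.
Proof. by move=> ul ul' /funext uu'; rewrite -uu' in ul'; exact: (cvg_unique (@Rhausdorff R) ul ul'). Qed.

(** Functions and gradients converge separately in L^2, and the defining identity of the weak
    gradient, for a fixed test function, is continuous under both limits. *)
Lemma H1_complete : complete_in (H1 A) (H1 A) (ipH1 A).
Proof.
have mA := open_measurable_rV oA.
move=> s hs sC; have hL k := H1_L2 (hs k); have hG k := grad_L2 (hs k).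
have hB k j := subB H1_sub (hs k) (hs j).
have gB k j : is_grad A (s k - s j) (grad A (s k) - grad A (s j)).
  rewrite addrC -scaleN1r [X in is_grad _ _ X]addrC -[- grad _ _]scaleN1r.
  by apply: is_gradL => //; exact: gradP.
have nE k j : ipH1 A (s k - s j) (s k - s j) = ip A (s k - s j) (s k - s j) +
    ipv A (grad A (s k) - grad A (s j)) (grad A (s k) - grad A (s j)).
  by apply: ipH1E => //; exact: (subB SA).
have le1 k j : ip A (s k - s j) (s k - s j) <= ipH1 A (s k - s j) (s k - s j).
  by rewrite nE lerDl; apply: (si_ge0 SvA); exact: (subB SvA).
have le2 k j : ipv A (grad A (s k) - grad A (s j)) (grad A (s k) - grad A (s j)) <=
    ipH1 A (s k - s j) (s k - s j).
  by rewrite nE lerDr; apply: (si_ge0 SA); exact: (subB SA).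
have [||v hv sv] := L2A_complete mA (s := s) => //.
  by move=> e /sC[N hN]; exists N => i j hi hj; apply: le_trans (le1 _ _) (hN _ _ hi hj).
have [||q hq sq] := L2v_complete mA (s := fun k => grad A (s k)) => //.
  by move=> e /sC[N hN]; exists N => i j hi hj; apply: le_trans (le2 _ _) (hN _ _ hi hj).
have vq : is_grad A v q.
  split => // phi tphi i; have t1 := test_L2 (test_partial i tphi); have t2 := test_L2 tphi.
  have c1 := si_cvg_ip SA hL hv t1 sv.
  have sqi : si_cvg (ip A) (fun k => comp (grad A (s k)) i) (comp q i).
    move=> e /sq[N hN]; exists N => k Nk; rewrite -compB; apply: le_trans (hN _ Nk).
    by apply: ip_le_ipv; exact: (subB SvA).
  have c2 := si_cvg_ip SA (fun k => hG k i) (hq i) t2 sqi.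
  apply: (cvg_lim_eq c1 (cvgN c2)) => k.
  by have [_ ->] := gradP (hs k).
exists v; first exact: is_grad_H1 vq.
move=> e e0; have e2 : 0 < e / 2 by rewrite divr_gt0.
have [N1 h1] := sv _ e2; have [N2 h2] := sq _ e2.
exists (maxn N1 N2) => k; rewrite geq_max => /andP[k1 k2].
have gv : is_grad A (v - s k) (q - grad A (s k)).
  rewrite addrC -scaleN1r [X in is_grad _ _ X]addrC -[- grad _ _]scaleN1r.
  by apply: is_gradL => //; exact: gradP.
have hvs := subB SA hv (hL k).
by rewrite (ipH1E hvs gv hvs gv) [leRHS]splitr lerD ?h1 ?h2.
Qed.

Lemma Hdiv_complete : complete_in (Hdiv A) (Hdiv A) (ipHdiv A).
Proof.
have mA := open_measurable_rV oA.
move=> s hs sC; have hL k := Hdiv_L2 (hs k); have hG k := div_L2 (hs k).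
have hB k j := subB Hdiv_sub (hs k) (hs j).
have gB k j : is_div A (s k - s j) (div A (s k) - div A (s j)).
  rewrite addrC -scaleN1r [X in is_div _ _ X]addrC -[- div _ _]scaleN1r.
  by apply: is_divL => //; exact: divP.
have nE k j : ipHdiv A (s k - s j) (s k - s j) = ipv A (s k - s j) (s k - s j) +
    ip A (div A (s k) - div A (s j)) (div A (s k) - div A (s j)).
  by apply: ipHdivE => //; exact: (subB SvA).
have le1 k j : ipv A (s k - s j) (s k - s j) <= ipHdiv A (s k - s j) (s k - s j).
  by rewrite nE lerDl; apply: (si_ge0 SA); exact: (subB SA).
have le2 k j : ip A (div A (s k) - div A (s j)) (div A (s k) - div A (s j)) <=
    ipHdiv A (s k - s j) (s k - s j).
  by rewrite nE lerDr; apply: (si_ge0 SvA); exact: (subB SvA).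
have [||p hp sp] := L2v_complete mA (s := s) => //.
  by move=> e /sC[N hN]; exists N => i j hi hj; apply: le_trans (le1 _ _) (hN _ _ hi hj).
have [||v hv sv] := L2A_complete mA (s := fun k => div A (s k)) => //.
  by move=> e /sC[N hN]; exists N => i j hi hj; apply: le_trans (le2 _ _) (hN _ _ hi hj).
have pv : is_div A p v.
  split => // phi tphi; have t1 := gradc_L2 tphi; have t2 := test_L2 tphi.
  have c1 := si_cvg_ip SvA hL hp t1 sp.
  have c2 := si_cvg_ip SA hG hv t2 sv.
  apply: (cvg_lim_eq c1 (cvgN c2)) => k.
  by have [_ ->] := divP (hs k).
exists p; first exact: is_div_Hdiv pv.
move=> e e0; have e2 : 0 < e / 2 by rewrite divr_gt0.
have [N1 h1] := sp _ e2; have [N2 h2] := sv _ e2.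
exists (maxn N1 N2) => k; rewrite geq_max => /andP[k1 k2].
have gp : is_div A (p - s k) (v - div A (s k)).
  rewrite addrC -scaleN1r [X in is_div _ _ X]addrC -[- div _ _]scaleN1r.
  by apply: is_divL => //; exact: divP.
have hps := subB SvA hp (hL k).
by rewrite (ipHdivE hps gp hps gp) [leRHS]splitr lerD ?h1 ?h2.
Qed.

Lemma test_H1 phi : test_function A phi -> H1 A phi.
Proof. by move=> tphi; apply: is_grad_H1 (is_grad_test tphi); exact: test_L2. Qed.

Lemma normH1_sqr v : H1 A v -> normH1 A v ^+ 2 = ipH1 A v v.
Proof. by move=> hv; rewrite sqr_sqrtr //; exact: (si_ge0 ipH1_semi). Qed.

Lemma H10P v : H10 A v <-> H1 A v /\
  exists2 phi : nat -> E -> R, forall k, test_function A (phi k) & si_cvg (ipH1 A) phi v.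
Proof.
split=> [[hv [phi [tphi cphi]]]|[hv [phi tphi cphi]]]; split => //; exists phi => //.
  move=> e e0; have se0 : 0 < Num.sqrt e by rewrite sqrtr_gt0.
  have /cvgr0_norm_le/(_ _ se0)[N _ hN] := cphi; exists N => k /hN /=.
  have hB := subB H1_sub hv (test_H1 (tphi k)).
  rewrite ger0_norm ?sqrtr_ge0 // ler_sqrt //; exact: ltW.
split => //; apply/cvgr0Pnorm_le => e e0.
have [N hN] := cphi _ (exprn_gt0 2 e0); exists N => // k /= /hN.
have hB := subB H1_sub hv (test_H1 (tphi k)).
rewrite -(normH1_sqr hB) ger0_norm ?sqrtr_ge0 // => h.
by rewrite -(ler_pXn2r (ltn0Sn 1)) ?nnegrE ?sqrtr_ge0 // ltW.
Qed.

Lemma si_null_eq (W : lmodType R) (X : set W) B x y : semi_inner X B -> X x -> X y ->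
  B x x = 0 -> B (x + y) (x + y) = B y y.
Proof.
move=> BX Xx Xy b0; have := si_sqrD BX 1 Xx Xy.
by rewrite scale1r b0 (si_null BX Xx Xy b0) !mulr0 !add0r.
Qed.

Lemma H10_null v w : H1 A v -> H10 A w -> ipH1 A (v - w) (v - w) = 0 -> H10 A v.
Proof.
move=> hv.
move=> /H10P[hw [phi tphi cphi]] vw0.
apply/H10P; split; first exact: hv.
exists phi; first exact: tphi.
move=> e /cphi[N hN]; exists N => k Nk.
have h1 := subB H1_sub hv hw; have h2 := subB H1_sub hw (test_H1 (tphi k)).
have -> : v - phi k = (v - w) + (w - phi k) by rewrite addrA subrK.
by rewrite (si_null_eq ipH1_semi) // hN.
Qed.

Lemma test_H10 phi : test_function A phi -> H10 A phi.
Proof.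
move=> tphi; apply/H10P; split; first exact: test_H1.
exists (fun=> phi) => // e e0; exists 0%N => k _; rewrite subrr.
by rewrite (si0 ipH1_semi) ?ltW //; exact: (sub0 H1_sub).
Qed.

Lemma H10_sub : subspace (H10 A).
Proof.
split; first by apply: test_H10; exact: (sub0 (test_sub A)).
move=> c v w /H10P[hv [phi tphi cphi]] /H10P[hw [psi tpsi cpsi]].
apply/H10P; split; first exact: (subL H1_sub).
exists (fun k => c *: phi k + psi k); first by move=> k; apply: (subL (test_sub A)).
move=> e e0; have c0 : 0 < 2 * (c ^+ 2 + 1) by rewrite mulr_gt0 // ltr_pwDr ?sqr_ge0.
have e1 : 0 < e / (2 * (2 * (c ^+ 2 + 1))) by rewrite divr_gt0 // mulr_gt0.
have [N1 h1] := cphi _ e1; have [N2 h2] := cpsi _ e1.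
exists (maxn N1 N2) => k; rewrite geq_max => /andP[/h1 k1 /h2 k2].
have hvp := subB H1_sub hv (test_H1 (tphi k)); have hwp := subB H1_sub hw (test_H1 (tpsi k)).
have -> : c *: v + w - (c *: phi k + psi k) = c *: (v - phi k) + (w - psi k).
  by rewrite scalerBr opprD addrACA.
have hc := subZ c H1_sub hvp.
apply: le_trans (si_sqrD_le ipH1_semi hc hwp) _.
rewrite (siZ ipH1_semi) // (siZr ipH1_semi) //.
set a := ipH1 _ _ _ in k1 *; set b := ipH1 _ _ _ in k2 *.
have a0 : 0 <= a by exact: (si_ge0 ipH1_semi).
have b0 : 0 <= b by exact: (si_ge0 ipH1_semi).
have D0 : 0 < 2 * (2 * (c ^+ 2 + 1)) by rewrite mulr_gt0.
rewrite ler_pdivlMr // in k1; rewrite ler_pdivlMr // in k2.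
have := sqr_ge0 c; nra.
Qed.

Lemma normal_traceL q c v w : Hdiv A q -> H1 A v -> H1 A w ->
  normal_trace A q (c *: v + w) = c * normal_trace A q v + normal_trace A q w.
Proof.
move=> hq hv hw; rewrite /normal_trace.
have hcw := subL H1_sub c hv hw.
rewrite (siC SvA (Hdiv_L2 hq) (grad_L2 hcw)) ipv_gradL //; last exact: Hdiv_L2.
rewrite (siC SvA (grad_L2 hv) (Hdiv_L2 hq)) (siC SvA (grad_L2 hw) (Hdiv_L2 hq)).
have hd := div_L2 hq.
rewrite (siDr SA (subZ c SA (H1_L2 hv)) (H1_L2 hw) hd) (siZr SA c (H1_L2 hv) hd).
by rewrite mulrDr; exact: addrACA.
Qed.

Lemma normal_traceLl c p q v : Hdiv A p -> Hdiv A q -> H1 A v ->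
  normal_trace A (c *: p + q) v = c * normal_trace A p v + normal_trace A q v.
Proof.
move=> hp hq hv; rewrite /normal_trace (ip_divL c hp hq (H1_L2 hv)).
rewrite (siL SvA c (Hdiv_L2 hp) (Hdiv_L2 hq) (grad_L2 hv)) mulrDr.
exact: addrACA.
Qed.

Lemma normal_traceD q v w : Hdiv A q -> H1 A v -> H1 A w ->
  normal_trace A q (v + w) = normal_trace A q v + normal_trace A q w.
Proof.
by move=> hq hv hw; have := normal_traceL 1 hq hv hw; rewrite scale1r mul1r.
Qed.

Lemma normal_traceB q v w : Hdiv A q -> H1 A v -> H1 A w ->
  normal_trace A q (v - w) = normal_trace A q v - normal_trace A q w.
Proof.
by move=> hq hv hw; rewrite addrC -scaleN1r normal_traceL // mulN1r addrC.
Qed.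

Lemma normal_traceE q d v g : L2v A q -> is_div A q d -> L2 A v -> is_grad A v g ->
  normal_trace A q v = ipv A q g + ip A d v.
Proof.
move=> hq qd hv vg; have [hg _] := vg; rewrite /normal_trace (ip_divE hq qd) //.
by rewrite (siC SvA hq (grad_L2 (is_grad_H1 hv vg))) (ipv_gradE hv vg) // (siC SvA hg hq).
Qed.

Lemma normal_trace_test q phi : Hdiv A q -> test_function A phi -> normal_trace A q phi = 0.
Proof.
move=> hq tphi.
rewrite (normal_traceE (Hdiv_L2 hq) (divP hq) (test_L2 tphi) (is_grad_test tphi)).
by have [_ ->] := divP hq => //; rewrite addNr.
Qed.

Lemma normal_trace_le q v : Hdiv A q -> H1 A v ->
  normal_trace A q v ^+ 2 <= 2 * ipHdiv A q q * ipH1 A v v.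
Proof.
move=> hq hv; have h1 := Hdiv_L2 hq; have h2 := div_L2 hq; have h3 := H1_L2 hv; have h4 := grad_L2 hv.
rewrite /normal_trace /ipHdiv /ipH1.
have := si_CS SvA h1 h4; have := si_CS SA h2 h3.
have := si_ge0 SvA h1; have := si_ge0 SA h2; have := si_ge0 SA h3; have := si_ge0 SvA h4.
move: (ipv A q _) (ip A (div A q) v) (ipv A q q) (ip A _ (div A q)) (ip A v v) (ipv A _ _).
move=> a b c d e f; have := sqr_ge0 (a - b); nra.
Qed.

(** The normal trace vanishes on test functions by the definition of the weak divergence, and it is
    continuous for the H^1 norm. *)
Lemma normal_trace_H10 q v : Hdiv A q -> H10 A v -> normal_trace A q v = 0.
Proof.
move=> hq /H10P[hv [phi tphi cphi]].
apply/eqP; rewrite -sqrf_eq0 eq_le sqr_ge0 andbT; apply/ler_addgt0Pl => e e0; rewrite addr0.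
have b0 := si_ge0 ipHdiv_semi hq.
have e1 : 0 < e / (2 * ipHdiv A q q + 1) by rewrite divr_gt0 // ltr_pwDr // mulr_ge0.
have [N hN] := cphi _ e1; have {}hN := hN N (leqnn N).
have hB := subB H1_sub hv (test_H1 (tphi N)).
have -> : normal_trace A q v = normal_trace A q (v - phi N).
  by rewrite normal_traceB ?(normal_trace_test hq (tphi N)) ?subr0 //; exact: test_H1.
apply: le_trans (normal_trace_le hq hB) _.
rewrite ler_pdivlMr ?ltr_pwDr ?mulr_ge0 // in hN.
have := si_ge0 ipH1_semi hB; nra.
Qed.

(* Hilbert-space projection: H^1 = H^1_0 + {r : div grad r = r}. *)
Lemma normal_trace_eq0_H10 r : H1 A r -> (forall q, Hdiv A q -> normal_trace A q r = 0) ->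
  H10 A r.
Proof.
move=> hr nt0.
have [|||t [ht tr [s [ts st]]]] := @riesz_min _ _ (H1 A) (test_function A) (ipH1 A) (ipH1 A r)
   (ipH1 A r r) ipH1_semi (test_sub A) test_H1.
- by move=> s ts sC; apply: H1_complete => // k; apply: test_H1; exact: ts.
- move=> c x y /test_H1 hx /test_H1 hy.
  have hcx := subZ c H1_sub hx.
  by rewrite (siDr ipH1_semi) // (siZr ipH1_semi).
- by move=> x /test_H1 hx; exact: (si_CS ipH1_semi).
have t0 : H10 A t by apply/H10P; split => //; exists s.
have hrt := subB H1_sub hr ht.
apply: (H10_null hr t0).
(* Here t is the H^1 projection of r on the closure of the test functions, so r - t is orthogonal to
   them; read as a weak identity, this says that the gradient of r - t has divergence r - t. *)
have dg : is_div A (grad A (r - t)) (r - t).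
  split; first exact: H1_L2.
  move=> phi tphi; have hphi := test_H1 tphi; have := tr _ tphi.
  have gphi := is_grad_test tphi; have [hgphi _] := gphi.
  move=> /eqP; rewrite -subr_eq0 -(siBl ipH1_semi) // => /eqP.
  have hL := subB H1_sub ht hr.
  move=> h; have : ipH1 A (r - t) phi = 0.
    by rewrite -opprB (siN ipH1_semi) // h oppr0.
  rewrite (ipH1E (H1_L2 hrt) (gradP hrt) (test_L2 tphi) gphi) addrC => /eqP.
  by rewrite addr_eq0 => /eqP.
have hd : Hdiv A (grad A (r - t)) by apply: is_div_Hdiv dg; exact: grad_L2.
(* The normal trace of this gradient on r is the squared H^1 norm of r - t, so the hypothesis makes
   r - t null. *)
have := nt0 _ hd; have -> : normal_trace A (grad A (r - t)) r =
   normal_trace A (grad A (r - t)) (r - t) + normal_trace A (grad A (r - t)) t.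
  by rewrite -normal_traceD // subrK.
rewrite (normal_trace_H10 hd t0) addr0.
rewrite (normal_traceE (grad_L2 hrt) dg (H1_L2 hrt) (gradP hrt)) => h.
by rewrite /ipH1 addrC.
Qed.

End sobolev_spaces.

(** * Restriction to subdomains and extension by zero *)

Section restriction.
Variables (R : realType) (n : nat).
Local Notation E := 'rV[R]_n.+1.
Local Notation mu := (leb R n.+1).
Implicit Types (A B : set E) (v w phi psi : E -> R) (p q : E -> E).

Lemma funBE (V : zmodType) (f g : E -> V) x : (f - g) x = f x - g x.
Proof. by []. Qed.

Lemma eq_is_grad A v v' q q' : (forall x, A x -> v x = v' x) ->
  (forall x, A x -> q x = q' x) -> is_grad A v q -> is_grad A v' q'.
Proof.
move=> vv qq [hq vq]; split; first exact: eq_L2v hq.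
move=> phi tphi i.
have <- : ip A v (partial i phi) = ip A v' (partial i phi) by apply: eq_ip.
have <- : ip A (fun x => q x 0 i) phi = ip A (fun x => q' x 0 i) phi.
  by apply: eq_ip => // x Ax; rewrite qq.
exact: vq.
Qed.

Lemma eq_is_div A q q' v v' : (forall x, A x -> q x = q' x) ->
  (forall x, A x -> v x = v' x) -> is_div A q v -> is_div A q' v'.
Proof.
move=> qq vv [hv qv]; split; first exact: eq_L2 hv.
move=> phi tphi.
have <- : ipv A q (gradc phi) = ipv A q' (gradc phi) by apply: eq_ipv.
have <- : ip A v phi = ip A v' phi by apply: eq_ip.
exact: qv.
Qed.

Lemma eq_grad A v v' : (forall x, A x -> v x = v' x) -> grad A v = grad A v'.
Proof.
move=> vv; rewrite /grad; congr xget; apply/seteqP; split => q.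
  exact: eq_is_grad.
by apply: eq_is_grad => // x Ax; rewrite vv.
Qed.

Lemma eq_div A q q' : (forall x, A x -> q x = q' x) -> div A q = div A q'.
Proof.
move=> qq; rewrite /div; congr xget; apply/seteqP; split => v.
  exact: eq_is_div.
by apply: eq_is_div => // x Ax; rewrite qq.
Qed.

Lemma eq_H1 A v v' : (forall x, A x -> v x = v' x) -> H1 A v -> H1 A v'.
Proof.
move=> vv [hv [q vq]]; split; first exact: eq_L2 hv.
by exists q; apply: eq_is_grad vq.
Qed.

Lemma eq_Hdiv A q q' : (forall x, A x -> q x = q' x) -> Hdiv A q -> Hdiv A q'.
Proof.
move=> qq [hq [v qv]]; split; first exact: eq_L2v hq.
by exists v; apply: eq_is_div qv.
Qed.

Lemma eq_ipH1 A v v' w w' : (forall x, A x -> v x = v' x) ->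
  (forall x, A x -> w x = w' x) -> ipH1 A v w = ipH1 A v' w'.
Proof. by move=> vv ww; rewrite /ipH1 (eq_ip vv ww) (eq_grad vv) (eq_grad ww). Qed.

Lemma eq_ipHdiv A p p' q q' : (forall x, A x -> p x = p' x) ->
  (forall x, A x -> q x = q' x) -> ipHdiv A p q = ipHdiv A p' q'.
Proof. by move=> pp qq; rewrite /ipHdiv (eq_ipv pp qq) (eq_div pp) (eq_div qq). Qed.

Lemma eq_normal_trace A q q' v v' : (forall x, A x -> q x = q' x) ->
  (forall x, A x -> v x = v' x) -> normal_trace A q v = normal_trace A q' v'.
Proof.
move=> qq vv; rewrite /normal_trace (eq_grad vv) (eq_div qq); congr (_ + _).
  exact: eq_ipv.
exact: eq_ip.
Qed.

Lemma eq_H10 A v v' : (forall x, A x -> v x = v' x) -> H10 A v -> H10 A v'.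
Proof.
move=> vv [hv [phi [tphi cphi]]]; split; first exact: eq_H1 hv.
exists phi; split; first exact: tphi.
have e k : normH1 A (v - phi k) = normH1 A (v' - phi k).
  have h x : A x -> (v - phi k) x = (v' - phi k) x by move=> Ax; rewrite !funBE vv.
  by rewrite /normH1 (eq_ipH1 h h).
apply: cvg_trans cphi; apply: near_eq_cvg; apply: nearW => k.
exact: e.
Qed.

Section sub.
Variables A B : set E.
Hypotheses (BA : B `<=` A) (mB : measurable B).

Lemma zext_sub v : zext B (zext A v) = zext B v.
Proof.
apply/funext => x; have [Bx|Bx] := pselect (B x); last by rewrite !zext_out.
by rewrite !zext_in //; exact: BA.
Qed.

Lemma L2_zext v : L2 setT v -> L2 B v.
Proof.
rewrite /L2 (_ : zext setT v = v); last by apply/funext => x; rewrite zext_in.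
move=> /Lfun2P[mv iv]; have mz : measurable_fun setT (zext B v).
  by apply/(measurable_restrictT _ mB); exact: measurable_funTS.
apply/Lfun2P; split => //; apply: le_lt_trans iv; apply: ge0_le_integral => //.
- by move=> x _; rewrite lee_fin sqr_ge0.
- by apply/measurable_EFinP/measurable_funX.
- by apply/measurable_EFinP/measurable_funX.
move=> x _; rewrite lee_fin; have [Bx|Bx] := pselect (B x); first by rewrite zext_in.
by rewrite zext_out // expr0n sqr_ge0.
Qed.

Lemma L2_restr v : L2 A v -> L2 B v.
Proof.
move=> hv; rewrite /L2 -zext_sub; apply: L2_zext.
by rewrite /L2 (_ : zext setT _ = zext A v) //; apply/funext => x; rewrite zext_in.
Qed.

Lemma L2_zext_restr v : L2 B v -> L2 A (zext B v).
Proof.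
rewrite /L2 (_ : zext A (zext B v) = zext B v) //; apply/funext => x.
have [Ax|Ax] := pselect (A x); first by rewrite zext_in.
by rewrite zext_out // zext_out // => /BA.
Qed.

Lemma L2v_restr q : L2v A q -> L2v B q.
Proof. by move=> hq i; apply: L2_restr; exact: hq. Qed.

Lemma comp_zext q i : comp (zext B q) i = zext B (comp q i).
Proof.
apply/funext => x; have [Bx|Bx] := pselect (B x).
  by rewrite /comp !zext_in.
by rewrite /comp !zext_out // mxE.
Qed.

Lemma L2v_zext_restr q : L2v B q -> L2v A (zext B q).
Proof. by move=> hq i; rewrite -[X in L2 A X]/(comp _ i) comp_zext; apply: L2_zext_restr; exact: hq. Qed.

Lemma ip_zext v w : ip A (zext B v) w = ip B v w.
Proof.
rewrite /ip [LHS]Rintegral_mkcond [RHS]Rintegral_mkcond; apply: eq_Rintegral => x _.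
rewrite /patch; have [Bx|Bx] := pselect (B x).
  by rewrite !mem_set ?zext_in //; exact: BA.
by rewrite zext_out // mul0r [x \in B]memNset //; case: ifP.
Qed.

Lemma ipv_zext p q : ipv A (zext B p) q = ipv B p q.
Proof.
rewrite /ipv [LHS]Rintegral_mkcond [RHS]Rintegral_mkcond; apply: eq_Rintegral => x _.
rewrite /patch; have [Bx|Bx] := pselect (B x).
  by rewrite !mem_set ?zext_in //; exact: BA.
rewrite [x \in B]memNset //; case: ifP => // _; rewrite /dotv big1 // => i _.
by rewrite zext_out // mxE mul0r.
Qed.

Lemma ip_test_restr v phi : test_function B phi -> ip B v phi = ip A v phi.
Proof. by move=> tphi; rewrite !ip_testE //; exact: test_mono tphi. Qed.

Lemma ipv_test_restr q phi : test_function B phi -> ipv B q (gradc phi) = ipv A q (gradc phi).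
Proof.
move=> tphi; have tA := test_mono BA tphi.
rewrite -(ipv_zext q) /ipv; apply: eq_Rintegral => x /set_mem Ax.
have [Bx|Bx] := pselect (B x); first by rewrite zext_in.
rewrite /dotv !big1 // => i _; rewrite mxE (test_out (test_partial i tphi) Bx) mulr0 //.
Qed.

Lemma is_grad_restr v q : is_grad A v q -> is_grad B v q.
Proof.
move=> [hq vq]; split; first exact: L2v_restr.
move=> phi tphi i; have tA := test_mono BA tphi.
rewrite ip_test_restr; last exact: test_partial.
by rewrite (ip_test_restr _ tphi) vq.
Qed.

Lemma is_div_restr q v : is_div A q v -> is_div B q v.
Proof.
move=> [hv qv]; split; first exact: L2_restr.
move=> phi tphi; have tA := test_mono BA tphi.
by rewrite [LHS]ipv_test_restr // (ip_test_restr _ tphi) -qv.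
Qed.

Lemma H1_restr v : H1 A v -> H1 B v.
Proof.
by move=> [hv [q vq]]; split; [exact: L2_restr|exists q; exact: is_grad_restr].
Qed.

Lemma Hdiv_restr q : Hdiv A q -> Hdiv B q.
Proof.
by move=> [hq [v qv]]; split; [exact: L2v_restr|exists v; exact: is_div_restr].
Qed.

Hypotheses (oA : open A) (oB : open B) (finA : (mu A < +oo)%E) (finB : (mu B < +oo)%E).

(** For test functions on B, integration by parts against psi leaves no term on the boundary of B,
    and the identity passes to limits in H^1(B). The zero extension of a general H^1 function would
    jump. *)
Lemma zext_H10_grad v : H10 B v -> is_grad A (zext B v) (zext B (grad B v)).
Proof.
move=> h0; have [hv [phi tphi cphi]] := (H10P oB finB v).1 h0.
have SB := ip_semi B; have SvB := ipv_semi B.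
have hg := grad_L2 hv; split; first exact: L2v_zext_restr.
move=> psi tpsi i; have t1 := L2_restr (test_L2 (test_partial i tpsi)).
have t2 := L2_restr (test_L2 tpsi).
rewrite ip_zext -[X in _ = - ip A X _]/(comp (zext B (grad B v)) i) comp_zext ip_zext.
have tB k := test_H1 (tphi k).
have gk k : is_grad B (v - phi k) (grad B v - gradc (phi k)).
  rewrite addrC -scaleN1r [X in is_grad _ _ X]addrC -[- gradc _]scaleN1r.
  by apply: is_gradL; [exact: test_L2|exact: H1_L2|exact: is_grad_test|exact: gradP].
have hB k : L2 B (v - phi k) by apply: (subB SB); [exact: H1_L2|exact: test_L2].
have gL k : L2v B (grad B v - gradc (phi k)) by have [] := gk k.
have nE k : ipH1 B (v - phi k) (v - phi k) = ip B (v - phi k) (v - phi k) +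
    ipv B (grad B v - gradc (phi k)) (grad B v - gradc (phi k)) by exact: ipH1E.
have c1 : si_cvg (ip B) phi v.
  move=> e /cphi[N hN]; exists N => k /hN; apply: le_trans.
  by rewrite nE lerDl; apply: (si_ge0 SvB).
have c2 : si_cvg (ip B) (fun k => comp (gradc (phi k)) i) (comp (grad B v) i).
  move=> e /cphi[N hN]; exists N => k /hN; apply: le_trans.
  rewrite -compB nE; apply: (@le_trans _ _ (ipv B (grad B v - gradc (phi k)) (grad B v - gradc (phi k)))).
    exact: ip_le_ipv.
  by rewrite lerDr; apply: (si_ge0 SB).
have d1 := si_cvg_ip SB (fun k => test_L2 (tphi k)) (H1_L2 hv) t1 c1.
have d2 := si_cvg_ip SB (fun k => gradc_L2 (tphi k) i) (hg i) t2 c2.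
apply: (cvg_lim_eq d1 (cvgN d2)) => k; rewrite -[RHS]/(- ip B (comp (gradc (phi k)) i) psi) comp_gradc.
rewrite (siC SB (test_L2 (tphi k)) t1) (siC SB (test_L2 (test_partial i (tphi k))) t2).
rewrite (ip_testE _ (tphi k)) (ip_testE _ (test_partial i (tphi k))).
rewrite (integration_by_parts i (tphi k) tpsi) opprK.
by apply: eq_Rintegral.
Qed.

Lemma zext_H10 v : H10 B v -> H10 A (zext B v).
Proof.
move=> h0; have g0 := zext_H10_grad h0.
have [hv [phi tphi cphi]] := (H10P oB finB v).1 h0.
have SB := ip_semi B; have SA := ip_semi A.
have hz : L2 A (zext B v) by apply: L2_zext_restr; exact: H1_L2.
apply/H10P => //; split; first exact: is_grad_H1 g0.
exists phi; first by move=> k; exact: test_mono (tphi k).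
move=> e /cphi[N hN]; exists N => k /hN; apply: le_trans.
have tA := test_mono BA (tphi k).
have gA : is_grad A (zext B v - phi k) (zext B (grad B v) - gradc (phi k)).
  rewrite addrC -scaleN1r [X in is_grad _ _ X]addrC -[- gradc _]scaleN1r.
  by apply: is_gradL; [exact: test_L2|exact: hz|exact: is_grad_test|exact: g0].
have gB : is_grad B (v - phi k) (grad B v - gradc (phi k)).
  rewrite addrC -scaleN1r [X in is_grad _ _ X]addrC -[- gradc _]scaleN1r.
  by apply: is_gradL; [exact: test_L2|exact: H1_L2|exact: is_grad_test|exact: gradP].
have hA : L2 A (zext B v - phi k) by apply: (subB SA) => //; exact: test_L2.
have hB : L2 B (v - phi k) by apply: (subB SB); [exact: H1_L2|exact: test_L2].
rewrite (ipH1E oA finA hA gA hA gA) (ipH1E oB finB hB gB hB gB).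
have -> : zext B v - phi k = zext B (v - phi k).
  apply/funext => x; rewrite /GRing.add /GRing.opp /=.
  have [Bx|Bx] := pselect (B x); first by rewrite !zext_in.
  by rewrite !zext_out // (test_out (tphi k) Bx) oppr0 addr0.
have -> : zext B (grad B v) - gradc (phi k) = zext B (grad B v - gradc (phi k)).
  apply/funext => x; rewrite [LHS]/GRing.add /= [X in _ + X]/GRing.opp /=.
  have [Bx|Bx] := pselect (B x); first by rewrite !zext_in.
  rewrite !zext_out //; apply/rowP => i.
  by rewrite !mxE (test_out (test_partial i (tphi k)) Bx) oppr0 addr0.
rewrite ip_zext ipv_zext lerD //.
  rewrite le_eqVlt; apply/orP; left; apply/eqP.
  by apply: eq_ip => // x Bx; rewrite zext_in.
rewrite le_eqVlt; apply/orP; left; apply/eqP.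
by apply: eq_ipv => // x Bx; rewrite zext_in.
Qed.

End sub.
End restriction.

(** * Lipschitz functions belong to H^1 *)

Section lipschitz_sobolev.
Variables (R : realType) (n : nat).
Local Notation E := 'rV[R]_n.+1.
Local Notation mu := (leb R n.+1).
Implicit Types (A K : set E).

(** The extension is the infimum of the cones f y + L |x - y| over y in K. A globally defined one is
    needed because difference quotients near the boundary look outside the set. *)
Lemma mcshane K (f : E -> R) L : K !=set0 -> 0 <= L ->
  (forall x y, K x -> K y -> `|f x - f y| <= L * `|x - y|) ->
  exists g, (forall x, K x -> g x = f x) /\ forall x y, `|g x - g y| <= L * `|x - y|.
Proof.
move=> [z Kz] L0 fL; pose F x := [set f y + L * `|x - y| | y in K].
have F0 x : F x !=set0 by exists (f z + L * `|x - z|), z.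
have Flb x y : K y -> f z - L * `|x - z| <= f y + L * `|x - y|.
  move=> Ky; have := fL z y Kz Ky; rewrite ler_norml => /andP[_ h].
  have : `|z - y| <= `|x - z| + `|x - y| by rewrite (distrC x z) ler_distD.
  move=> /(ler_wpM2l L0); rewrite mulrDr; lra.
have hlb x : has_lbound (F x) by exists (f z - L * `|x - z|) => _ [y Ky <-]; exact: Flb.
pose g x := inf (F x).
have gle x y : K y -> g x <= f y + L * `|x - y| by move=> Ky; apply: ge_inf => //; exists y.
have key x y : g x <= g y + L * `|x - y|.
  rewrite -lerBlDr; apply: lb_le_inf => // _ [w Kw <-].
  rewrite lerBlDr; apply: le_trans (gle x w Kw) _.
  have : `|x - w| <= `|x - y| + `|y - w| by exact: ler_distD.
  move=> /(ler_wpM2l L0); rewrite mulrDr; lra.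
exists g; split=> [x Kx|x y]; last first.
  have := key x y; have := key y x; rewrite (distrC y x) ler_norml => h1 h2.
  by apply/andP; split; lra.
apply/eqP; rewrite eq_le; apply/andP; split.
  by have := gle x x Kx; rewrite subrr normr0 mulr0 addr0.
apply: lb_le_inf => // _ [y Ky <-].
have := fL x y Kx Ky; rewrite ler_norml => /andP[_ h]; lra.
Qed.

Lemma lipschitz_continuous (g : E -> R) L :
  (forall x y, `|g x - g y| <= L * `|x - y|) -> continuous g.
Proof.
move=> gL x; apply/(@cvgrPdist_le _ _ _ _ (nbhs_filter x)) => e e0.
have L0 : 0 < `|L| + 1 by rewrite ltr_pwDr.
apply/nbhs_ballP; exists (e / (`|L| + 1)); first by rewrite /= divr_gt0.
move=> y /=; rewrite -ball_normE /= ltr_pdivlMr // => h.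
apply: le_trans (gL _ _) _; apply: le_trans (ltW h); rewrite mulrC ler_wpM2l //.
by rewrite (le_trans (ler_norm _)) // lerDl.
Qed.

Lemma bounded_rbox A : bounded_set A -> exists2 r, 0 <= r & A `<=` rbox r.
Proof.
move=> [M [_ hM]]; exists (`|M| + 1); first by rewrite addr_ge0.
move=> x Ax; apply/rboxP; first by rewrite addr_ge0.
by apply: hM => //; rewrite (le_lt_trans (ler_norm M)) // ltrDl.
Qed.

Lemma bounded_fin A : measurable A -> bounded_set A -> (mu A < +oo)%E.
Proof.
move=> mA /bounded_rbox[r _ Ar]; apply: le_lt_trans (leb_rbox n r).
by apply: le_measure; rewrite ?inE //; exact: measurable_rbox.
Qed.

Lemma bounded_fun_L2 A (v : E -> R) M : measurable A -> (mu A < +oo)%E ->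
  measurable_fun setT v -> (forall x, A x -> `|v x| <= M) -> L2 A v.
Proof.
move=> mA finA mv vM; have mz : measurable_fun setT (zext A v).
  by apply/(measurable_restrictT _ mA); exact: measurable_funTS.
apply/Lfun2P; split => //.
have := integrable_lty measurableT (indic_integrable (M ^+ 2) mA finA); apply: le_lt_trans.
apply: ge0_le_integral => //.
- by move=> x _; rewrite lee_fin sqr_ge0.
- by apply/measurable_EFinP/measurable_funX.
- by apply/measurable_EFinP; apply: measurable_funM => //; exact: measurable_indic.
move=> x _; rewrite /= lee_fin indicE; have [Ax|Ax] := pselect (A x); last first.
  by rewrite zext_out // memNset // expr0n /= mulr0.
rewrite zext_in // mem_set // mulr1 -[leLHS]real_normK ?num_real //.
have M0 : 0 <= M by apply: le_trans (vM _ Ax).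
by rewrite ler_pXn2r ?nnegrE ?vM.
Qed.

Lemma Rintegral_norm_test A phi : measurable A -> (mu A < +oo)%E -> test_function A phi ->
  (\int[mu]_x `|phi x|) ^+ 2 <= fine (mu A) * ip A phi phi.
Proof.
move=> mA finA tphi; have SA := ip_semi A.
have L1 : L2 A (cst 1) by apply: (bounded_fun_L2 (M := 1)) => // x _; rewrite normr1.
have Ln : L2 A (fun x => `|phi x|).
  have [r [M tb]] := test_boundsP tphi.
  apply: (bounded_fun_L2 (M := M)) => //; last by move=> x _; rewrite normr_id; exact: (tb_le tb).
  apply: measurableT_comp => //; apply: continuous_measurable_rV; exact: (tb_cont tb).
have := si_CS SA L1 Ln.
have -> : ip A (cst 1) (fun x => `|phi x|) = \int[mu]_x `|phi x|.
  rewrite /ip Rintegral_mkcond; apply: eq_Rintegral => x _; rewrite /patch.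
  by case: ifPn => [_|/negP]; rewrite ?mul1r // inE => nA; rewrite (test_out tphi nA) normr0.
have -> : ip A (cst 1) (cst 1) = fine (mu A).
  transitivity (\int[mu]_(x in A) (1 : R)); last by rewrite Rintegral_cst // mul1r.
  by apply: eq_Rintegral => x _; rewrite mulr1.
by have -> : ip A (fun x => `|phi x|) (fun x => `|phi x|) = ip A phi phi;
  [apply: eq_Rintegral => x _; rewrite -normrM -expr2 ger0_norm ?sqr_ge0 // expr2|].
Qed.

(* The difference quotients of v bound the distributional derivatives of v on
   L^2; the Riesz representation theorem then yields the weak gradient. *)
Lemma lipschitz_H1 A (v : E -> R) : open A -> bounded_set A -> A !=set0 ->
  [lipschitz v x | x in closure A] -> H1 A v.
Proof.
move=> oA bA [a Aa] /lipP[L [L0 vL]]; have mA := open_measurable_rV oA.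
have finA := bounded_fin mA bA.
have K0 : closure A !=set0 by exists a; exact: subset_closure.
have [g [gv gL]] := mcshane K0 L0 vL.
have cg := lipschitz_continuous gL.
apply: (@eq_H1 _ _ _ g) => [x Ax|]; first by apply: gv; exact: subset_closure.
have gl i x t : `|g (x + t *: delta_mx 0 i) - g x| <= L * `|t|.
  apply: le_trans (gL _ _) _; rewrite addrAC subrr add0r normrZ.
  by rewrite ler_wpM2l // ler_piMr // norm_delta.
have SA := ip_semi A.
have /choice[q hq] i : exists t, L2 A t /\ forall phi, test_function A phi ->
    ip A t phi = - \int[mu]_x (g x * partial i phi x).
  (* Cauchy-Schwarz on A turns the L^1 bound of [lipschitz_weak_bound] into an L^2 one, at the price
     of the factor mu(A). *)
  have [||||t [ht tl _]] := @riesz_min _ _ (L2 A) (test_function A) (ip A)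
    (fun phi => - \int[mu]_x (g x * partial i phi x)) (L ^+ 2 * fine (mu A)) SA (test_sub A).
  - by move=> phi; exact: test_L2.
  - by move=> s ts sC; apply: L2A_complete => // k; apply: test_L2; exact: ts.
  - move=> c x y tx ty; have [r [M tb]] := test_boundsP tx; have [r' [M' tb']] := test_boundsP ty.
    have [_ ->] := partial_lin c (fun z => @tb_der _ _ _ _ _ tb i z) (fun z => @tb_der _ _ _ _ _ tb' i z).
    have dx : continuous (partial i x) by exact: (tb_dcont tb).
    have dy : continuous (partial i y) by exact: (tb_dcont tb').
    have I1 := compact_support_integrable (tb_r0 tb) cg dx (fun z zr => tb_dsupp tb i zr).
    have I2 := compact_support_integrable (tb_r0 tb') cg dy (fun z zr => tb_dsupp tb' i zr).
    have -> : \int[mu]_z (g z * (c *: partial i x + partial i y) z) =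
        \int[mu]_z (c * (g z * partial i x z) + g z * partial i y z).
      by apply: eq_Rintegral => z _; rewrite funLE mulrDr mulrCA.
    rewrite RintegralD //; last by have := integrableZl measurableT c I1; apply: eq_integrable.
    by rewrite (RintegralZl _ measurableT I1) opprD mulrN.
  - move=> phi tphi; rewrite sqrrN -[leLHS]real_normK ?num_real //.
    have := lipschitz_weak_bound cg (gl i) tphi.
    move=> h; apply: (@le_trans _ _ ((L * \int[mu]_x `|phi x|) ^+ 2)).
      by rewrite ler_pXn2r // nnegrE mulr_ge0 // Rintegral_ge0.
    rewrite exprMn -[leRHS]mulrA; apply: ler_wpM2l; first exact: sqr_ge0.
    exact: Rintegral_norm_test.
  by exists t.
split.
  have [r r0 Ar] := bounded_rbox bA.
  apply: (bounded_fun_L2 (M := `|g 0| + L * r)) => //; first exact: continuous_measurable_rV.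
  move=> x /Ar/rboxP xr; have := gL x 0; rewrite subr0 => h.
  have -> : g x = (g x - g 0) + g 0 by rewrite subrK.
  apply: le_trans (ler_normD _ _) _; rewrite addrC lerD2l; apply: le_trans h _.
  by rewrite ler_wpM2l // xr.
exists (fun x => \row_i q i x); split.
  by move=> i; apply: eq_L2 (hq i).1 => x _; rewrite mxE.
move=> phi tphi i; rewrite (ip_testE _ (test_partial i tphi)).
have -> : ip A (fun x => (\row_j q j x) 0 i) phi = ip A (q i) phi.
  by apply: eq_ip => // x _; rewrite mxE.
by rewrite (hq i).2 // opprK.
Qed.

End lipschitz_sobolev.

(** * Simplicial meshes *)

Section barycentric.
Variables (R : realType) (n : nat).
Local Notation E := 'rV[R]_n.+1.
Local Notation mu := (leb R n.+1).
Variable p : 'I_n.+2 -> E.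
Hypothesis up : edges p \in unitmx.
Implicit Types (x y e : E) (t : 'I_n.+2 -> R).

(** Linear part of the j-th barycentric coordinate: for j other than 0, a coordinate in the basis of
    the edges issued from the vertex 0; for j = 0, minus the sum of these. *)
Definition blin (j : 'I_n.+2) (x : E) : R :=
  if unlift ord0 j is Some k then (x *m invmx (edges p)) 0 k
  else - \sum_k (x *m invmx (edges p)) 0 k.

Definition bary x j : R := blin j (x - p ord0) + (j == ord0)%:R.

Lemma blinL j c x y : blin j (c *: x + y) = c * blin j x + blin j y.
Proof.
rewrite /blin; case: unliftP => [k _|_].
  by rewrite mulmxDl -scalemxAl !mxE.
rewrite mulrN -opprD mulr_sumr -big_split; congr (- _); apply: eq_bigr => k _ /=.
by rewrite mulmxDl -scalemxAl !mxE.
Qed.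

Lemma sum_bary x : \sum_j bary x j = 1.
Proof.
rewrite big_ord_recl (eq_bigr (fun k => ((x - p ord0) *m invmx (edges p)) 0 k)).
  by rewrite /bary /blin unlift_none eqxx addrAC addNr add0r.
by move=> k _; rewrite /bary /blin liftK /= addr0.
Qed.

Lemma baryE x : x = \sum_j bary x j *: p j.
Proof.
have -> : \sum_j bary x j *: p j = p ord0 + \sum_j bary x j *: (p j - p ord0).
  under [in RHS]eq_bigr do rewrite scalerBr.
  by rewrite sumrB -scaler_suml sum_bary scale1r addrCA subrr addr0.
rewrite big_ord_recl subrr scaler0 add0r.
rewrite (eq_bigr (fun k => ((x - p ord0) *m invmx (edges p)) 0 k *: row k (edges p))); last first.
  by move=> k _; rewrite /bary /blin liftK /= addr0 rowK.
by rewrite -mulmx_sum_row mulmxKV // addrC subrK.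
Qed.

Lemma bary_unique x t : \sum_j t j = 1 -> x = \sum_j t j *: p j -> forall j, t j = bary x j.
Proof.
move=> t1 xt.
have h : x - p ord0 = (\row_k t (lift ord0 k)) *m edges p.
  rewrite mulmx_sum_row xt -[p ord0]scale1r -t1 scaler_suml -sumrB big_ord_recl subrr add0r.
  by apply: eq_bigr => k _; rewrite mxE rowK scalerBr.
have tk k : t (lift ord0 k) = bary x (lift ord0 k).
  by rewrite /bary /blin liftK /= addr0 h mulmxK // mxE.
move=> j; case: (unliftP ord0 j) => [k ->|->]; first exact: tk.
have e : \sum_k t (lift ord0 k) = \sum_k bary x (lift ord0 k) by apply: eq_bigr.
have : \sum_j t j = \sum_j bary x j by rewrite t1 sum_bary.
by rewrite [LHS]big_ord_recl [RHS]big_ord_recl e => /addIr.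
Qed.

Lemma bary_vertex i j : bary (p i) j = (i == j)%:R.
Proof.
apply/esym; apply: (@bary_unique _ (fun j => (i == j)%:R)).
  by rewrite (bigD1 i) //= eqxx big1 ?addr0 // => k /negPf; rewrite eq_sym => ->.
rewrite (bigD1 i) //= eqxx scale1r big1 ?addr0 // => k /negPf; rewrite eq_sym => ->.
by rewrite scale0r.
Qed.

Lemma cellP x : cell p x <-> forall j, 0 < bary x j.
Proof.
split=> [[t [t0 t1 xt]] j|h]; first by rewrite -(bary_unique t1 xt).
by exists (bary x); split => //; [exact: sum_bary|exact: baryE].
Qed.

Lemma hullP (I : set 'I_n.+2) x : hull p I x <->
  (forall j, 0 <= bary x j) /\ (forall j, ~ I j -> bary x j = 0).
Proof.
split=> [[t [t0 tI t1 xt]]|[h hI]].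
  by split=> j; rewrite -(bary_unique t1 xt) //; exact: tI.
by exists (bary x); split => //; [exact: sum_bary|exact: baryE].
Qed.

Lemma blin_continuous j : continuous (blin j).
Proof.
have h k : continuous (fun x : E => (x *m invmx (edges p)) 0 k).
  have -> : (fun x : E => (x *m invmx (edges p)) 0 k) =
      (fun x : E => \sum_l x 0 l * invmx (edges p) l k).
    by apply/funext => x; rewrite mxE.
  apply: continuous_big => [y|l _ x]; first exact: add_continuous.
  exact: (@continuousM R E (fun y : E => y 0 l) (fun=> invmx (edges p) l k) x (@coord_continuous R 1 n.+1 0 l x) (@cst_continuous E R _ x)).
rewrite /blin; case: unliftP => [k _|_]; first exact: h.
move=> x; apply: continuousN; move: x; apply: continuous_big => [y|l _].
  exact: add_continuous.
exact: h.
Qed.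

Lemma bary_line x e s j : bary (x + s *: e) j = bary x j + s * blin j e.
Proof. by rewrite /bary addrAC [_ + s *: e]addrC blinL; ring. Qed.

Lemma bary_blin x j : bary x j = blin j x - (blin j (p ord0) - (j == ord0)%:R).
Proof. by rewrite /bary -scaleN1r addrC [x + _]addrC blinL; ring. Qed.

Lemma bary_continuous j : continuous (fun x => bary x j).
Proof.
move=> x; have c : continuous (fun y => blin j y + (- blin j (p ord0) + (j == ord0)%:R)).
  by move=> y; exact: (@continuousD R R E (blin j) (fun=> _) y (@blin_continuous j y) (@cst_continuous E R _ y)).
have e y : bary y j = blin j y + (- blin j (p ord0) + (j == ord0)%:R).
  by rewrite bary_blin opprB [- _ + _]addrC.
have -> : (fun x => bary x j) = (fun y => blin j y + (- blin j (p ord0) + (j == ord0)%:R)).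
  by apply/funext => y; exact: e.
exact: c.
Qed.

Lemma cell_open : open (cell p).
Proof.
rewrite openE => x /cellP h; rewrite /interior /=.
have : \forall y \near x, forall j, 0 < bary y j.
  apply: (@filter_forall E 'I_n.+2 (fun j y => 0 < bary y j) (nbhs x) _) => j; have o : open [set y : R | 0 < y] by exact: open_gt.
  exact: (@bary_continuous j x _ (open_nbhs_nbhs (conj o (h j)))).
by apply: filterS => y hy; apply/cellP.
Qed.

Lemma hull_closed : closed (hull p setT).
Proof.
rewrite (_ : hull p setT = \bigcap_(j in [set: 'I_n.+2]) (fun x => bary x j) @^-1` [set y | 0 <= y]).
  apply: closed_bigI => j _; apply: preimage_closed; last exact: closed_ge.
  by move=> x _; exact: bary_continuous.
apply/seteqP; split => x.
  by move=> /hullP[h _] j _; exact: h.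
by move=> h; apply/hullP; split => [j|j []//]; exact: (h j I).
Qed.

Lemma hull_norm x : hull p setT x -> `|x| <= \sum_j `|p j|.
Proof.
move=> [t [t0 _ t1 ->]]; apply: le_trans (ler_norm_sum _ _ _) _.
apply: ler_sum => j _; rewrite normrZ ger0_norm // ler_piMl //.
by rewrite -t1 (bigD1 j) //= lerDl sumr_ge0.
Qed.

(* Moving away from the vertex j makes the j-th coordinate negative. *)
Lemma open_sub_hull (B : set E) : open B -> B `<=` hull p setT -> B `<=` cell p.
Proof.
move=> oB Bh x Bx; apply/cellP => j; have /hullP[h _] := Bh x Bx.
rewrite lt_neqAle h andbT; apply/eqP => bj.
pose e := x - p j.
have le1 : blin j e = -1.
  have := bary_line (p j) e 1 j; rewrite scale1r mul1r /e addrC subrK -bj bary_vertex eqxx => /eqP.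
  by rewrite addrC -subr_eq sub0r => /eqP.
have /nbhs_ballP[d /= d0 dB] := open_nbhs_nbhs (conj oB Bx).
pose s := d / (2 * (`|e| + 1)); have e1 : 0 < `|e| + 1 by rewrite ltr_pwDr.
have s0 : 0 < s by rewrite divr_gt0 // mulr_gt0.
have /Bh/hullP[+ _] : B (x + s *: e).
  apply: dB; rewrite -ball_normE /= opprD addrA subrr sub0r normrN normrZ gtr0_norm //.
  rewrite /s mulrAC ltr_pdivrMr ?mulr_gt0 // ltr_pM2l //.
  have := normr_ge0 e; lra.
by move=> /(_ j); rewrite bary_line -bj le1 mulrN1 add0r oppr_ge0 leNgt s0.
Qed.

(** Along an edge from another vertex k to the vertex j the coordinate has slope 1, so its zero set
    is a hyperplane transversal to that edge. *)
Lemma leb_face0 j : mu [set x | bary x j = 0] = 0%E.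
Proof.
have [k kj] : exists k : 'I_n.+2, k != j.
  by exists (lift j ord0); rewrite eq_sym neq_lift.
have le : blin j (p j - p k) = 1.
  have := bary_line (p k) (p j - p k) 1 j; rewrite scale1r mul1r addrC subrK !bary_vertex eqxx.
  by rewrite (negPf kj) add0r.
have h := @leb_hyperplane R n.+1 (blin j) (blin j (p ord0) - (j == ord0)%:R) (p j - p k).
rewrite (_ : [set x | bary x j = 0] = [set x | blin j x = blin j (p ord0) - (j == ord0)%:R]).
  apply: h.
  - exact: (@continuous_measurable_rV R n.+1 (blin j) (@blin_continuous j)).
  - by rewrite le oner_eq0.
  - by move=> x t; rewrite addrC blinL; ring.
apply/seteqP; split => x /=; rewrite bary_blin => /eqP.
  by rewrite subr_eq0 => /eqP.
by rewrite -subr_eq0 => /eqP.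
Qed.

End barycentric.

(** * Distance between two simplices of a conforming mesh *)

Section common_part.
Variables (R : realType) (m : nat).
Implicit Types (e : 'I_m -> 'I_m -> bool) (s t : 'I_m -> R).

(** Meant for a partial matching e of the vertices of two simplices: the sum then has at most one
    nonzero term, the smaller of the two coordinates at a matched vertex, and is 0 at an unmatched
    one. *)
Definition common_part e s t k : R := \sum_l (e k l)%:R * Num.min (s k) (t l).

Lemma common_partE e s t k l : (forall l', e k l' -> l' = l) -> e k l ->
  common_part e s t k = Num.min (s k) (t l).
Proof.
move=> h ekl; rewrite /common_part (bigD1 l) //= ekl mul1r big1 ?addr0 // => l' l'l.
by case: (boolP (e k l')) => [/h ll|_]; [rewrite ll eqxx in l'l|rewrite mul0r].
Qed.

Lemma common_part_bound e s t k : (forall l l', e k l -> e k l' -> l = l') ->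
  (forall k, 0 <= s k) -> (forall l, 0 <= t l) -> 0 <= common_part e s t k <= s k.
Proof.
move=> he s0 t0; case: (pselect (exists l, e k l)) => [[l ekl]|h].
  rewrite (common_partE _ _ (fun l' h => he _ _ h ekl) ekl).
  by rewrite le_min s0 t0 ge_min lexx.
rewrite /common_part big1 ?lexx ?s0 // => l _.
by case: (boolP (e k l)) => [ekl|_]; [case: h; exists l|rewrite mul0r].
Qed.

Lemma sum_common_part (V : lmodType R) e s t (a b : 'I_m -> V) :
  (forall k l, e k l -> a k = b l) ->
  \sum_k common_part e s t k *: a k = \sum_l common_part (fun l k => e k l) t s l *: b l.
Proof.
move=> ab; under eq_bigr do rewrite scaler_suml.
rewrite exchange_big /=; apply: eq_bigr => l _; rewrite scaler_suml.
apply: eq_bigr => k _; rewrite minC; case: (boolP (e k l)) => [/ab ->//|_].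
by rewrite !mul0r !scale0r.
Qed.

End common_part.

Section separation.
Variables (R : realType) (n : nat).
Local Notation E := 'rV[R]_n.+1.
Variables p q : 'I_n.+2 -> E.
Hypotheses (up : edges p \in unitmx) (uq : edges q \in unitmx).
Hypothesis pq : hull p setT `&` hull q setT = hull p [set k | exists l, p k = q l].
Let e k l := p k == q l.

Lemma vertex_inj (r : 'I_n.+2 -> E) : edges r \in unitmx -> injective r.
Proof.
move=> ur k l rkl; have := bary_vertex ur k l; rewrite rkl bary_vertex // eqxx.
by case: eqP => // _ /eqP; rewrite oner_eq0.
Qed.

Let el k l l' : e k l -> e k l' -> l = l'.
Proof. by move=> /eqP pl /eqP pl'; apply: (vertex_inj uq); rewrite -pl. Qed.

Let ek l k k' : e k l -> e k' l -> k = k'.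
Proof. by move=> /eqP pk /eqP pk'; apply: (vertex_inj up); rewrite pk. Qed.

(** Pairs of points without common part: at each shared vertex one of the two coordinates vanishes.
    The set is compact, and conformity keeps it off the diagonal. *)
Let Q : set (E * E) := (hull p setT `*` hull q setT) `&`
  \bigcap_(kl in [set kl : 'I_n.+2 * 'I_n.+2 | e kl.1 kl.2])
    [set xy | bary p xy.1 kl.1 * bary q xy.2 kl.2 = 0].

Lemma hull_compact (r : 'I_n.+2 -> E) : edges r \in unitmx -> compact (hull r setT).
Proof.
move=> ur; apply: bounded_closed_compact; last exact: hull_closed.
exists (\sum_j `|r j|); split; first exact: num_real.
by move=> M rM x /hull_norm /le_trans; apply; exact: ltW.
Qed.

Let fst_cont : continuous (@fst E E). Proof. by move=> x; exact: cvg_fst. Qed.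

Let snd_cont : continuous (@snd E E). Proof. by move=> x; exact: cvg_snd. Qed.

Let Q_compact : compact Q.
Proof.
apply: compact_closedI; first by apply: compact_setX; exact: hull_compact.
apply: closed_bigI => -[k l] _ /=.
have c : continuous (fun xy : E * E => bary p xy.1 k * bary q xy.2 l).
  move=> xy; apply: (@continuousM R _ (fun xy : E * E => bary p xy.1 k) (fun xy : E * E => bary q xy.2 l)).
    by apply: (@continuous_comp _ _ _ fst (fun x => bary p x k)); [exact: fst_cont|exact: bary_continuous].
  by apply: (@continuous_comp _ _ _ snd (fun x => bary q x l)); [exact: snd_cont|exact: bary_continuous].
apply: (@preimage_closed _ _ (fun xy : E * E => bary p xy.1 k * bary q xy.2 l) [set 0]).
  by move=> x _; exact: c.
exact: closed_eq.
Qed.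

(** A common point lies in the common face, so by uniqueness its coordinates in p and in q coincide
    at shared vertices; as their products are 0 they all vanish, although they sum to 1. *)
Let Q_neq x y : Q (x, y) -> x != y.
Proof.
move=> [[/= px qy] Qxy]; apply/eqP => xy; rewrite -{y}xy in qy Qxy.
have : (hull p setT `&` hull q setT) x by [].
rewrite pq => /(hullP up)[b0 bS].
pose t l := \sum_k (e k l)%:R * bary p x k.
have tE k l : e k l -> t l = bary p x k.
  move=> ekl; rewrite /t (bigD1 k) //= ekl mul1r big1 ?addr0 // => k' kk'.
  by case: (boolP (e k' l)) => [/(ek ekl) h|_]; [rewrite h eqxx in kk'|rewrite mul0r].
have sumE (V : lmodType R) (F : 'I_n.+2 -> V) (G : 'I_n.+2 -> V) :
    (forall k l, e k l -> F k = G l) -> \sum_k bary p x k *: F k = \sum_l t l *: G l.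
  move=> FG; under [RHS]eq_bigr do rewrite scaler_suml.
  rewrite exchange_big /=; apply: eq_bigr => k _.
  case: (pselect (exists l, p k = q l)) => [[l /eqP ekl]|nS].
    have {}ekl : e k l := ekl; rewrite (bigD1 l) //= ekl mul1r (FG _ _ ekl) big1 ?addr0 // => l' l'l.
    case: (boolP (e k l')) => [/(el ekl) h|_]; last by rewrite mul0r scale0r.
    by rewrite h eqxx in l'l.
  by rewrite (bS _ nS) scale0r big1 // => l _; rewrite mulr0 scale0r.
have tq : forall l, t l = bary q x l.
  apply: bary_unique => //.
    by have := sumE R^o (fun=> 1) (fun=> 1) (fun _ _ _ => erefl); rewrite /GRing.scale /=;
       under eq_bigr do rewrite mulr1; rewrite sum_bary // => ->; apply: eq_bigr => l _; rewrite mulr1.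
  rewrite {1}(baryE up x); apply: sumE => k l /eqP //.
have s0 k : bary p x k = 0.
  case: (pselect (exists l, p k = q l)) => [[l /eqP ekl]|nS]; last exact: bS.
  have := Qxy (k, l) ekl; rewrite /= -tq (tE _ _ ekl) => /eqP.
  by rewrite mulf_eq0 orbb => /eqP.
have := sum_bary p x; rewrite big1 // => /eqP.
by rewrite eq_sym oner_eq0.
Qed.

Let Q_sep : exists2 c : R, 0 < c & forall x y, Q (x, y) -> c <= `|x - y|.
Proof.
case: (pselect (Q !=set0)) => [Q0|Q0]; last first.
  by exists 1 => // x y Qxy; case: Q0; exists (x, y).
have cf : {within Q, continuous (fun xy : E * E => `|xy.1 - xy.2|)}.
  apply: continuous_subspaceT => xy; apply: (@continuous_comp _ _ _ (fun xy : E * E => xy.1 - xy.2) Num.norm).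
    by apply: (@continuousB R _ _ (fun xy : E * E => xy.1) (fun xy => xy.2)); [exact: fst_cont|exact: snd_cont].
  exact: norm_continuous.
have [[x y] /set_mem Qxy h] := compact_EVT_min Q0 Q_compact cf.
exists `|x - y|; first by rewrite normr_gt0 subr_eq0 Q_neq.
by move=> x' y' Q'; apply: (h (x', y')); exact: mem_set.
Qed.

(* Removing from x and y the common part of their barycentric coordinates does not
   change x - y and leaves points supported by disjoint sets of vertices. *)
Lemma simplex_separation : exists2 K : R, 0 <= K & forall x y,
  hull p setT x -> hull q setT y ->
  (exists z, [/\ hull p setT z, hull q setT z & `|x - z| <= K * `|x - y|]) \/
  1 <= K * `|x - y|.
Proof.
have [c c0 hc] := Q_sep; pose D := \sum_j `|p j|.
have D0 : 0 <= D by exact: sumr_ge0.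
(* D bounds the norm on the simplex p. The part 2 D / c serves when x and y have a common part, and
   1 / c when they have none. *)
exists ((1 + 2 * D) / c); first by apply: divr_ge0; [rewrite addr_ge0 // mulr_ge0|exact: ltW].
move=> x y hx hy; pose s := bary p x; pose t := bary q y.
have s0 k : 0 <= s k by have /(hullP up)[h _] := hx; exact: h.
have t0 k : 0 <= t k by have /(hullP uq)[h _] := hy; exact: h.
pose r k := common_part e s t k; pose r' l := common_part (fun l k => e k l) t s l.
have rs k : 0 <= r k <= s k by apply: common_part_bound => //; exact: el.
have rt l : 0 <= r' l <= t l by apply: common_part_bound => // k k'; exact: ek.
pose rho := \sum_k r k; have rho0 : 0 <= rho by apply: sumr_ge0 => k _; case/andP: (rs k).
have rho' : rho = \sum_l r' l.
  have := @sum_common_part R _ R^o e s t (fun=> 1) (fun=> 1) (fun _ _ _ => erefl).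
  by rewrite /GRing.scale /=; under eq_bigr do rewrite mulr1; under [RHS]eq_bigr do rewrite mulr1.
have rq : \sum_k r k *: p k = \sum_l r' l *: q l.
  by apply: sum_common_part => k l /eqP.
have rho1 : rho <= 1.
  by rewrite -(sum_bary p x); apply: ler_sum => k _; case/andP: (rs k).
pose x1 := \sum_k (s k - r k) *: p k; pose y1 := \sum_l (t l - r' l) *: q l.
have xE : x = x1 + \sum_k r k *: p k.
  by rewrite {1}(baryE up x) -big_split; apply: eq_bigr => k _; rewrite /= scalerBl subrK.
have yE : y = y1 + \sum_k r k *: p k.
  by rewrite {1}(baryE uq y) rq -big_split; apply: eq_bigr => k _; rewrite /= scalerBl subrK.
have xy : x - y = x1 - y1 by rewrite xE {1}yE opprD addrACA subrr addr0.
(* Divided by their mass 1 - rho, the two remainders form a pair of [Q], hence are at distance at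
   least c. *)
have sep : (1 - rho) * c <= `|x - y|.
  have [->|rn1] := eqVneq rho 1; first by rewrite subrr mul0r.
  have d0 : 0 < 1 - rho by rewrite subr_gt0 lt_neqAle rn1.
  have sE k : (s k - r k) / (1 - rho) = bary p ((1 - rho)^-1 *: x1) k.
    move: k; apply: bary_unique => //.
      by rewrite -mulr_suml sumrB sum_bary divff // gt_eqF.
    by rewrite scaler_sumr; apply: eq_bigr => k _; rewrite scalerA mulrC.
  have tE k : (t k - r' k) / (1 - rho) = bary q ((1 - rho)^-1 *: y1) k.
    move: k; apply: bary_unique => //.
      by rewrite -mulr_suml sumrB sum_bary -rho' divff // gt_eqF.
    by rewrite scaler_sumr; apply: eq_bigr => k _; rewrite scalerA mulrC.
  have : Q ((1 - rho)^-1 *: x1, (1 - rho)^-1 *: y1).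
    split; [split => /=|move=> [k l] /= ekl].
    - apply/(hullP up); split=> [k|k []//]; rewrite -sE; apply: divr_ge0; [rewrite subr_ge0|exact: ltW].
      by case/andP: (rs k).
    - apply/(hullP uq); split=> [k|k []//]; rewrite -tE; apply: divr_ge0; [rewrite subr_ge0|exact: ltW].
      by case/andP: (rt k).
    - have h1 := common_partE s t (fun l' h => el h ekl) ekl.
      have h2 := common_partE t s (e := fun l k => e k l) (fun k' h => ek h ekl) ekl.
      rewrite -sE -tE /r /r' h1 h2 minC; case: (leP (t l) (s k)) => _; rewrite subrr mul0r ?mulr0 //.
      by rewrite mul0r.
  move=> /hc; rewrite -scalerBr normrZ -xy gtr0_norm ?invr_gt0 // mulrC ler_pdivlMr //.
  by rewrite mulrC.
have [rz|rn0] := eqVneq rho 0.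
  right; rewrite mulrAC ler_pdivlMr // mul1r; apply: le_trans (_ : 1 * `|x - y| <= _).
    by rewrite mul1r; move: sep; rewrite rz subr0 mul1r.
  by rewrite ler_wpM2r // lerDl mulr_ge0.
have rp : 0 < rho by rewrite lt_neqAle eq_sym rn0.
(* Normalised, the common part is a point of both simplices; x - z involves only masses 1 - rho,
   which [sep] bounds by |x - y| / c. *)
left; pose z := rho^-1 *: \sum_k r k *: p k.
have rzE k : r k / rho = bary p z k.
  move: k; apply: bary_unique => //; first by rewrite -mulr_suml divff.
  by rewrite /z scaler_sumr; apply: eq_bigr => k _; rewrite scalerA mulrC.
have rzE' k : r' k / rho = bary q z k.
  move: k; apply: bary_unique => //; first by rewrite -mulr_suml -rho' divff.
  by rewrite /z rq scaler_sumr; apply: eq_bigr => k _; rewrite scalerA mulrC.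
have pz : hull p setT z.
  apply/(hullP up); split=> [k|k []//]; rewrite -rzE; apply: divr_ge0; last exact: ltW.
  by case/andP: (rs k).
exists z; split => //.
  apply/(hullP uq); split=> [k|k []//]; rewrite -rzE'; apply: divr_ge0; last exact: ltW.
  by case/andP: (rt k).
have x1D : `|x1| <= (1 - rho) * D.
  have pj k : `|p k| <= D by rewrite /D (bigD1 k) //= lerDl sumr_ge0.
  apply: le_trans (ler_norm_sum _ _ _) _.
  rewrite -(sum_bary p x) -sumrB mulr_suml; apply: ler_sum => k _.
  by rewrite normrZ ger0_norm ?subr_ge0 ?ler_wpM2l ?subr_ge0 //; case/andP: (rs k).
have xz : x - z = x1 - (1 - rho) *: z.
  rewrite {1}xE scalerBl scale1r /z scalerA divff // scale1r opprB.
  by rewrite -addrA; congr (_ + _); rewrite addrC [LHS]addrC.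
rewrite xz; apply: le_trans (ler_normB _ _) _; rewrite normrZ ger0_norm ?subr_ge0 //.
have zD : (1 - rho) * `|z| <= (1 - rho) * D by rewrite ler_wpM2l ?subr_ge0 //; exact: hull_norm.
rewrite mulrAC ler_pdivlMr //.
have h : (1 - rho) * c * (2 * D) <= `|x - y| * (2 * D) by rewrite ler_wpM2r // mulr_ge0.
have h0 := normr_ge0 (x - y).
have h3 : (`|x1| + (1 - rho) * `|z|) * c <= (2 * ((1 - rho) * D)) * c.
  apply: ler_wpM2r; [exact: ltW|lra].
move: h0 h h3; lra.
Qed.

End separation.

(** * Geometry of the mesh *)

Section mesh.
Variables (R : realType) (n : nat).
Local Notation E := 'rV[R]_n.+1.
Local Notation mu := (leb R n.+1).
Variables (Omega : set E) (N : nat) (a : 'I_N -> 'I_n.+2 -> E).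
Hypotheses (oO : open Omega) (bO : bounded_set Omega).
Hypothesis hmesh : conforming_mesh Omega a.
Local Notation T i := (cell (a i)).
Implicit Types (v w phi : E -> R) (p q : E -> E).

Lemma edges_unit i : edges (a i) \in unitmx. Proof. by case: hmesh. Qed.

Lemma closure_cell i : closure (T i) = hull (a i) setT.
Proof.
have [_ _ _ _ /(_ i i)] := hmesh; rewrite setIid => ->; congr hull.
by apply/seteqP; split => // k _; exists k.
Qed.

Lemma cell_sub i : T i `<=` Omega. Proof. by case: hmesh. Qed.

Lemma open_cell i : open (T i). Proof. exact: cell_open (edges_unit i). Qed.

Lemma measurable_cell i : measurable (T i).
Proof. exact: open_measurable_rV (@open_cell i). Qed.

Lemma bounded_cell i : bounded_set (T i).
Proof.
have [M [M1 hM]] := bO; exists M; split => // r Mr x Tx.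
by apply: hM => //; exact: cell_sub Tx.
Qed.

Lemma cell_fin i : (mu (T i) < +oo)%E.
Proof. exact: bounded_fin (@measurable_cell i) (@bounded_cell i). Qed.

Lemma Omega_measurable : measurable Omega.
Proof. exact: open_measurable_rV oO. Qed.

Lemma Omega_fin : (mu Omega < +oo)%E.
Proof. exact: bounded_fin Omega_measurable bO. Qed.

(** A point of an open cell has positive coordinates at all vertices, while conformity puts a point
    common with another closed cell in the face of shared vertices. So all vertices are shared, the
    first cell lies in the closure of the second and, being open, in the second itself; symmetry
    gives equality. *)
Lemma cell_closure_eq i j x : T i x -> closure (T j) x -> i = j.
Proof.
have [_ inj _ _ conf] := hmesh.
have sub k l y : T k y -> closure (T l) y -> T k `<=` T l.
  move=> Ty Cy; apply: (open_sub_hull (edges_unit l) (@open_cell k)).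
  have h : (closure (T k) `&` closure (T l)) y by split => //; exact: subset_closure.
  rewrite conf in h; have /(hullP (edges_unit k))[_ hS] := h.
  have S m : exists l0, a k m = a l l0.
    apply/not_existsP => nS; have /(cellP (edges_unit k))/(_ m) := Ty.
    by rewrite hS ?ltxx // => -[l0 e]; exact: (nS l0).
  rewrite -closure_cell => z Tz.
  suff [] : (closure (T k) `&` closure (T l)) z by [].
  rewrite conf; apply/(hullP (edges_unit k)); split=> [m|m nm]; last by case: nm; exact: S.
  by have /(cellP (edges_unit k))/(_ m)/ltW := Tz.
move=> Ti Cj; have s := sub i j x Ti Cj.
apply: inj; apply/seteqP; split => //.
by apply: (sub j i x (s _ Ti)); exact: subset_closure.
Qed.

Lemma cell_eq i j x : T i x -> T j x -> i = j.
Proof. by move=> Ti Tj; apply: cell_closure_eq Ti _; exact: subset_closure. Qed.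

Lemma mesh_cover x : Omega x -> exists i, closure (T i) x.
Proof.
have [_ _ _ cov _] := hmesh => /subset_closure; rewrite -cov => -[i _ h].
by exists i.
Qed.

(** A point of Omega in no open cell has a vanishing barycentric coordinate in some cell, so it lies
    on one of finitely many hyperplanes. *)
Lemma mesh_null : mu.-negligible (Omega `\` \bigcup_i T i).
Proof.
pose F (i : 'I_N) (k : 'I_n.+2) := [set x | bary (a i) x k = 0].
have F0 i k : mu.-negligible (F i k).
  have mF : measurable (F i k).
    have mb : measurable_fun setT (fun x => bary (a i) x k).
      by apply: continuous_measurable_rV; exact: bary_continuous.
    by rewrite -[F i k]setTI; exact: (mb measurableT _ (measurable_set1 0)).
  by apply/negligibleP => //; exact: leb_face0 (edges_unit i) k.
apply: (@negligibleS _ _ _ mu (\big[setU/set0]_i \big[setU/set0]_k F i k)).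
  move=> x [Ox nT]; have [i] := mesh_cover Ox.
  rewrite closure_cell => /(hullP (edges_unit i))[b0 _].
  have /existsNP[k nk] : ~ (forall k, 0 < bary (a i) x k).
    by move=> h; apply: nT; exists i => //; apply/(cellP (edges_unit i)).
  rewrite (bigD1 i) //=; left; rewrite (bigD1 k) //=; left.
  by apply/eqP; move: (b0 k); rewrite le_eqVlt eq_sym => /orP[//|/nk].
have N0 : mu.-negligible set0 by exact: negligible_set0.
have NU A B : mu.-negligible A -> mu.-negligible B -> mu.-negligible (A `|` B).
  exact: negligibleU.
exact: (big_ind _ N0 NU (fun i _ => big_ind _ N0 NU (fun k _ => F0 i k))).
Qed.

(** For two cells, x and y are joined through a common point z at a distance controlled by |x - y|;
    otherwise |x - y| is bounded below and the bound of Z suffices. The constant depends on the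
    mesh, which is harmless: only the Lipschitz property is used later, not its constant. *)
Lemma mesh_lipschitz (Z : E -> R) : (forall i, [lipschitz Z x | x in closure (T i)]) ->
  [lipschitz Z x | x in closure Omega].
Proof.
move=> hZ; have /choice[L hL] i := (lipP _ _).1 (hZ i).
pose D i := \sum_k `|a i k|; pose M i := `|Z (a i ord0)| + L i * (D i + D i).
have D0 i : 0 <= D i by exact: sumr_ge0.
have M0 i : 0 <= M i by rewrite addr_ge0 // mulr_ge0 ?addr_ge0 //; case: (hL i).
have ZM i x : closure (T i) x -> `|Z x| <= M i.
  move=> Tx; have T0 : closure (T i) (a i ord0).
    rewrite closure_cell; apply/(hullP (edges_unit i)); split=> [k|k []//].
    by rewrite bary_vertex ?edges_unit.
  have [L0 /(_ _ _ Tx T0) h] := hL i.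
  have nD y : closure (T i) y -> `|y| <= D i by rewrite closure_cell => /hull_norm.
  have h1 : L i * `|x - a i ord0| <= L i * (D i + D i).
    by rewrite ler_wpM2l // (le_trans (ler_normB _ _)) // lerD // nD.
  have := ler_normD (Z x - Z (a i ord0)) (Z (a i ord0)); rewrite subrK /M; lra.
have /choice[P hP] (ij : 'I_N * 'I_N) : exists P, 0 <= P /\ forall x y,
    closure (T ij.1) x -> closure (T ij.2) y -> `|Z x - Z y| <= P * `|x - y|.
  case: ij => i j /=; have [_ _ _ _ /(_ i j)] := hmesh; rewrite !closure_cell => conf.
  have [K K0 hK] := simplex_separation (edges_unit i) (edges_unit j) conf.
  have [Li0 hLi] := hL i; have [Lj0 hLj] := hL j.
  exists (L i * K + L j * (K + 1) + (M i + M j) * K).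
  have K1 : 0 <= K + 1 by rewrite addr_ge0.
  have MM : 0 <= M i + M j by rewrite addr_ge0 ?M0.
  have h1 := mulr_ge0 Li0 K0; have h2 := mulr_ge0 Lj0 K1; have h3 := mulr_ge0 MM K0.
  split; first by rewrite addr_ge0 // addr_ge0.
  move=> x y hx hy; have n0 := normr_ge0 (x - y).
  have Lp : 0 <= (L i * K + L j * (K + 1)) * `|x - y| by rewrite mulr_ge0 // addr_ge0.
  have Mp : 0 <= (M i + M j) * K * `|x - y| by rewrite mulr_ge0.
  move=> {h1 h2 h3}.
  rewrite mulrDl; have [[z [iz jz xz]]|one] := hK x y hx hy; last first.
    have h1 : (M i + M j) * 1 <= (M i + M j) * (K * `|x - y|) by rewrite ler_wpM2l.
    have h2 := ZM i x; have h3 := ZM j y; rewrite !closure_cell in h2 h3.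
    have := h2 hx; have := h3 hy; have := ler_normB (Z x) (Z y).
    by rewrite mulr1 mulrA in h1; move: h1 Lp; lra.
  have h1 : `|Z x - Z z| <= L i * (K * `|x - y|).
    apply: le_trans (hLi x z _ _) _; rewrite ?closure_cell //.
    by rewrite ler_wpM2l.
  have h2 : `|Z z - Z y| <= L j * ((K + 1) * `|x - y|).
    apply: le_trans (hLj z y _ _) _; rewrite ?closure_cell // ler_wpM2l //.
    have -> : z - y = (x - y) - (x - z) by rewrite opprB [RHS]addrC addrA subrK.
    by apply: le_trans (ler_normB _ _) _; rewrite mulrDl mul1r; lra.
  have := ler_normD (Z x - Z z) (Z z - Z y); rewrite addrA subrK.
  by move: h1 h2 Mp; rewrite !mulrA mulrDl => *; lra.
apply/lipP; exists (\sum_ij P ij); split; first by apply: sumr_ge0 => ij _; case: (hP ij).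
have [_ _ _ cov _] := hmesh.
move=> x y; rewrite -cov => -[i _ hx] [j _ hy].
have [_ /(_ _ _ hx hy) h] := hP (i, j); apply: le_trans h _.
rewrite ler_wpM2r // (bigD1 (i, j)) //= lerDl; apply: sumr_ge0 => ij _.
by case: (hP ij).
Qed.

End mesh.

(** * Splitting of the global forms over the cells *)

Section splitting.
Variables (R : realType) (n : nat).
Local Notation E := 'rV[R]_n.+1.
Local Notation mu := (leb R n.+1).
Variables (Omega : set E) (N : nat) (a : 'I_N -> 'I_n.+2 -> E).
Hypotheses (oO : open Omega) (bO : bounded_set Omega).
Hypothesis hmesh : conforming_mesh Omega a.
Local Notation T i := (cell (a i)).
Implicit Types (v w phi : E -> R) (p q : E -> E).

Let finO := Omega_fin oO bO.
Let mT i := measurable_cell hmesh i.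
Let oT i := @open_cell _ _ _ _ _ hmesh i.
Let finT i := cell_fin bO hmesh i.
Let sT i := @cell_sub _ _ _ _ _ hmesh i.
Let S := ip_semi Omega.
Let Sv := ipv_semi Omega.

Definition glue (V : zmodType) (F : 'I_N -> E -> V) : E -> V := \sum_i zext (T i) (F i).

Lemma glue_in (V : zmodType) (F : 'I_N -> E -> V) i x : T i x -> glue F x = F i x.
Proof.
move=> Tx; rewrite /glue fct_sumE (bigD1 i) //= zext_in // big1 ?addr0 // => j ji.
by rewrite zext_out // => Tj; rewrite (cell_eq hmesh Tj Tx) eqxx in ji.
Qed.

Lemma comp_glue (F : 'I_N -> E -> E) k : comp (glue F) k = glue (fun i => comp (F i) k).
Proof.
apply/funext => x; rewrite /comp /glue !fct_sumE summxE; apply: eq_bigr => i _.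
by rewrite -[LHS]/(comp (zext (T i) (F i)) k x) comp_zext.
Qed.

Lemma subspace_sum (X : set (E -> R)) (F : 'I_N -> E -> R) : subspace X ->
  (forall i, X (F i)) -> X (\sum_i F i).
Proof.
move=> SX XF; elim/big_ind : _ => // [|f g]; first exact: sub0 SX.
by move=> Xf Xg; exact: (subD SX).
Qed.

Lemma L2_glue (F : 'I_N -> E -> R) : (forall i, L2 (T i) (F i)) -> L2 Omega (glue F).
Proof.
move=> hF; apply: (subspace_sum S) => i.
exact: (@L2_zext_restr _ _ Omega (T i) (@sT i) _ (hF i)).
Qed.

Lemma L2v_glue (F : 'I_N -> E -> E) : (forall i, L2v (T i) (F i)) -> L2v Omega (glue F).
Proof.
move=> hF k; rewrite -[X in L2 _ X]/(comp (glue F) k) comp_glue; apply: L2_glue => i.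
exact: hF.
Qed.

Lemma ip_cells0 v w : L2 Omega v -> L2 Omega w -> (forall i x, T i x -> v x = 0) ->
  ip Omega v w = 0.
Proof.
move=> hv hw v0; apply: (si_null S hv hw); rewrite ipE /ip2 /Rintegral.
rewrite (_ : (\int[mu]_x _)%E = 0%E) //.
have [mv _] := (Lfun2P _ _).1 hv.
rewrite (ae_eq_integral (cst 0%E)) ?integral0 //.
  by apply/measurable_EFinP; exact: measurable_funM.
have [M [mM M0 hM]] := mesh_null hmesh.
exists M; split => // x /= nx; apply: hM.
have Ox : Omega x by apply: contrapT => Ox; apply: nx => _; rewrite zext_out // mul0r.
split=> // -[i _ Tx]; apply: nx => _; rewrite zext_in // (v0 _ _ Tx) mul0r //.
Qed.

Lemma ip_cells_eq v v' w : L2 Omega v -> L2 Omega v' -> L2 Omega w ->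
  (forall i x, T i x -> v x = v' x) -> ip Omega v w = ip Omega v' w.
Proof.
move=> hv hv' hw vv; apply/eqP; rewrite -subr_eq0 -(siBl S) //; apply/eqP.
by apply: ip_cells0 => //; [exact: (subB S)|move=> i x /vv e; rewrite funBE e subrr].
Qed.

Lemma ip_split v w : L2 Omega v -> L2 Omega w -> ip Omega v w = \sum_i ip (T i) v w.
Proof.
move=> hv hw; have hr i : L2 (T i) v by exact: (L2_restr (@sT i) (mT i)).
have hz i : L2 Omega (zext (T i) v) by exact: (L2_zext_restr (@sT i) (hr i)).
rewrite (@ip_cells_eq v (glue (fun=> v))) //; first last.
- by move=> i x Tx; rewrite (glue_in _ Tx).
- exact: L2_glue.
suff [_ ->] : L2 Omega (glue (fun=> v)) /\
    ip Omega (glue (fun=> v)) w = \sum_i ip Omega (zext (T i) v) w.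
  by apply: eq_bigr => i _; rewrite ip_zext //; exact: sT.
rewrite /glue; elim/big_rec2 : _ => [|i y f _ [hf e]].
  by split; [exact: (sub0 S)|exact: (si0 S)].
by split; [exact: (subD S)|rewrite (siD S) // e].
Qed.

Lemma ipv_split p q : L2v Omega p -> L2v Omega q -> ipv Omega p q = \sum_i ipv (T i) p q.
Proof.
move=> hp hq; rewrite ipvE // (eq_bigr _ (fun k _ => ip_split (hp k) (hq k))).
rewrite exchange_big /=; apply: eq_bigr => i _.
by rewrite ipvE //; exact: (L2v_restr (@sT i) (mT i)).
Qed.

(** Both integrals of Green's formula split because the skeleton is null, and the global weak
    gradient and divergence restrict to weak ones on each cell. *)
Lemma normal_trace_split q v : Hdiv Omega q -> H1 Omega v ->
  normal_trace Omega q v = \sum_i normal_trace (T i) q v.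
Proof.
move=> hq hv; have hgq := Hdiv_L2 hq; have hdq := div_L2 hq.
have hgv := H1_L2 hv; have hdv := grad_L2 hv.
have qd := divP hq; have vg := gradP hv.
rewrite /normal_trace [X in X + _]ipv_split // [X in _ + X]ip_split // -big_split.
apply: eq_bigr => i _; rewrite /=.
by rewrite -(normal_traceE (@oT i) (finT i) (L2v_restr (@sT i) (mT i) hgq) (is_div_restr (@sT i) (mT i) qd) (L2_restr (@sT i) (mT i) hgv) (is_grad_restr (@sT i) (mT i) vg)).
Qed.

Lemma is_grad_cells v v' g : L2 Omega v -> L2 Omega v' ->
  (forall i x, T i x -> v x = v' x) -> is_grad Omega v g -> is_grad Omega v' g.
Proof.
move=> hv hv' vv [hg vg]; split => // phi tphi i.
by rewrite -(vg phi tphi i); apply/esym; apply: ip_cells_eq => //; exact: test_L2 (test_partial i tphi).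
Qed.

(** The zero extensions of the pieces are in H^1_0(Omega), and their sum differs from v only on the
    null skeleton, hence by a null vector. This is how equality of traces on every cell yields
    equality of traces on the boundary of Omega. *)
Lemma H10_cells v : L2 Omega v -> (forall i, H10 (T i) v) -> H10 Omega v.
Proof.
move=> hv h0; have SH := H10_sub oO finO.
have hg : H10 Omega (glue (fun=> v)).
  apply: (subspace_sum SH) => i; exact: (zext_H10 (@sT i) (mT i) oO (@oT i) finO (finT i) (h0 i)).
have [hgH _] := hg; have [hgL _] := hgH.
have vg i x : T i x -> glue (fun=> v) x = v x by move=> Tx; rewrite (glue_in _ Tx).
have vG := is_grad_cells hgL hv vg (gradP hgH).
have hvH := is_grad_H1 hv vG.
suff n0 : ipH1 Omega (v - glue (fun=> v)) (v - glue (fun=> v)) = 0.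
  exact: (H10_null oO finO hvH hg n0).
have hL := subB S hv hgL.
have h00 : is_grad Omega 0 (0 : E -> E).
  split; first exact: (sub0 Sv).
  move=> phi tphi i; rewrite (si0 S (test_L2 (test_partial i tphi))).
  rewrite (_ : (fun x => _) = 0); last by apply/funext => x; rewrite mxE.
  by rewrite (si0 S (test_L2 tphi)) oppr0.
have v0 i x : T i x -> (v - glue (fun=> v)) x = 0.
  by move=> Tx; rewrite funBE (vg _ _ Tx) subrr.
have g0 : is_grad Omega (v - glue (fun=> v)) 0.
  by apply: is_grad_cells h00 => //; [exact: (sub0 S)|move=> i x /v0 ->].
rewrite (ipH1E oO finO hL g0 hL g0) (ip_cells0 hL hL v0) (si0 Sv) ?addr0 //.
exact: (sub0 Sv).
Qed.

End splitting.

(** * The DPG forms *)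

Section bounded_functionals.
Variables (R : realType).

(** Linearity is asked on X only, and the bound concerns squares, to match [riesz_min] without
    taking roots. *)
Definition bounded_lin (W : lmodType R) (X : set W) (B : W -> W -> R) (l : W -> R) :=
  (forall c x y, X x -> X y -> l (c *: x + y) = c * l x + l y) /\
  exists C, forall x, X x -> l x ^+ 2 <= C * B x x.

Lemma bounded_linL (W : lmodType R) (X : set W) B (c : R) l l' : semi_inner X B ->
  bounded_lin X B l -> bounded_lin X B l' -> bounded_lin X B (fun x => c * l x + l' x).
Proof.
move=> BX [hl [C hC]] [hl' [C' hC']]; split.
  by move=> d x y Xx Xy; rewrite hl // hl' //; ring.
exists (2 * c ^+ 2 * C + 2 * C') => x Xx; have h1 := hC x Xx; have h2 := hC' x Xx.
have h3 : c ^+ 2 * (l x ^+ 2) <= c ^+ 2 * (C * B x x) by rewrite ler_wpM2l // sqr_ge0.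
by have := sqr_ge0 (c * l x - l' x); move: h2 h3; nra.
Qed.

Lemma riesz_bounded (W : lmodType R) (X : set W) B l : semi_inner X B ->
  complete_in X X B -> bounded_lin X B l ->
  exists2 t, X t & forall z, X z -> B t z = l z.
Proof.
move=> BX cX [hl [C hC]].
have [//|//|//|t [Xt ht _]] := @riesz_min _ _ X X B l C BX BX (fun x h => h).
by exists t.
Qed.

Lemma bounded_lin_comp (W W' : lmodType R) (X : set W) (Y : set W') B B' (A : W -> W') t :
  semi_inner Y B' -> Y t -> (forall x, X x -> Y (A x)) ->
  (forall c x y, X x -> X y -> B' t (A (c *: x + y)) = c * B' t (A x) + B' t (A y)) ->
  (forall x, X x -> B' (A x) (A x) <= B x x) -> bounded_lin X B (fun x => B' t (A x)).
Proof.
move=> BY Yt XY hl hB; split => //; exists (B' t t) => x Xx.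
by apply: le_trans (si_CS BY Yt (XY _ Xx)) _; rewrite ler_wpM2l ?hB //; exact: (si_ge0 BY).
Qed.

Lemma eq_bounded_lin (W : lmodType R) (X : set W) B (l l' : W -> R) : subspace X ->
  (forall x, X x -> l x = l' x) -> bounded_lin X B l -> bounded_lin X B l'.
Proof.
move=> SX e [h [C hC]]; split; last by exists C => x Xx; rewrite -e //; exact: hC.
by move=> c x y Xx Xy; rewrite -!e //; [exact: h|exact: (subL SX)].
Qed.

Lemma bounded_lin0 (W : lmodType R) (X : set W) B (l : W -> R) : subspace X ->
  bounded_lin X B l -> l 0 = 0.
Proof.
move=> SX [h _]; have X0 := sub0 SX; have := h 1 0 0 X0 X0.
by rewrite scaler0 addr0 mul1r => /eqP; rewrite -subr_eq0 opprD addNKr oppr_eq0 => /eqP.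
Qed.

End bounded_functionals.

Section sobolev_functionals.
Variables (R : realType) (n : nat).
Local Notation E := 'rV[R]_n.+1.
Local Notation mu := (leb R n.+1).
Variable A : set E.
Hypotheses (oA : open A) (finA : (mu A < +oo)%E).
Implicit Types (v w : E -> R) (p q : E -> E).
Let S := ip_semi A.
Let Sv := ipv_semi A.

Lemma ip_le_ipH1 v : H1 A v -> ip A v v <= ipH1 A v v.
Proof. by move=> hv; rewrite /ipH1 lerDl; apply: (si_ge0 Sv); exact: grad_L2. Qed.

Lemma ipv_le_ipH1 v : H1 A v -> ipv A (grad A v) (grad A v) <= ipH1 A v v.
Proof. by move=> hv; rewrite /ipH1 lerDr; apply: (si_ge0 S); exact: H1_L2. Qed.

Lemma ipv_le_ipHdiv q : Hdiv A q -> ipv A q q <= ipHdiv A q q.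
Proof. by move=> hq; rewrite /ipHdiv lerDl; apply: (si_ge0 S); exact: div_L2. Qed.

Lemma ip_le_ipHdiv q : Hdiv A q -> ip A (div A q) (div A q) <= ipHdiv A q q.
Proof. by move=> hq; rewrite /ipHdiv lerDr; apply: (si_ge0 Sv); exact: Hdiv_L2. Qed.

Lemma bounded_ip f : L2 A f -> bounded_lin (H1 A) (ipH1 A) (ip A f).
Proof.
move=> hf; apply: (@bounded_lin_comp _ _ _ (H1 A) (L2 A) (ipH1 A) (ip A) id f S hf).
- by move=> v; exact: H1_L2.
- move=> c v w hv hw; have hv2 := H1_L2 hv; have hw2 := H1_L2 hw.
  by rewrite (siDr S (subZ c S hv2) hw2 hf) (siZr S c hv2 hf).
- exact: ip_le_ipH1.
Qed.

Lemma bounded_ipv_grad p : L2v A p -> bounded_lin (H1 A) (ipH1 A) (fun v => ipv A p (grad A v)).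
Proof.
move=> hp; apply: (@bounded_lin_comp _ _ _ (H1 A) (L2v A) (ipH1 A) (ipv A) (grad A) p Sv hp).
- by move=> v; exact: grad_L2.
- move=> c v w hv hw; have hv2 := grad_L2 hv; have hw2 := grad_L2 hw.
  have hg := grad_L2 (subL (H1_sub A) c hv hw).
  by rewrite (siC Sv hp hg) (ipv_gradL oA finA c hv hw hp) (siC Sv hp hv2) (siC Sv hp hw2).
- exact: ipv_le_ipH1.
Qed.

Lemma bounded_ipv p : L2v A p -> bounded_lin (Hdiv A) (ipHdiv A) (ipv A p).
Proof.
move=> hp; apply: (@bounded_lin_comp _ _ _ (Hdiv A) (L2v A) (ipHdiv A) (ipv A) id p Sv hp).
- by move=> v; exact: Hdiv_L2.
- move=> c v w hv hw; have hv2 := Hdiv_L2 hv; have hw2 := Hdiv_L2 hw.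
  by rewrite (siDr Sv (subZ c Sv hv2) hw2 hp) (siZr Sv c hv2 hp).
- exact: ipv_le_ipHdiv.
Qed.

Lemma bounded_ip_div f : L2 A f -> bounded_lin (Hdiv A) (ipHdiv A) (fun q => ip A f (div A q)).
Proof.
move=> hf; apply: (@bounded_lin_comp _ _ _ (Hdiv A) (L2 A) (ipHdiv A) (ip A) (div A) f S hf).
- by move=> v; exact: div_L2.
- move=> c v w hv hw; have hv2 := div_L2 hv; have hw2 := div_L2 hw.
  have hg := div_L2 (subL (Hdiv_sub A) c hv hw).
  by rewrite (siC S hf hg) (ip_divL oA finA c hv hw hf) (siC S hf hv2) (siC S hf hw2).
- exact: ip_le_ipHdiv.
Qed.

Lemma bounded_ntr_l q : Hdiv A q -> bounded_lin (H1 A) (ipH1 A) (normal_trace A q).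
Proof.
move=> hq; split; first by move=> c v w hv hw; exact: normal_traceL.
exists (2 * ipHdiv A q q) => v hv; exact: normal_trace_le.
Qed.

Lemma bounded_ntr_r v : H1 A v -> bounded_lin (Hdiv A) (ipHdiv A) (fun q => normal_trace A q v).
Proof.
move=> hv; split; first by move=> c p q hp hq; exact: normal_traceLl.
exists (2 * ipH1 A v v) => q hq; apply: le_trans (normal_trace_le hq hv) _.
by rewrite mulrAC.
Qed.

End sobolev_functionals.

Section dpg_forms.
Variables (R : realType) (n : nat).
Local Notation E := 'rV[R]_n.+1.
Local Notation mu := (leb R n.+1).
Variables (Omega : set E) (N : nat) (a : 'I_N -> 'I_n.+2 -> E).
Hypotheses (oO : open Omega) (bO : bounded_set Omega).
Hypothesis hmesh : conforming_mesh Omega a.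
Local Notation T i := (cell (a i)).
Local Notation U := (spaceU R n N).
Local Notation V := (spaceV R n).
Implicit Types (v w phi : E -> R) (p q : E -> E) (x y : U) (z t : V).

Let mT i := measurable_cell hmesh i.
Let oT i := @open_cell _ _ _ _ _ hmesh i.
Let finT i := cell_fin bO hmesh i.
Let sT i := @cell_sub _ _ _ _ _ hmesh i.

(** With [b2], the contribution of one cell to b for each component of the test function. The
    components are uncoupled, so Riesz representatives are found separately for each of them and on
    each cell. *)
Definition b1 x i v : R :=
  ipv (T i) (fluxU x) (grad (T i) v) + ip (T i) (fldU x) v - ntrU x i v.

Definition b2 x i q : R :=
  ipv (T i) (fluxU x) q + ip (T i) (fldU x) (div (T i) q) - normal_trace (T i) q (trU x i).

Lemma fld_cell x i : inU Omega a x -> L2 (T i) (fldU x).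
Proof. by case=> h _ _ _; exact: (L2_restr (@sT i) (mT i)). Qed.

Lemma flux_cell x i : inU Omega a x -> L2v (T i) (fluxU x).
Proof. by case=> _ h _ _; exact: (L2v_restr (@sT i) (mT i)). Qed.

Lemma tr_H1 x i : inU Omega a x -> H1 (T i) (trU x i).
Proof. by case=> _ _ [h _] _; exact: h. Qed.

Lemma ntr_bounded x i : inU Omega a x -> bounded_lin (H1 (T i)) (ipH1 (T i)) (ntrU x i).
Proof.
case=> _ _ _ [q [hq ntq]].
apply: (@eq_bounded_lin _ _ _ _ (normal_trace (T i) q)) => //; first exact: H1_sub.
  by move=> v hv; rewrite ntq.
by apply: (bounded_ntr_l (@oT i) (finT i)); exact: (Hdiv_restr (@sT i) (mT i)).
Qed.

Lemma b1_bounded x i : inU Omega a x -> bounded_lin (H1 (T i)) (ipH1 (T i)) (b1 x i).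
Proof.
move=> hx; have S1 := ipH1_semi (@oT i) (finT i).
have h1 := bounded_ipv_grad (@oT i) (finT i) (flux_cell i hx).
have h2 := bounded_ip (fld_cell i hx).
have h3 := bounded_linL (-1) S1 (ntr_bounded i hx) (bounded_linL 1 S1 h1 h2).
apply: eq_bounded_lin h3; first exact: S1.
by move=> v hv; rewrite /b1 mul1r mulN1r addrC.
Qed.

Lemma b2_bounded x i : inU Omega a x -> bounded_lin (Hdiv (T i)) (ipHdiv (T i)) (b2 x i).
Proof.
move=> hx; have S1 := ipHdiv_semi (@oT i) (finT i).
have h1 := bounded_ipv (flux_cell i hx).
have h2 := bounded_ip_div (@oT i) (finT i) (fld_cell i hx).
have h4 := bounded_ntr_r (@oT i) (finT i) (tr_H1 i hx).
have h3 := bounded_linL (-1) S1 h4 (bounded_linL 1 S1 h1 h2).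
apply: eq_bounded_lin h3; first exact: S1.
by move=> v hv; rewrite /b2 mul1r mulN1r addrC.
Qed.

Lemma pgrad_L2 z : inV Omega a z -> L2v Omega (pgrad a z.1).
Proof. by case=> _ _ h; apply: (L2v_glue hmesh) => i; apply: grad_L2; have [] := h i. Qed.

Lemma pdiv_L2 z : inV Omega a z -> L2 Omega (Defs.pdiv a z.2).
Proof. by case=> _ _ h; apply: (L2_glue hmesh) => i; apply: div_L2; have [] := h i. Qed.

Lemma pgrad_in v i (u : E) : T i u -> pgrad a v u = grad (T i) v u.
Proof. exact: (glue_in hmesh (fun i => grad (T i) v)). Qed.

Lemma pdiv_in q i (u : E) : T i u -> Defs.pdiv a q u = div (T i) q u.
Proof. exact: (glue_in hmesh (fun i => div (T i) q)). Qed.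

Lemma ipV_split z t : inV Omega a z -> inV Omega a t -> ipV Omega a z t = \sum_i ipVT a i z t.
Proof.
move=> hz ht; have [z1 z2 _] := hz; have [t1 t2 _] := ht.
rewrite /ipV (ip_split hmesh z1 t1) (ipv_split hmesh z2 t2).
rewrite (ipv_split hmesh (pgrad_L2 hz) (pgrad_L2 ht)) (ip_split hmesh (pdiv_L2 hz) (pdiv_L2 ht)).
rewrite -!big_split; apply: eq_bigr => i _; rewrite /= /ipVT /ipH1 /ipHdiv addrA.
by congr (_ + _ + _ + _); [apply: eq_ipv => u; exact: pgrad_in|apply: eq_ip => u; exact: pdiv_in].
Qed.

Lemma bform_split x z : inU Omega a x -> inV Omega a z ->
  bform Omega a x z = \sum_i (b1 x i z.1 + b2 x i z.2).
Proof.
move=> hx hz; have [x1 x2 _ _] := hx; have [z1 z2 _] := hz.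
rewrite /bform (ipv_split hmesh x2 (pgrad_L2 hz)) (ip_split hmesh x1 z1).
rewrite (ipv_split hmesh x2 z2) (ip_split hmesh x1 (pdiv_L2 hz)).
rewrite -!sumrN -!big_split; apply: eq_bigr => i _; rewrite /= /b1 /b2 !addrA.
by congr (_ + _ + _ + _ + _ + _); [apply: eq_ipv => // u; exact: pgrad_in|apply: eq_ip => // u; exact: pdiv_in].
Qed.

Lemma riesz_cell i l1 l2 : bounded_lin (H1 (T i)) (ipH1 (T i)) l1 ->
  bounded_lin (Hdiv (T i)) (ipHdiv (T i)) l2 ->
  exists2 t, inVT a i t & forall z, inVT a i z -> ipVT a i t z = l1 z.1 + l2 z.2.
Proof.
move=> h1 h2.
have [t1 ht1 e1] := riesz_bounded (ipH1_semi (@oT i) (finT i)) (H1_complete (@oT i) (finT i)) h1.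
have [t2 ht2 e2] := riesz_bounded (ipHdiv_semi (@oT i) (finT i)) (Hdiv_complete (@oT i) (finT i)) h2.
by exists (t1, t2) => // z [z1 z2]; rewrite /ipVT e1 ?e2.
Qed.

Lemma riesz_invP i l l1 l2 : bounded_lin (H1 (T i)) (ipH1 (T i)) l1 ->
  bounded_lin (Hdiv (T i)) (ipHdiv (T i)) l2 ->
  (forall z, inVT a i z -> l z = l1 z.1 + l2 z.2) ->
  inVT a i (riesz_inv a i l) /\
  forall z, inVT a i z -> ipVT a i (riesz_inv a i l) z = l1 z.1 + l2 z.2.
Proof.
move=> h1 h2 hl; have [t ht et] := riesz_cell h1 h2.
have := @xgetPex _ 0 [set t | inVT a i t /\ forall z, inVT a i z -> ipVT a i t z = l z].
case; first by exists t; split => // z hz; rewrite et // hl.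
by move=> hr er; split; [exact: hr|move=> z hz; rewrite (er z hz); exact: hl].
Qed.

Lemma eq_inVT i z t : (forall u, T i u -> z.1 u = t.1 u) -> (forall u, T i u -> z.2 u = t.2 u) ->
  inVT a i z -> inVT a i t.
Proof. by move=> e1 e2 [h1 h2]; split; [exact: eq_H1 h1|exact: eq_Hdiv h2]. Qed.

Lemma eq_ipVT i z z' t : (forall u, T i u -> z.1 u = z'.1 u) -> (forall u, T i u -> z.2 u = z'.2 u) ->
  ipVT a i z t = ipVT a i z' t.
Proof.
move=> e1 e2; rewrite /ipVT (@eq_ipH1 _ _ (T i) z.1 z'.1 t.1 t.1 e1 (fun _ _ => erefl)).
by rewrite (@eq_ipHdiv _ _ (T i) z.2 z'.2 t.2 t.2 e2 (fun _ _ => erefl)).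
Qed.

(** The space V is broken, with no condition across cells, so gluing the local representatives gives
    a global one. *)
Lemma riesz_mesh (l1 : 'I_N -> (E -> R) -> R) (l2 : 'I_N -> (E -> E) -> R) :
  (forall i, bounded_lin (H1 (T i)) (ipH1 (T i)) (l1 i)) ->
  (forall i, bounded_lin (Hdiv (T i)) (ipHdiv (T i)) (l2 i)) ->
  exists2 t, inV Omega a t & forall z, inV Omega a z ->
    ipV Omega a t z = \sum_i (l1 i z.1 + l2 i z.2).
Proof.
move=> h1 h2; have /choice[t ht] i : exists t, inVT a i t /\
    forall z, inVT a i z -> ipVT a i t z = l1 i z.1 + l2 i z.2.
  by have [t] := riesz_cell (h1 i) (h2 i); exists t.
pose g : V := (glue a (fun i => (t i).1), glue a (fun i => (t i).2)).
have g1 i u : T i u -> (t i).1 u = g.1 u by move=> Tu; rewrite /= (glue_in hmesh _ Tu).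
have g2 i u : T i u -> (t i).2 u = g.2 u by move=> Tu; rewrite /= (glue_in hmesh _ Tu).
have gV : inV Omega a g.
  split; [apply: (L2_glue hmesh) => i|apply: (L2v_glue hmesh) => i|move=> i].
  - by apply: H1_L2; have [[]] := ht i.
  - by apply: Hdiv_L2; have [[]] := ht i.
  - by apply: (eq_inVT (@g1 i) (@g2 i)); have [] := ht i.
exists g => // z hz; rewrite ipV_split //; apply: eq_bigr => i _.
rewrite -(eq_ipVT _ (@g1 i) (@g2 i)); have [_ ->] := ht i => //.
by have [_ _] := hz.
Qed.

Lemma ThetaP x : inU Omega a x -> inV Omega a (Theta Omega a x) /\
  forall z, inV Omega a z -> ipV Omega a (Theta Omega a x) z = bform Omega a x z.
Proof.
move=> hx; have [t ht et] := riesz_mesh (fun i => b1_bounded i hx) (fun i => b2_bounded i hx).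
apply: (@xgetPex _ 0 [set t | inV Omega a t /\ forall z, inV Omega a z -> ipV Omega a t z = bform Omega a x z]).
by exists t; split => // z hz; rewrite et // bform_split.
Qed.

End dpg_forms.

(** Expands the square of 2 x + y. The weight 1/4 on y leaves three quarters of the [Theta] term for
    the final absorption. *)
Lemma si_young (R : realType) (W : lmodType R) (X : set W) B x y : semi_inner X B ->
  X x -> X y -> - B x y <= B x x + B y y / 4.
Proof.
move=> BX Xx Xy; have := si_ge0 BX (subL BX 2 Xx Xy); rewrite (si_sqrD BX) //; lra.
Qed.

(** * The pairing on the skeleton and the residual *)

Section dpg_estimates.
Variables (R : realType) (n : nat).
Local Notation E := 'rV[R]_n.+1.
Local Notation mu := (leb R n.+1).
Variables (Omega : set E) (N : nat) (a : 'I_N -> 'I_n.+2 -> E).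
Hypotheses (oO : open Omega) (bO : bounded_set Omega).
Hypothesis hmesh : conforming_mesh Omega a.
Local Notation T i := (cell (a i)).
Local Notation U := (spaceU R n N).
Local Notation V := (spaceV R n).
Implicit Types (v w phi : E -> R) (p q : E -> E) (x y : U) (z t : V).

Let mT i := measurable_cell hmesh i.
Let oT i := @open_cell _ _ _ _ _ hmesh i.
Let finT i := cell_fin bO hmesh i.
Let sT i := @cell_sub _ _ _ _ _ hmesh i.
Let S := ip_semi Omega.
Let Sv := ipv_semi Omega.
Let ST i := ip_semi (T i).
Let SvT i := ipv_semi (T i).

Lemma inU_sub x y : inU Omega a x -> inU Omega a y -> inU Omega a (x - y).
Proof.
move=> [x1 x2 [x3 [w [hw xw]]] [q [hq xq]]] [y1 y2 [y3 [w' [hw' yw]]] [q' [hq' yq]]].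
split; [exact: (subB S)|exact: (subB Sv)|split|].
- by move=> i; exact: (subB (H1_sub (T i)) (x3 i) (y3 i)).
- exists (w - w'); split; first exact: (subB (H1_sub Omega)).
  move=> i; have := subB (H10_sub (@oT i) (finT i)) (xw i) (yw i).
  have -> : trU x i - w - (trU y i - w') = (trU x i - trU y i) - (w - w').
    by rewrite !opprD !opprK addrACA.
  by [].
- exists (q - q'); split; first exact: (subB (Hdiv_sub Omega)).
  move=> i v hv; rewrite -[LHS]/(ntrU x i v - ntrU y i v) xq // yq //.
  have hqi := Hdiv_restr (@sT i) (mT i) hq; have hqi' := Hdiv_restr (@sT i) (mT i) hq'.
  have := normal_traceLl (@oT i) (finT i) (-1) hqi' hqi hv.
  by rewrite scaleN1r mulN1r addrC => ->; rewrite addrC.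
Qed.

Let arith (b c d e g h : R) : b - c + (d - e) - (g - h) = b + d - g - (c + e - h).
Proof. by ring. Qed.

Lemma b1_sub x y i v : inU Omega a x -> inU Omega a y -> H1 (T i) v ->
  b1 a (x - y) i v = b1 a x i v - b1 a y i v.
Proof.
move=> hx hy hv; rewrite /b1.
rewrite -[ipv _ (fluxU (x - y)) _]/(ipv _ (fluxU x - fluxU y) _).
rewrite -[ip _ (fldU (x - y)) _]/(ip _ (fldU x - fldU y) _).
rewrite -[ntrU (x - y) i v]/(ntrU x i v - ntrU y i v).
rewrite (siBl (SvT i) (flux_cell hmesh i hx) (flux_cell hmesh i hy) (grad_L2 hv)).
rewrite (siBl (ST i) (fld_cell hmesh i hx) (fld_cell hmesh i hy) (H1_L2 hv)).
exact: arith.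
Qed.

Lemma b2_sub x y i q : inU Omega a x -> inU Omega a y -> Hdiv (T i) q ->
  b2 a (x - y) i q = b2 a x i q - b2 a y i q.
Proof.
move=> hx hy hq; rewrite /b2.
rewrite -[ipv _ (fluxU (x - y)) _]/(ipv _ (fluxU x - fluxU y) _).
rewrite -[ip _ (fldU (x - y)) _]/(ip _ (fldU x - fldU y) _).
rewrite -[trU (x - y) i]/(trU x i - trU y i).
rewrite (siBl (SvT i) (flux_cell hmesh i hx) (flux_cell hmesh i hy) (Hdiv_L2 hq)).
rewrite (siBl (ST i) (fld_cell hmesh i hx) (fld_cell hmesh i hy) (div_L2 hq)).
rewrite (normal_traceB (@oT i) (finT i) hq (tr_H1 i hx) (tr_H1 i hy)).
exact: arith.
Qed.

Lemma bform_sub x y z : inU Omega a x -> inU Omega a y -> inV Omega a z ->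
  bform Omega a (x - y) z = bform Omega a x z - bform Omega a y z.
Proof.
move=> hx hy hz; have hxy := inU_sub hx hy; have [_ _ hzT] := hz.
rewrite !(bform_split hmesh) // -sumrB; apply: eq_bigr => i _; have [z1 z2] := hzT i.
by rewrite (b1_sub hx hy z1) (b2_sub hx hy z2) [in RHS]opprD addrACA.
Qed.

(** The pairing D(x, y) in terms of the skeleton data. [gamma0] and [gamman] come from chosen
    liftings and are not visibly linear, whereas this sum is; [gammaE] identifies the two. *)
Definition skel_pair x y : R := \sum_i ntrU x i (trU y i).

Lemma skel_pairBl x x' y : skel_pair (x - x') y = skel_pair x y - skel_pair x' y.
Proof. by rewrite /skel_pair -sumrB. Qed.

Lemma skel_pairBr x y y' : inU Omega a x -> inU Omega a y -> inU Omega a y' ->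
  skel_pair x (y - y') = skel_pair x y - skel_pair x y'.
Proof.
move=> hx hy hy'; rewrite /skel_pair -sumrB; apply: eq_bigr => i _.
have [h _] := ntr_bounded bO hmesh i hx.
have := h (-1) _ _ (tr_H1 i hy') (tr_H1 i hy).
by rewrite scaleN1r mulN1r addrC => e; rewrite [RHS]addrC -e.
Qed.

(** Any liftings give the same value: on each cell w differs from [trU y i] by an element of H^1_0,
    which normal traces annihilate. *)
Lemma skel_pairE x y q w : inU Omega a x -> inU Omega a y ->
  liftn Omega a (ntrU x) q -> Defs.lift0 Omega a (trU y) w ->
  normal_trace Omega q w = skel_pair x y.
Proof.
move=> hx hy [hq xq] [hw yw]; rewrite (normal_trace_split bO hmesh) //.
apply: eq_bigr => i _; have hqi := Hdiv_restr (@sT i) (mT i) hq.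
have hwi := H1_restr (@sT i) (mT i) hw; have hyi := tr_H1 i hy.
have := normal_trace_H10 (@oT i) (finT i) hqi (yw i).
by rewrite (normal_traceB (@oT i) (finT i) hqi hyi hwi) -xq // => /eqP; rewrite subr_eq0 => /eqP ->.
Qed.

Lemma gamma0P y : inU Omega a y -> Defs.lift0 Omega a (trU y) (gamma0 Omega a y).
Proof. by case=> _ _ [_ [w hw]] _; apply: (@xgetPex _ 0 [set w | Defs.lift0 Omega a (trU y) w]); exists w. Qed.

Lemma gammanP x : inU Omega a x -> exists2 q, liftn Omega a (ntrU x) q &
  gamman Omega a x = normal_trace Omega q.
Proof.
case=> _ _ _ [q hq]; exists (xget 0 [set q | liftn Omega a (ntrU x) q]); last by rewrite /gamman.
exact: (@xgetPex _ 0 [set q | liftn Omega a (ntrU x) q] (ex_intro _ q hq)).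
Qed.

Lemma gammaE x y : inU Omega a x -> inU Omega a y ->
  gamman Omega a x (gamma0 Omega a y) = skel_pair x y.
Proof.
move=> hx hy; have [q hq ->] := gammanP hx; exact: skel_pairE hq (gamma0P hy).
Qed.

Section residual.
Variables (f : E -> R) (uh : U).
Hypotheses (hf : L2 Omega f) (huh : inU Omega a uh).

Let r i := riesz_inv a i (fun z => Lform Omega f (iota_ a i z) - bform Omega a uh (iota_ a i z)).

Lemma iota_inV i z : inVT a i z -> inV Omega a (iota_ a i z).
Proof.
move=> [z1 z2]; split.
- exact: (L2_zext_restr (@sT i) (H1_L2 z1)).
- exact: (L2v_zext_restr (@sT i) (Hdiv_L2 z2)).
move=> j; have [ji|ji] := eqVneq j i; last first.
  have e (W : zmodType) (F : E -> W) u : T j u -> 0 = zext (T i) F u.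
    by move=> Tu; rewrite zext_out // => Tiu; rewrite (cell_eq hmesh Tu Tiu) eqxx in ji.
  split; first by apply: eq_H1 (sub0 (H1_sub (T j))) => u Tu; rewrite /= -e.
  by apply: eq_Hdiv (sub0 (Hdiv_sub (T j))) => u Tu; rewrite /= -e.
rewrite {}ji; have e (W : zmodType) (F : E -> W) u : T i u -> F u = zext (T i) F u.
  by move=> Tu; rewrite zext_in.
by split; [apply: eq_H1 z1|apply: eq_Hdiv z2] => u Tu; rewrite /= -e.
Qed.

Lemma eq_b1 x i v v' : inU Omega a x -> H1 (T i) v -> (forall u, T i u -> v u = v' u) ->
  b1 a x i v = b1 a x i v'.
Proof.
move=> [_ _ _ [q [_ xq]]] hv vv; rewrite /b1 (eq_grad vv); congr (_ + _ - _).
  exact: eq_ip.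
by rewrite xq // xq; [exact: eq_normal_trace|exact: eq_H1 hv].
Qed.

Lemma eq_b2 x i q q' : (forall u, T i u -> q u = q' u) -> b2 a x i q = b2 a x i q'.
Proof.
move=> qq; rewrite /b2 (eq_div qq) (@eq_ipv _ _ (T i) (fluxU x) (fluxU x) q q' (fun _ _ => erefl) qq).
by rewrite (@eq_normal_trace _ _ (T i) q q' (trU x i) (trU x i) qq (fun _ _ => erefl)).
Qed.

Lemma bform_iota x i z : inU Omega a x -> inVT a i z ->
  bform Omega a x (iota_ a i z) = b1 a x i z.1 + b2 a x i z.2.
Proof.
move=> hx hz; rewrite (bform_split hmesh) //; last exact: iota_inV.
have [_ _ hzT] := iota_inV hz.
rewrite (bigD1 i) //= [X in _ + X]big1 ?addr0 => [|j ji].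
  have [z1 z2] := hzT i.
  rewrite (@eq_b1 x i (zext (T i) z.1) z.1 hx z1); last by move=> u Tu; rewrite zext_in.
  by rewrite (@eq_b2 x i (zext (T i) z.2) z.2) // => u Tu; rewrite zext_in.
have e (W : zmodType) (F : E -> W) u : T j u -> zext (T i) F u = 0.
  by move=> Tu; rewrite zext_out // => Tiu; rewrite (cell_eq hmesh Tu Tiu) eqxx in ji.
have [z1 z2] := hzT j.
rewrite (@eq_b1 x j (zext (T i) z.1) 0 hx z1); last by move=> u Tu; rewrite e.
rewrite (@eq_b2 x j (zext (T i) z.2) 0); last by move=> u Tu; rewrite e.
rewrite (bounded_lin0 (H1_sub (T j)) (b1_bounded bO hmesh j hx)).
by rewrite (bounded_lin0 (Hdiv_sub (T j)) (b2_bounded bO hmesh j hx)) addr0.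
Qed.

Lemma residualP i : inVT a i (r i) /\ forall z, inVT a i z ->
  ipVT a i (r i) z = (ip (T i) f z.1 - b1 a uh i z.1) - b2 a uh i z.2.
Proof.
have S1 := ipH1_semi (@oT i) (finT i); have S2 := ipHdiv_semi (@oT i) (finT i).
have hfi : L2 (T i) f by exact: (L2_restr (@sT i) (mT i)).
have h1 := bounded_linL (-1) S1 (b1_bounded bO hmesh i huh) (bounded_ip hfi).
(* The combination of coefficients -2 and 1 of [b2] with itself is a way to negate [b2]. *)
have h2 := bounded_linL (-2) S2 (b2_bounded bO hmesh i huh) (b2_bounded bO hmesh i huh).
have [|hr er] := riesz_invP bO hmesh (i := i) (l := fun z => Lform Omega f (iota_ a i z) - bform Omega a uh (iota_ a i z)) h1 h2.
  move=> z hz; rewrite (bform_iota huh hz) /Lform /=.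
  have [z1 _] := hz; have z1L := L2_zext_restr (@sT i) (H1_L2 z1).
  rewrite (siC S hf z1L) (ip_zext (@sT i)) (siC (ST i) (H1_L2 z1) hfi); ring.
split; first exact: hr.
by move=> z hz; rewrite /r (er z hz); ring.
Qed.

Let arith2 (b c g x y r0 s z t : R) : x + y = g - b - c -> - x <= r0 + z / 4 ->
  - y <= s + t / 4 -> b + c - g <= r0 + s + (z + t) / 4.
Proof. lra. Qed.

(** On each cell the residual at z is the product of z with its Riesz representative, which
    [si_young] splits. Summation costs no constant, since both squared norms are sums over cells. *)
Lemma residual_le z : inV Omega a z ->
  bform Omega a uh z - Lform Omega f z <=
  \sum_i normVT a i (r i) ^+ 2 + ipV Omega a z z / 4.
Proof.
move=> hz; have [z1 _ hzT] := hz.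
rewrite (bform_split hmesh) // /Lform (ip_split hmesh) // -sumrB (ipV_split hmesh) //.
rewrite mulr_suml -big_split; apply: ler_sum => i _ /=; have [hr er] := residualP i.
have S1 := ipH1_semi (@oT i) (finT i); have S2 := ipHdiv_semi (@oT i) (finT i).
have e := er z (hzT i); have [r1 r2] := hr; have [zi1 zi2] := hzT i.
have h1 := si_young S1 r1 zi1; have h2 := si_young S2 r2 zi2.
have h3 := si_ge0 S1 r1; have h4 := si_ge0 S2 r2.
rewrite /normVT sqr_sqrtr /ipVT; last by rewrite addr_ge0.
exact: arith2 e h1 h2.
Qed.

End residual.

End dpg_estimates.

(** * The liftings m and p of the traces of x *)

Section reliability.
Variables (R : realType) (n : nat).
Local Notation E := 'rV[R]_n.+1.
Local Notation mu := (leb R n.+1).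
Variables (Omega : set E) (N : nat) (a : 'I_N -> 'I_n.+2 -> E).
Hypotheses (oO : open Omega) (bO : bounded_set Omega).
Hypothesis hmesh : conforming_mesh Omega a.
Local Notation T i := (cell (a i)).
Local Notation U := (spaceU R n N).
Local Notation V := (spaceV R n).
Implicit Types (v w phi : E -> R) (p q : E -> E) (x y : U) (z t : V).

Let finO := Omega_fin oO bO.
Let mT i := measurable_cell hmesh i.
Let oT i := @open_cell _ _ _ _ _ hmesh i.
Let finT i := cell_fin bO hmesh i.
Let sT i := @cell_sub _ _ _ _ _ hmesh i.
Let S := ip_semi Omega.
Let Sv := ipv_semi Omega.
Let ST i := ip_semi (T i).
Let SvT i := ipv_semi (T i).

Lemma ipV_iota i z t : inV Omega a z -> inVT a i t ->
  ipV Omega a z (iota_ a i t) = ipVT a i z t.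
Proof.
move=> hz ht; have hi := iota_inV hmesh ht; rewrite (ipV_split hmesh hz hi).
have [_ _ hzT] := hz; have [_ _ hiT] := hi.
have VC j t' : inVT a j t' -> ipVT a j z t' = ipVT a j t' z.
  move=> [t1 t2]; have [z1 z2] := hzT j; rewrite /ipVT.
  by rewrite (siC (ipH1_semi (@oT j) (finT j)) z1 t1) (siC (ipHdiv_semi (@oT j) (finT j)) z2 t2).
rewrite (bigD1 i) //= [X in _ + X]big1 ?addr0 => [|j ji].
  rewrite (VC i _ (hiT i)) (VC i t ht).
  by rewrite (@eq_ipVT _ _ _ a i (iota_ a i t) t z) // => u Tu; rewrite /= zext_in.
have e (W : zmodType) (F : E -> W) u : T j u -> zext (T i) F u = 0.
  by move=> Tu; rewrite zext_out // => Tiu; rewrite (cell_eq hmesh Tu Tiu) eqxx in ji.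
rewrite (VC j _ (hiT j)) (@eq_ipVT _ _ _ a j (iota_ a i t) (0, 0) z); first last.
- by move=> u Tu; rewrite /= e.
- by move=> u Tu; rewrite /= e.
have [z1 z2] := hzT j; rewrite /ipVT /=.
by rewrite (si0 (ipH1_semi (@oT j) (finT j)) z1) (si0 (ipHdiv_semi (@oT j) (finT j)) z2) addr0.
Qed.

Lemma ipv_delta A p phi k : ipv A (fun u : E => phi u *: (delta_mx 0 k : E)) p = ip A phi (comp p k).
Proof.
apply: eq_Rintegral => u _; rewrite /dotv (bigD1 k) //= big1 ?addr0 => [|j jk].
  by rewrite !mxE !eqxx mulr1.
by rewrite !mxE (negPf jk) andbF mulr0 mul0r.
Qed.

Lemma L2v_delta phi k : L2 Omega phi -> L2v Omega (fun u : E => phi u *: (delta_mx 0 k : E)).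
Proof.
move=> hphi j; have [->|jk] := eqVneq j k.
  by apply: eq_L2 hphi => u _; rewrite !mxE !eqxx mulr1.
by apply: eq_L2 (sub0 S) => u _; rewrite !mxE (negPf jk) andbF mulr0.
Qed.

(** For the field phi e_k, Green's formula is the definition of the weak derivative of v in
    direction k. *)
Lemma normal_trace_delta v phi k : H1 Omega v -> test_function Omega phi ->
  normal_trace Omega (fun u : E => phi u *: (delta_mx 0 k : E)) v = 0.
Proof.
move=> hv tphi; have dphi := is_div_test k tphi; have hg := gradP hv.
have tphi' := test_partial k tphi; have L1 := test_L2 tphi; have L2p := test_L2 tphi'.
have hq := L2v_delta k L1.
rewrite (normal_traceE oO finO hq dphi (H1_L2 hv) hg) ipv_delta.
have gL := grad_L2 hv k; have hvL := H1_L2 hv.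
rewrite (siC S L2p hvL) (siC S L1 gL).
by have [_ /(_ phi tphi k) ->] := hg; rewrite addrN.
Qed.

Section lifts.
Variables (x : U) (e : V).
Hypotheses (hx : inU Omega a x) (he : inV Omega a e).
Hypothesis hxe : forall z, inV Omega a z -> ipV Omega a e z = bform Omega a x z.

Let m := fldU x - Defs.pdiv a e.2.
Let gm := fluxU x - e.2.
Let p := fluxU x - pgrad a e.1.
Let dp := fldU x - e.1.

Let mL : L2 Omega m.
Proof. by have [h _ _ _] := hx; exact: (subB S h (pdiv_L2 hmesh he)). Qed.
Let gmL : L2v Omega gm.
Proof. by have [_ h _ _] := hx; have [_ h' _] := he; exact: (subB Sv h h'). Qed.
Let pL : L2v Omega p.
Proof. by have [_ h _ _] := hx; exact: (subB Sv h (pgrad_L2 hmesh he)). Qed.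
Let dpL : L2 Omega dp.
Proof. by have [h _ _ _] := hx; have [h' _ _] := he; exact: (subB S h h'). Qed.

Let eT i : inVT a i e. Proof. by have [] := he. Qed.

Let arithA (b c d g h : R) : b + c = g + d - h -> h = g - c + (d - b).
Proof. lra. Qed.

Let arithB (b c d g h : R) : b + c = g + d - h -> h = g - b + (d - c).
Proof. lra. Qed.

(** The equation of e tested with (v, 0) on one cell: once the products with e are moved to the
    other side, Green's formula for p remains, with dp in the role of its divergence. *)
Lemma ntr_cell i v : H1 (T i) v -> ntrU x i v = ipv (T i) p (grad (T i) v) + ip (T i) dp v.
Proof.
move=> hv; have [e1 e2] := eT i; have H0 := sub0 (Hdiv_sub (T i)).
have S2 := ipHdiv_semi (@oT i) (finT i).
have hz : inVT a i (v, 0) by [].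
have := hxe (iota_inV hmesh hz).
rewrite (ipV_iota he hz) (bform_iota bO hmesh hx hz) /ipVT /=.
rewrite (siC S2 e2 H0) (si0 S2 e2) (bounded_lin0 (Hdiv_sub (T i)) (b2_bounded bO hmesh i hx)) !addr0.
rewrite /ipH1 /b1 => /arithA ->.
have h1 := flux_cell hmesh i hx; have h2 := fld_cell hmesh i hx.
rewrite -(siBl (SvT i) h1 (grad_L2 e1) (grad_L2 hv)) -(siBl (ST i) h2 (H1_L2 e1) (H1_L2 hv)).
congr (_ + _); apply: eq_ipv => // u Tu.
by rewrite /p !funBE (pgrad_in hmesh _ Tu).
Qed.

Lemma tr_cell i q : Hdiv (T i) q ->
  normal_trace (T i) q (trU x i) = ipv (T i) gm q + ip (T i) m (div (T i) q).
Proof.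
move=> hq; have [e1 e2] := eT i; have H0 := sub0 (H1_sub (T i)).
have S2 := ipH1_semi (@oT i) (finT i).
have hz : inVT a i (0, q) by [].
have := hxe (iota_inV hmesh hz).
rewrite (ipV_iota he hz) (bform_iota bO hmesh hx hz) /ipVT /=.
rewrite (siC S2 e1 H0) (si0 S2 e1) (bounded_lin0 (H1_sub (T i)) (b1_bounded bO hmesh i hx)) !add0r.
rewrite /ipHdiv /b2 => /arithB ->.
have h1 := flux_cell hmesh i hx; have h2 := fld_cell hmesh i hx.
rewrite -(siBl (SvT i) h1 (Hdiv_L2 e2) (Hdiv_L2 hq)) -(siBl (ST i) h2 (div_L2 e2) (div_L2 hq)).
congr (_ + _); apply: eq_ip => // u Tu.
by rewrite /m !funBE (pdiv_in hmesh _ Tu).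
Qed.

(** [tr_cell] is summed over the cells for the global field phi e_k. The left-hand side is a normal
    trace on one global H^1 lifting of the traces, so it vanishes, and the local Green formulas add
    up to a weak gradient on Omega: m does not jump across cells. *)
Lemma is_grad_lift : is_grad Omega m gm.
Proof.
split=> // phi tphi k; pose q := fun u : E => phi u *: (delta_mx 0 k : E).
have dphi := is_div_test k tphi; have tphi' := test_partial k tphi.
have L1 := test_L2 tphi; have L2p := test_L2 tphi'.
have hqL : L2v Omega q := L2v_delta k L1.
have hq : Hdiv Omega q by exact: is_div_Hdiv hqL dphi.
have [_ _ [_ [w [hw xw]]] _] := hx.
have h0 : \sum_i normal_trace (T i) q (trU x i) = 0.
  apply: etrans (normal_trace_delta k hw tphi); rewrite (normal_trace_split bO hmesh hq hw).
  apply: eq_bigr => i _; have hqi := Hdiv_restr (@sT i) (mT i) hq.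
  have hwi := H1_restr (@sT i) (mT i) hw; have hxi := tr_H1 i hx.
  have := normal_trace_H10 (@oT i) (finT i) hqi (xw i).
  by rewrite (normal_traceB (@oT i) (finT i) hqi hxi hwi) => /eqP; rewrite subr_eq0 => /eqP.
have : \sum_i normal_trace (T i) q (trU x i) = ipv Omega gm q + ip Omega m (partial k phi).
  rewrite (ipv_split hmesh gmL hqL) (ip_split hmesh mL L2p) -big_split; apply: eq_bigr => i _ /=.
  have hqi := Hdiv_restr (@sT i) (mT i) hq; rewrite (tr_cell hqi); congr (_ + _).
  have mi := L2_restr (@sT i) (mT i) mL; have di := is_div_restr (@sT i) (mT i) dphi.
  have [diL _] := di.
  by rewrite (siC (ST i) mi (div_L2 hqi)) (ip_divE (@oT i) (finT i) (Hdiv_L2 hqi) di mi) (siC (ST i) diL mi).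
rewrite h0 (siC Sv gmL hqL) ipv_delta (siC S L1 (gmL k)) => /esym/eqP.
by rewrite addrC addr_eq0 => /eqP.
Qed.

(** Dual to [is_grad_lift]: a scalar test function is paired with a global H(div) lifting of the
    normal traces. *)
Lemma is_div_lift : is_div Omega p dp.
Proof.
split=> // phi tphi; have gphi := is_grad_test tphi.
have L1 := test_L2 tphi; have L2g := gradc_L2 tphi; have hphi := test_H1 tphi.
have [_ _ _ [q [hq xq]]] := hx.
have h0 : \sum_i ntrU x i phi = 0.
  apply: etrans (normal_trace_test oO finO hq tphi); rewrite (normal_trace_split bO hmesh hq hphi).
  by apply: eq_bigr => i _; rewrite xq //; exact: (H1_restr (@sT i) (mT i)).
have : \sum_i ntrU x i phi = ipv Omega p (gradc phi) + ip Omega dp phi.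
  rewrite (ipv_split hmesh pL L2g) (ip_split hmesh dpL L1) -big_split; apply: eq_bigr => i _ /=.
  have hi := H1_restr (@sT i) (mT i) hphi; rewrite (ntr_cell hi); congr (_ + _).
  have pi := L2v_restr (@sT i) (mT i) pL; have gi := is_grad_restr (@sT i) (mT i) gphi.
  have [giL _] := gi.
  by rewrite (siC (SvT i) pi (grad_L2 hi)) (ipv_gradE (@oT i) (finT i) (H1_L2 hi) gi pi) (siC (SvT i) giL pi).
by rewrite h0 => /esym/eqP; rewrite addr_eq0 => /eqP.
Qed.

(** By [tr_cell] and Green's formula for m, all normal traces vanish on the difference of [trU x i]
    and m, and [normal_trace_eq0_H10] puts this difference in H^1_0 of the cell. *)
Lemma lift0_m : Defs.lift0 Omega a (trU x) m.
Proof.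
have hm := is_grad_H1 mL is_grad_lift; split => // i.
have hxi := tr_H1 i hx; have hmi := H1_restr (@sT i) (mT i) hm.
apply: (normal_trace_eq0_H10 (@oT i) (finT i)); first exact: (subB (H1_sub (T i))).
move=> q hq; rewrite (normal_traceB (@oT i) (finT i) hq hxi hmi) (tr_cell hq).
have mi := L2_restr (@sT i) (mT i) mL; have gi := is_grad_restr (@sT i) (mT i) is_grad_lift.
have [giL _] := gi.
rewrite (normal_traceE (@oT i) (finT i) (Hdiv_L2 hq) (divP hq) mi gi).
by rewrite (siC (SvT i) giL (Hdiv_L2 hq)) (siC (ST i) mi (div_L2 hq)) subrr.
Qed.

Lemma liftn_p : liftn Omega a (ntrU x) p.
Proof.
split=> [|i v hv]; first exact: is_div_Hdiv pL is_div_lift.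
have di := is_div_restr (@sT i) (mT i) is_div_lift; have pi := L2v_restr (@sT i) (mT i) pL.
by rewrite (ntr_cell hv) (normal_traceE (@oT i) (finT i) pi di (H1_L2 hv) (gradP hv)).
Qed.

End lifts.
End reliability.

Lemma si_sqrB_le (R : realType) (W : lmodType R) (X : set W) B x y : semi_inner X B ->
  X x -> X y -> B (x - y) (x - y) <= 2 * B x x + 2 * B y y.
Proof.
move=> BX Xx Xy; have := si_ge0 BX (subD BX Xx Xy); have := si_sqrD BX 1 Xx Xy.
by rewrite scale1r => ->; rewrite (si_sqrB BX) //; lra.
Qed.

Lemma si_mul_ge (R : realType) (W : lmodType R) (X : set W) B x y : semi_inner X B ->
  X x -> X y -> - (B x x + B y y) / 2 <= B x y.
Proof.
move=> BX Xx Xy; have := si_ge0 BX (subD BX Xx Xy); have := si_sqrD BX 1 Xx Xy.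
by rewrite scale1r => ->; lra.
Qed.

Lemma inf_sqr_le (R : realType) (T : Type) (X : set T) (F : T -> R) t : X t ->
  (forall t, 0 <= F t) -> (inf [set F t | t in X]) ^+ 2 <= F t ^+ 2.
Proof.
move=> Xt F0; have lb0 : lbound [set F t | t in X] 0 by move=> _ [s _ <-].
rewrite ler_pXn2r // ?nnegrE //.
- by apply: ge_inf; [exists 0|exists t].
- by apply: lb_le_inf => //; exists (F t), t.
Qed.

(** * Norm estimates and absorption *)

Section reliability.
Variables (R : realType) (n : nat).
Local Notation E := 'rV[R]_n.+1.
Local Notation mu := (leb R n.+1).
Variables (Omega : set E) (N : nat) (a : 'I_N -> 'I_n.+2 -> E).
Hypotheses (oO : open Omega) (bO : bounded_set Omega).
Hypothesis hmesh : conforming_mesh Omega a.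
Local Notation T i := (cell (a i)).
Local Notation U := (spaceU R n N).
Local Notation V := (spaceV R n).
Implicit Types (v w phi : E -> R) (p q : E -> E) (x y : U) (z t : V).

Let finO := Omega_fin oO bO.
Let oT i := @open_cell _ _ _ _ _ hmesh i.
Let finT i := cell_fin bO hmesh i.
Let S := ip_semi Omega.
Let Sv := ipv_semi Omega.

(** Letters stand for squared norms: mm, gg for m and its gradient; vv, pp, tt, dd for v, grad v,
    tau, div tau, where the element of V is (v, tau). With b = tau - grad v and c = div tau - v one
    has p = grad m + b and div p = m + c; each cross term bg, cm costs half of both squares. *)
Let lower (mm gg bb bg cc cm vv pp tt dd : R) :
  - (bb + gg) / 2 <= bg -> - (cc + mm) / 2 <= cm -> bb <= 2 * tt + 2 * pp ->
  cc <= 2 * dd + 2 * vv ->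
  (mm + gg) / 2 - (vv + pp + tt + dd) <= gg + bg + (mm + cm).
Proof. lra. Qed.

(** Here s1 to s4 are the squared norms of the four components: u = m + div tau and sigma = grad m +
    tau cost a factor 2, the trace norms are bounded through m and p. The part of m then occurs 2 +
    1 + 2 = 5 times, that of (v, tau) at most 2 + 4 = 6 times. *)
Let upper (mm gg bb cc vv pp tt dd s1 s2 s3 s4 s5 s6 : R) :
  bb <= 2 * tt + 2 * pp -> cc <= 2 * dd + 2 * vv ->
  s1 <= 2 * mm + 2 * dd -> s2 <= 2 * gg + 2 * tt -> s3 <= mm + gg ->
  s4 <= s5 + s6 -> s5 <= 2 * gg + 2 * bb -> s6 <= 2 * mm + 2 * cc ->
  0 <= vv -> 0 <= pp -> 0 <= tt -> 0 <= dd ->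
  s1 + s2 + s3 + s4 <= 5 * (mm + gg) + 6 * (vv + pp + tt + dd).
Proof. lra. Qed.

Lemma skeleton_lifts x e : inU Omega a x -> inV Omega a e ->
  (forall z, inV Omega a z -> ipV Omega a e z = bform Omega a x z) ->
  exists2 M, 0 <= M & M / 2 - ipV Omega a e e <= skel_pair x x /\
    normU Omega a x ^+ 2 <= 5 * M + 6 * ipV Omega a e e.
Proof.
move=> hx he hxe; pose m := fldU x - Defs.pdiv a e.2; pose gm := fluxU x - e.2.
pose p := fluxU x - pgrad a e.1; pose dp := fldU x - e.1.
have [xL xv _ _] := hx; have [eL ev _] := he; have pgL := pgrad_L2 hmesh he.
have pdL := pdiv_L2 hmesh he.
have gr : is_grad Omega m gm := is_grad_lift oO bO hmesh hx he hxe.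
have dv : is_div Omega p dp := is_div_lift oO bO hmesh hx he hxe.
have lm : Defs.lift0 Omega a (trU x) m := lift0_m oO bO hmesh hx he hxe.
have lp : liftn Omega a (ntrU x) p := liftn_p oO bO hmesh hx he hxe.
have mL : L2 Omega m by exact: (subB S xL pdL).
have gL : L2v Omega gm by exact: (subB Sv xv ev).
pose b := e.2 - pgrad a e.1; pose c := Defs.pdiv a e.2 - e.1.
have bL : L2v Omega b by exact: (subB Sv ev pgL).
have cL : L2 Omega c by exact: (subB S pdL eL).
have pE : p = gm + b by rewrite /p /gm /b addrA subrK.
have dE : dp = m + c by rewrite /dp /m /c addrA subrK.
have pL : L2v Omega p by rewrite pE; exact: (subD Sv gL bL).
have dL : L2 Omega dp by rewrite dE; exact: (subD S mL cL).
have bb : ipv Omega b b <= 2 * ipv Omega e.2 e.2 + 2 * ipv Omega (pgrad a e.1) (pgrad a e.1).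
  exact: (si_sqrB_le Sv ev pgL).
have cc : ip Omega c c <= 2 * ip Omega (Defs.pdiv a e.2) (Defs.pdiv a e.2) + 2 * ip Omega e.1 e.1.
  exact: (si_sqrB_le S pdL eL).
exists (ip Omega m m + ipv Omega gm gm).
  by rewrite addr_ge0 //; [exact: (si_ge0 S mL)|exact: (si_ge0 Sv gL)].
split.
  rewrite -(skel_pairE bO hmesh hx hx lp lm) (normal_traceE oO finO pL dv mL gr).
  rewrite pE (siD Sv gL bL gL) dE (siD S mL cL mL).
  exact: (lower (si_mul_ge Sv bL gL) (si_mul_ge S cL mL) bb cc).
have hm := is_grad_H1 mL gr; have hp := is_div_Hdiv pL dv.
have fE : fldU x = m + Defs.pdiv a e.2 by rewrite /m subrK.
have flE : fluxU x = gm + e.2 by rewrite /gm subrK.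
have s1 : ip Omega (fldU x) (fldU x) <= 2 * ip Omega m m + 2 * ip Omega (Defs.pdiv a e.2) (Defs.pdiv a e.2).
  by rewrite {1 2}fE; exact: (si_sqrD_le S mL pdL).
have s2 : ipv Omega (fluxU x) (fluxU x) <= 2 * ipv Omega gm gm + 2 * ipv Omega e.2 e.2.
  by rewrite {1 2}flE; exact: (si_sqrD_le Sv gL ev).
have s3 : norm_half Omega a (trU x) ^+ 2 <= ip Omega m m + ipv Omega gm gm.
  apply: (@le_trans _ _ (normH1 Omega m ^+ 2)).
    by apply: (@inf_sqr_le _ _ [set w | Defs.lift0 Omega a (trU x) w] (normH1 Omega) m) => // w; exact: sqrtr_ge0.
  by rewrite (normH1_sqr oO finO hm) (ipH1E oO finO mL gr mL gr).
have s4 : norm_mhalf Omega a (ntrU x) ^+ 2 <= ipv Omega p p + ip Omega dp dp.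
  apply: (@le_trans _ _ (normHdiv Omega p ^+ 2)).
    by apply: (@inf_sqr_le _ _ [set q | liftn Omega a (ntrU x) q] (normHdiv Omega) p) => // q; exact: sqrtr_ge0.
  rewrite /normHdiv sqr_sqrtr; last exact: (si_ge0 (ipHdiv_semi oO finO) hp).
  by rewrite (ipHdivE oO finO pL dv pL dv).
have s5 : ipv Omega p p <= 2 * ipv Omega gm gm + 2 * ipv Omega b b.
  by rewrite pE; exact: (si_sqrD_le Sv gL bL).
have s6 : ip Omega dp dp <= 2 * ip Omega m m + 2 * ip Omega c c.
  by rewrite dE; exact: (si_sqrD_le S mL cL).
rewrite /normU sqr_sqrtr; last first.
  have h1 := si_ge0 S xL; have h2 := si_ge0 Sv xv.
  by rewrite !addr_ge0 // sqr_ge0.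
exact: (upper bb cc s1 s2 s3 s4 s5 s6 (si_ge0 S eL) (si_ge0 Sv pgL) (si_ge0 Sv ev) (si_ge0 S pdL)).
Qed.

Lemma inV_scale c z : inV Omega a z -> inV Omega a (c *: z).
Proof.
move=> [z1 z2 z3]; split; [exact: (subZ _ S z1)|exact: (subZ _ Sv z2)|].
by move=> i; have [h1 h2] := z3 i; split; [exact: (subZ _ (H1_sub (T i)) h1)|exact: (subZ _ (Hdiv_sub (T i)) h2)].
Qed.

Lemma inV_opp z : inV Omega a z -> inV Omega a (- z).
Proof. by rewrite -scaleN1r; exact: inV_scale. Qed.

Lemma ipV_opp z t : inV Omega a z -> inV Omega a t -> ipV Omega a (- z) t = - ipV Omega a z t.
Proof.
move=> hz ht; rewrite (ipV_split hmesh (inV_opp hz) ht) (ipV_split hmesh hz ht) -sumrN.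
apply: eq_bigr => i _; have [_ _ /(_ i)[z1 z2]] := hz; have [_ _ /(_ i)[t1 t2]] := ht.
have h1 := siN (ipH1_semi (@oT i) (finT i)) z1 t1.
have h2 := siN (ipHdiv_semi (@oT i) (finT i)) z2 t2.
by rewrite /ipVT -[(- z).1]/(- z.1) -[(- z).2]/(- z.2) h1 h2 [RHS]opprD.
Qed.

Lemma bform_scale c x z : inU Omega a x -> inV Omega a z -> inV Omega a (c *: z) ->
  bform Omega a x (c *: z) = c * bform Omega a x z.
Proof.
move=> hx hz hcz; rewrite (bform_split hmesh hx hcz) (bform_split hmesh hx hz) mulr_sumr.
apply: eq_bigr => i _; have [_ _ /(_ i)[z1 z2]] := hz.
rewrite -[(c *: z).1]/(c *: z.1) -[(c *: z).2]/(c *: z.2) mulrDr.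
have B1 := b1_bounded bO hmesh i hx; have B2 := b2_bounded bO hmesh i hx.
have [h1 _] := B1; have [h2 _] := B2.
have := h1 c _ _ z1 (sub0 (H1_sub (T i))); rewrite addr0 (bounded_lin0 (H1_sub (T i)) B1) addr0 => ->.
by have := h2 c _ _ z2 (sub0 (Hdiv_sub (T i))); rewrite addr0 (bounded_lin0 (Hdiv_sub (T i)) B2) addr0 => ->.
Qed.

(** The variational inequality and the residual bound give Duu <= beta rho - (3/4) beta Y + (Duh +
    Dhu) / 2. In the lower bound the mixed terms keep the factor -1/2 and drop out, so M / 2 + (3
    beta / 4 - 1) Y <= eta^2. For beta >= 2 this gives M + Y <= 2 eta^2, hence 5 M + 6 Y <= 12
    eta^2, rounded up to 4^2 eta^2. *)
Let final (beta Y M rho Duu Duh Dhu Dhh bw L eta nrm : R) : 2 <= beta -> 0 <= Y -> 0 <= M ->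
  0 <= Duh -> 0 <= Dhu ->
  beta * L <= beta * (bw - Y) + 2^-1 * (Duh - Duu + (Dhu - Duu)) ->
  bw - L <= rho + Y / 4 -> M / 2 - Y <= Duu - Dhu - (Duh - Dhh) ->
  eta ^+ 2 = beta * rho + Dhh -> nrm <= 5 * M + 6 * Y ->
  nrm <= 4 ^+ 2 * eta ^+ 2.
Proof.
move=> b2 Y0 M0 D1 D2 vi res low ->.
have h1 : 0 <= beta * (rho + Y / 4 - (bw - L)) by rewrite mulr_ge0 // ?subr_ge0 //; lra.
have h2 : 0 <= (beta - 2) * Y by rewrite mulr_ge0 // subr_ge0.
move: vi h1 h2; rewrite !mulrDr !mulrN => vi h1 h2; lra.
Qed.

Let sqr_le (b c : R) : 0 <= b -> 0 <= c -> b ^+ 2 <= 4 ^+ 2 * c ^+ 2 -> b <= 4 * c.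
Proof. by move=> b0 c0; rewrite -exprMn ler_pXn2r // nnegrE mulr_ge0. Qed.

Lemma dpg_reliability f beta (u uh : U) eta : L2 Omega f -> 2 <= beta ->
  Ks Omega a u -> Ks Omega a uh ->
  Fform Omega a f beta (uh - u) <= a_s Omega a beta u (uh - u) ->
  0 <= eta -> eta ^+ 2 = \sum_i eta2_cell Omega a f beta uh i + skel_pair uh uh ->
  normU Omega a (u - uh) <= 4 * eta.
Proof.
move=> hf b2 [hu gu ngu] [huh guh nguh] vi eta0 etaE.
have hw := inU_sub bO hmesh huh hu; have hx := inU_sub bO hmesh hu huh.
have [eV eP] := ThetaP bO hmesh hw; set e := Theta _ _ _ in eV eP vi *.
have neV := inV_opp eV.
(* The variational inequality involves [uh - u], the lower bound [u - uh]. [Theta] is a choice and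
   not visibly linear, but -e satisfies the equation of [u - uh], which is all that [skeleton_lifts]
   asks. *)
have xP z : inV Omega a z -> ipV Omega a (- e) z = bform Omega a (u - uh) z.
  move=> hz; rewrite (ipV_opp eV hz) (eP _ hz) (bform_sub bO hmesh huh hu hz).
  by rewrite (bform_sub bO hmesh hu huh hz) opprB.
have [M M0 [low nrm]] := skeleton_lifts hx neV xP.
have beV := inV_scale beta eV; have bw := bform_sub bO hmesh huh hu eV.
have Y0 : 0 <= ipV Omega a e e.
  have [e1 e2 _] := eV; have h1 := si_ge0 S e1; have h2 := si_ge0 Sv e2.
  have h3 := si_ge0 S (pdiv_L2 hmesh eV); have h4 := si_ge0 Sv (pgrad_L2 hmesh eV).
  by rewrite /ipV !addr_ge0.
have YE : ipV Omega a (- e) (- e) = ipV Omega a e e.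
  have := bform_scale hw eV (inV_scale (-1) eV); rewrite scaleN1r mulN1r => h.
  by rewrite (ipV_opp eV neV) (eP _ neV) h opprK -eP.
rewrite YE in low nrm.
have pair_ge0 y y' : inU Omega a y -> inU Omega a y' -> dual_ge0 Omega (gamman Omega a y) ->
    trace_ge0 Omega (gamma0 Omega a y') -> 0 <= skel_pair y y'.
  move=> hy hy' dy ty; have [g0 _] := gamma0P hy'; have := dy _ g0 ty.
  by have -> := gammaE bO hmesh hy hy'.
have D1 := pair_ge0 _ _ hu huh ngu guh; have D2 := pair_ge0 _ _ huh hu nguh gu.
move: vi; rewrite /Fform /a_s /Theta_ -/e /Lform.
rewrite -[(beta *: e).1]/(beta *: e.1).
have [e1 _ _] := eV; rewrite (siZr S beta e1 hf) (bform_scale hu eV beV).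
rewrite (gammaE bO hmesh hu hw) (gammaE bO hmesh hw hu).
rewrite (skel_pairBr bO hmesh hu huh hu) (skel_pairBl uh u u) => vi.
(* As e represents [uh - u], the value of b(uh - u, e) is the square of e; this replaces u by uh in
   the residual. *)
have ub : bform Omega a u e = bform Omega a uh e - ipV Omega a e e.
  by rewrite (eP _ eV) bw opprB addrC subrK.
rewrite ub in vi.
have res := residual_le bO hmesh hf huh eV.
move: low; rewrite (skel_pairBr bO hmesh hx hu huh) !skel_pairBl => low.
rewrite /eta2_cell -mulr_sumr in etaE.
apply: (sqr_le _ eta0); first exact: sqrtr_ge0.
exact: (final b2 Y0 M0 D1 D2 vi res low etaE nrm).
Qed.

End reliability.

(** * The boundary term *)

(** The difference x - s vanishes for |x| <= C; otherwise it has the sign of x and |x| = C + |x -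
    s|, to be multiplied by |x - s|. *)
Lemma truncation (R : realType) (C x : R) : 0 <= C ->
  let s := Num.max (- C) (Num.min C x) in
  `|s| <= C /\ (x - s) * (x - s) + C * `|x - s| <= x * (x - s).
Proof.
move=> C0 s; rewrite /s; have [h|h] := lerP x C.
  have [h'|h'] := lerP (- C) x.
    by rewrite subrr normr0 !mulr0 addr0 ler_norml h' h.
  rewrite normrN (ger0_norm C0) ltr0_norm ?subr_lt0 //; split => //; nra.
have nC : - C <= C by lra.
rewrite (max_idPr nC) (ger0_norm C0) gtr0_norm ?subr_gt0 //; split => //; nra.
Qed.

(** * Signed combinations of finite measures *)

Section bounded_measurable.
Context d (T : measurableType d) (R : realType).
Implicit Types (m : {measure set T -> \bar R}) (f g h : T -> R).

(** The bound holds everywhere, not almost everywhere: several measures with different null sets are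
    in play, and such a function is integrable for every finite one. *)
Definition bmf g := measurable_fun setT g /\ exists C, forall x, `|g x| <= C.

Lemma bmf_integrable m g : (m setT < +oo)%E -> bmf g -> m.-integrable setT (EFin \o g).
Proof.
move=> mfin [mg [C gC]]; have I1 := indic_integrable C measurableT mfin.
apply: le_integrable I1 => //; first exact/measurable_EFinP.
move=> x _ /=; rewrite lee_fin indicE in_setT mulr1.
by apply: le_trans (gC x) (ler_norm _).
Qed.

Lemma bmf_cst c : bmf (cst c). Proof. by split => //; exists `|c|. Qed.

Lemma bmfD f g : bmf f -> bmf g -> bmf (f \+ g).
Proof.
move=> [mf [C fC]] [mg [D gD]]; split; first exact: measurable_funD.
by exists (C + D) => x; apply: le_trans (ler_normD _ _) _; exact: lerD.
Qed.

Lemma bmfM f g : bmf f -> bmf g -> bmf (f \* g).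
Proof.
move=> [mf [C fC]] [mg [D gD]]; split; first exact: measurable_funM.
by exists (C * D) => x; rewrite normrM ler_pM.
Qed.

Lemma bmf_indic (A : set T) : measurable A -> bmf (\1_A : T -> R).
Proof.
move=> mA; split; first exact: measurable_indic.
by exists 1 => x; rewrite indicE; case: (x \in A); rewrite ?normr1 ?normr0.
Qed.

(** A combination of measures is specified by its integrals, so that it can be built by recursion on
    the index set and used without its construction. *)
Definition measure_comb (I : finType) (c : I -> R) (nu : I -> {measure set T -> \bar R}) m :=
  forall f : T -> \bar R, measurable_fun setT f -> (forall x, 0 <= f x)%E ->
    (\int[m]_x f x = \sum_i (c i)%:E * \int[nu i]_x f x)%E.

Lemma measure_comb_ex (I : finType) (c : I -> R) (nu : I -> {measure set T -> \bar R}) :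
  (forall i, 0 <= c i) -> exists m, measure_comb c nu m.
Proof.
move=> c0; rewrite /measure_comb.
suff [m hm] : exists m : {measure set T -> \bar R}, forall f : T -> \bar R,
    measurable_fun setT f -> (forall x, 0 <= f x)%E ->
    (\int[m]_x f x = \sum_(i <- index_enum I) (c i)%:E * \int[nu i]_x f x)%E by exists m.
elim: (index_enum I) => [|i s [m hm]].
  exists mzero => f _ _; rewrite big_nil; exact: integral_measure_zero.
exists (measure_add (mscale (NngNum (c0 i)) (nu i)) m) => f mf f0.
rewrite ge0_integral_measure_add // big_cons hm //; congr (_ + _)%E.
by rewrite ge0_integral_mscale.
Qed.

Section comb.
Variables (I : finType) (c : I -> R) (nu : I -> {measure set T -> \bar R}).
Variable m : {measure set T -> \bar R}.
Hypotheses (c0 : forall i, 0 <= c i) (nu_fin : forall i, (nu i setT < +oo)%E).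
Hypothesis hm : measure_comb c nu m.

Lemma measure_comb_ge0 g : (forall x, 0 <= g x) ->
  (forall i, (nu i).-integrable setT (EFin \o g)) -> measurable_fun setT g ->
  (\int[m]_x (g x)%:E)%E = (\sum_i c i * \int[nu i]_x g x)%:E.
Proof.
move=> g0 ig mg; rewrite hm; last first.
- by move=> x; rewrite lee_fin.
- exact/measurable_EFinP.
rewrite -sumEFin; apply: eq_bigr => i _; rewrite EFinM; congr (_ * _)%E.
rewrite /Rintegral fineK //; exact: (integrable_fin_num measurableT (ig i)).
Qed.

Lemma measure_comb_fin : (m setT < +oo)%E.
Proof.
have h := @measure_comb_ge0 (cst 1) (fun=> ler01) (fun i => bmf_integrable (nu_fin i) (bmf_cst 1)) (measurable_cst _).
have e : (\int[m]_x ((cst 1 : T -> R) x)%:E = 1%:E * m setT)%E by exact: (@integral_cst _ _ _ m setT measurableT 1%:E).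
by move: h; rewrite e mul1e => ->; exact: ltry.
Qed.

Lemma measure_combE g : bmf g -> \int[m]_x g x = \sum_i c i * \int[nu i]_x g x.
Proof.
(* Adding its bound C makes g nonnegative; the identity for g + C and for C gives the one for g. *)
move=> bg; have [mg [C gC]] := bg; have bC := bmf_cst C; have bD := bmfD bg bC.
have g0 x : 0 <= (g \+ cst C) x by have := gC x; rewrite ler_norml /= => /andP[+ _]; lra.
have C0 x : 0 <= (cst C : T -> R) x by exact: le_trans (gC x).
have eR h : bmf h -> (forall x, 0 <= h x) -> \int[m]_x h x = \sum_i c i * \int[nu i]_x h x.
  move=> bh h0; rewrite {1}/Rintegral measure_comb_ge0 //; last by case: bh.
  by move=> i; exact: bmf_integrable.
have e1 := eR _ bD g0; have e2 := eR _ bC C0.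
have eD m' : (m' setT < +oo)%E -> \int[m']_x (g \+ cst C) x = \int[m']_x g x + \int[m']_x (cst C) x.
  by move=> fm; rewrite RintegralD //; exact: bmf_integrable.
move: e1; rewrite (eD m measure_comb_fin) e2 => e1; apply: (addIr (\sum_i c i * \int[nu i]_x cst C x)).
rewrite e1 -big_split; apply: eq_bigr => i _.
by rewrite (eD _ (nu_fin i)) mulrDr.
Qed.

End comb.

(* The density s0 given by the Riesz representation is truncated at the level C:
   (s0 - s) s0 = (s0 - s)^2 + C |s0 - s| for the truncation s. *)
Lemma signed_density (I : finType) (c : I -> R) (nu : I -> {measure set T -> \bar R}) m :
  (forall i, (nu i setT < +oo)%E) -> measure_comb (fun=> 1) nu m ->
  exists s, bmf s /\ forall g, bmf g -> \int[m]_x (s x * g x) = \sum_i c i * \int[nu i]_x g x.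
Proof.
move=> nu_fin hm; have one0 (i : I) : 0 <= (fun=> 1 : R) i by exact: ler01.
have mfin : (m setT < +oo)%E by exact: (measure_comb_fin nu_fin hm).
have BX := L2_semi_inner m; set X := [set f : T -> R | _] in BX.
have bX g : bmf g -> X g.
  move=> bg; apply/Lfun2P; split; first by case: bg.
  have := bmf_integrable mfin (bmfM bg bg) => /integrableP[_]; apply: le_lt_trans.
  apply: ge0_le_integral => //.
  - by move=> x _; rewrite lee_fin sqr_ge0.
  - by apply/measurable_EFinP; apply: measurable_funX; case: bg.
  - by apply: measurableT_comp => //; apply/measurable_EFinP; have [] := bmfM bg bg.
  - by move=> x _; rewrite /= lee_fin expr2 ler_norm.
have X1 : X (cst 1) by exact: bX (bmf_cst 1).
have XI g : X g -> m.-integrable setT (EFin \o g).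
  move=> Xg; have := Lfun2M_integrable Xg X1.
  by rewrite (_ : (fun x => g x * cst 1 x) = g) //; apply/funext => x; rewrite /= mulr1.
(* All weights of m are 1, so m dominates each [nu i], and functions integrable for m are integrable
   for all of them. *)
have nule (f : T -> \bar R) i : measurable_fun setT f -> (forall x, 0 <= f x)%E ->
    (\int[nu i]_x f x <= \int[m]_x f x)%E.
  move=> mf f0; rewrite (hm f mf f0) (bigD1 i) //= mul1e leeDl //.
  by apply: sume_ge0 => j _; rewrite mul1e; exact: integral_ge0.
have nuI g i : m.-integrable setT (EFin \o g) -> (nu i).-integrable setT (EFin \o g).
  move=> /integrableP[mg ig]; apply/integrableP; split => //.
  by apply: le_lt_trans ig; apply: nule => //; exact: measurableT_comp.
pose C := \sum_i `|c i|; pose l g := \sum_i c i * \int[nu i]_x g x.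
have C0 : 0 <= C by exact: sumr_ge0.
have labs g : m.-integrable setT (EFin \o g) -> `|l g| <= C * \int[m]_x `|g x|.
  move=> ig; have iga : m.-integrable setT (EFin \o (fun x => `|g x|)).
    by have := integrable_abse ig.
  have mga : measurable_fun setT (fun x => `|g x|).
    by have [/measurable_EFinP] := (integrableP _ _ _ iga).
  have e := measure_comb_ge0 hm (fun x => normr_ge0 (g x)) (fun i => nuI _ i iga) mga.
  rewrite {1}/Rintegral e mulr_sumr; apply: le_trans (ler_norm_sum _ _ _) _.
  apply: ler_sum => i _; rewrite normrM mul1r; apply: ler_pM => //.
    by rewrite /C (bigD1 i) //= lerDl; exact: sumr_ge0.
  exact: le_normr_Rintegral (nuI _ i ig).
have ll : bounded_lin X (@ip2 _ _ _ m) l.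
  split.
    move=> k f g Xf Xg; rewrite /l mulr_sumr -big_split; apply: eq_bigr => i _ /=.
    have iff := nuI _ i (XI _ Xf); have igg := nuI _ i (XI _ Xg).
    have iz : (nu i).-integrable setT (EFin \o (fun x => k * f x)).
      by have := integrableZl measurableT k iff.
    rewrite (@RintegralD _ _ _ (nu i) setT (fun x => k * f x) g measurableT iz igg).
    by rewrite (@RintegralZl _ _ _ (nu i) setT f k measurableT iff) mulrDr mulrCA.
  exists (C ^+ 2 * ip2 m (cst 1) (cst 1)) => g Xg.
  have Xa : X (fun x => `|g x|).
    have [mg ig] := (Lfun2P _ _).1 Xg; apply/Lfun2P; split; first exact: measurableT_comp.
    by under eq_integral do rewrite real_normK ?num_real //.
  have e : \int[m]_x `|g x| = ip2 m (fun x => `|g x|) (cst 1).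
    by apply: eq_Rintegral => x _; rewrite /= mulr1.
  have e2 : ip2 m (fun x => `|g x|) (fun x => `|g x|) = ip2 m g g.
    by apply: eq_Rintegral => x _; rewrite -normrM -expr2 ger0_norm ?sqr_ge0.
  have := labs g (XI _ Xg); rewrite e => h.
  have h2 : l g ^+ 2 <= (C * ip2 m (fun x => `|g x|) (cst 1)) ^+ 2.
    by rewrite -real_normK ?num_real // ler_pXn2r // nnegrE ?normr_ge0 // (le_trans _ h).
  apply: le_trans h2 _; rewrite exprMn -[leRHS]mulrA.
  by apply: ler_wpM2l; [exact: sqr_ge0|rewrite -e2 [leRHS]mulrC; exact: (si_CS BX Xa X1)].
have [s0 Xs0 hs0] := riesz_bounded BX (@L2_complete _ _ _ m) ll.
(* A bounded density stays in the class [bmf], where products and integrals against every [nu i] are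
   available; [s0] is only in L^2 of m. *)
pose s x := Num.max (- C) (Num.min C (s0 x)).
have ms0 : measurable_fun setT s0 by have [] := (Lfun2P _ _).1 Xs0.
have sC x : `|s x| <= C.
  by have [] := truncation (s0 x) C0.
have bs : bmf s.
  split; last by exists C.
  by apply: measurable_maxr => //; apply: measurable_minr.
have Xs := bX _ bs; have Xd := subB BX Xs0 Xs.
pose dd := s0 - s.
have key x : dd x * dd x + C * `|dd x| <= s0 x * dd x.
  by have [] := truncation (s0 x) C0.
have idd := Lfun2M_integrable Xd Xd; have isd := Lfun2M_integrable Xs0 Xd.
have ida : m.-integrable setT (EFin \o (fun x => `|dd x|)) by have := integrable_abse (XI _ Xd).
have iCa : m.-integrable setT (EFin \o (fun x => C * `|dd x|)) by have := integrableZl measurableT C ida.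
have h1 : ip2 m dd dd + C * \int[m]_x `|dd x| <= ip2 m s0 dd.
  rewrite -(@RintegralZl _ _ _ m setT (fun x => `|dd x|) C measurableT ida).
  rewrite -(@RintegralD _ _ _ m setT _ _ measurableT idd iCa).
  apply: le_Rintegral => //.
  by have := integrableD measurableT idd iCa.
have h2 : ip2 m s0 dd <= C * \int[m]_x `|dd x|.
  by rewrite hs0 //; apply: le_trans (ler_norm _) (labs _ (XI _ Xd)).
have d0 : ip2 m dd dd = 0.
  apply/eqP; rewrite eq_le (si_ge0 BX Xd) andbT.
  by rewrite -(lerD2r (C * \int[m]_x `|dd x|)) add0r; exact: le_trans h1 h2.
exists s; split => // g bg; have Xg := bX _ bg.
rewrite -[RHS](hs0 g Xg) -[LHS]/(ip2 m s g); apply/eqP; rewrite eq_sym -subr_eq0.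
by rewrite -(siBl BX Xs0 Xs Xg) (si_null BX Xd Xg d0).
Qed.

End bounded_measurable.

(** * Surface measures of simplices *)

Section simplex_measure.
Variables (R : realType) (n k : nat).
Local Notation E := 'rV[R]_n.+1.
Local Notation lk := (leb R k).
Local Notation D := (@ref_simplex R k).
Variable p : 'I_k.+1 -> E.

Lemma measurable_ref_simplex : measurable D.
Proof.
have -> : D = \big[setI/setT]_(j < k) [set t : 'rV[R]_k | 0 <= t 0 j] `&` [set t | \sum_j t 0 j <= 1].
  apply/seteqP; split => t /=.
    by move=> [t0 t1]; split => //; elim/big_ind : _ => [//|A B hA hB|j _]; [split|exact: t0].
  move=> [t0 t1]; split => // j.
  by move: t0; rewrite (bigD1 j) //= => -[].
apply: measurableI.
  elim/big_ind : _ => [|A B|j _]; [exact: measurableT|exact: measurableI|].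
  rewrite (_ : [set t | _] = setT `&` (fun t : 'rV[R]_k => t 0 j) @^-1` `[0, +oo[%classic).
    have mi : measurable (`[(0 : R), +oo[%classic) by exact: measurable_itv.
    exact: (@measurable_coord R k j measurableT _ mi).
  by rewrite setTI; apply/seteqP; split => t /=; rewrite in_itv /= andbT.
have mS : measurable_fun setT (fun t : 'rV[R]_k => \sum_j t 0 j).
  by apply: measurable_sum => j; exact: measurable_coord.
have mi : measurable (`]-oo, (1 : R)]%classic) by exact: measurable_itv.
have := mS measurableT _ mi; by rewrite setTI.
Qed.

Lemma leb_ref_simplex : (lk D < +oo)%E.
Proof.
apply: le_lt_trans (leb_box_fin (const_mx (-1) : 'rV[R]_k) (const_mx 2)).
apply: le_measure; rewrite ?inE.
- exact: measurable_ref_simplex.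
- exact: measurable_box.
move=> t [t0 t1] j; rewrite !mxE; have h := t0 j.
have h2 : t 0 j <= \sum_j t 0 j by rewrite (bigD1 j) //= lerDl; apply: sumr_ge0 => i _; exact: t0.
by apply/andP; split; lra.
Qed.

Lemma measurable_simplex_map : measurable_fun setT (simplex_map p).
Proof.
apply: measurable_fun_rV => i; rewrite /simplex_map.
rewrite (_ : (fun x => _) = fun t : 'rV[R]_k => p ord0 0 i + \sum_j t 0 j * edges p j i).
  apply: measurable_funD => //; apply: measurable_sum => j; apply: measurable_funM => //.
  exact: measurable_coord.
by apply/funext => t; rewrite !mxE.
Qed.

Lemma simplex_map_hull t : D t -> hull p setT (simplex_map p t).
Proof.
move=> [t0 t1]; exists (fun j => if unlift ord0 j is Some l then t 0 l else 1 - \sum_l t 0 l).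
split => //.
- by move=> j; case: unliftP => [l _|_]; rewrite ?subr_ge0.
- by move=> j [].
- rewrite big_ord_recl unlift_none -[RHS](subrK (\sum_l t 0 l)); congr (_ + _).
  by apply: eq_bigr => l _; rewrite liftK.
- rewrite /simplex_map big_ord_recl unlift_none mulmx_sum_row scalerBl scale1r -addrA; congr (_ + _).
  rewrite scaler_suml addrC -sumrB; apply: eq_bigr => l _.
  by rewrite rowK liftK scalerBr.
Qed.

Lemma eq_simplex_int g h : (forall x, hull p setT x -> g x = h x) ->
  simplex_int p g = simplex_int p h.
Proof.
move=> gh; congr (_ * _); apply: eq_Rintegral => t /set_mem Dt.
by rewrite gh //; exact: simplex_map_hull.
Qed.

Lemma bmf_simplex_map (g : E -> R) : bmf g -> bmf (g \o simplex_map p).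
Proof.
move=> [mg [C gC]]; split; first by apply: measurableT_comp mg _; exact: measurable_simplex_map.
by exists C => x; exact: gC.
Qed.

Lemma Rintegral_mrestr (g : 'rV[R]_k -> R) : bmf g ->
  \int[mrestr lk measurable_ref_simplex]_t g t = \int[lk]_(t in D) g t.
Proof.
have mD := measurable_ref_simplex; set m := mrestr _ _ => bg.
have mfin : (m setT < +oo)%E by rewrite /m /mrestr setTI; exact: leb_ref_simplex.
have ig : m.-integrable (D `|` ~` D) (EFin \o g) by rewrite setUv; exact: bmf_integrable.
have dj : [disjoint D & ~` D] by apply/disj_setPS => x [].
have := Rintegral_setU mD (measurableC mD) ig dj; rewrite setUv => ->.
rewrite (_ : \int[m]_(x in ~` D) g x = 0); last first.
  rewrite /Rintegral (@eq_measure_integral _ _ _ (~` D) mzero) ?integral_measure_zero //.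
  by move=> A mA AD; rewrite /= /mrestr (_ : A `&` D = set0) ?measure0 //; apply/seteqP; split => // x [/AD].
rewrite addr0 /Rintegral; congr fine; apply: eq_measure_integral => A mA AD.
by rewrite /= /mrestr; congr (lk _); apply/setIidl.
Qed.

(** The image of the Lebesgue measure of the reference simplex under the affine map, scaled by the
    Gram factor through a one-term [measure_comb]. *)
Lemma simplex_measure : exists nu : {measure set E -> \bar R}, (nu setT < +oo)%E /\
  forall g, bmf g -> \int[nu]_x g x = simplex_int p g.
Proof.
pose m0 := image_measure (mrestr lk measurable_ref_simplex) measurable_simplex_map.
have m0fin : (m0 setT < +oo)%E.
  by rewrite /m0 /= /pushforward preimage_setT /mrestr setTI; exact: leb_ref_simplex.
pose w := Num.sqrt (\det (edges p *m (edges p)^T)).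
have [nu hnu] := @measure_comb_ex _ _ R 'I_1 (fun=> w) (fun=> m0) (fun=> sqrtr_ge0 _).
have w0 (i : 'I_1) : 0 <= (fun=> w) i by exact: sqrtr_ge0.
exists nu; split; first exact: (measure_comb_fin (fun=> m0fin) hnu).
move=> g bg; rewrite (measure_combE (fun=> m0fin) hnu bg) big_ord1 /simplex_int; congr (_ * _).
rewrite -(Rintegral_mrestr (bmf_simplex_map bg)) /Rintegral; congr fine.
rewrite /m0 /image_measure /=; apply: integral_pushforward => //.
- exact: measurable_simplex_map.
- by apply/measurable_EFinP; case: bg.
apply: (bmf_integrable _ (bmf_simplex_map bg)).
by rewrite /= /mrestr setTI; exact: leb_ref_simplex.
Qed.

Lemma bmf_simplex_L2 g : bmf g -> simplex_L2 p g.
Proof.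
move=> bg; have [mh [C hC]] := bmf_simplex_map bg; have mD := measurable_ref_simplex.
have ms : measurable_fun setT (patch (fun=> 0) D (g \o simplex_map p)).
  by apply/(measurable_restrictT _ mD); exact: measurable_funTS.
apply/Lfun2P; split; first exact: ms.
have := indic_integrable (C ^+ 2) mD leb_ref_simplex => /integrableP[_]; apply: le_lt_trans.
apply: ge0_le_integral => //.
- by move=> x _; rewrite lee_fin sqr_ge0.
- by apply/measurable_EFinP; exact: measurable_funX.
- by apply: measurableT_comp => //; apply/measurable_EFinP; apply: measurable_funM => //; exact: measurable_indic.
move=> x _ /=; rewrite lee_fin /patch indicE; case: ifP => _; last by rewrite mulr0 normr0 expr0n.
rewrite mulr1 ger0_norm ?sqr_ge0 // -real_normK ?num_real //.
by apply: lerXn2r; rewrite ?nnegrE ?normr_ge0 ?(le_trans _ (hC x)) //; exact: hC.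
Qed.

End simplex_measure.

(** * The boundary part of the estimator *)

Section boundary.
Variables (R : realType) (n : nat).
Local Notation E := 'rV[R]_n.+1.
Local Notation mu := (leb R n.+1).
Variables (Omega : set E) (N : nat) (a : 'I_N -> 'I_n.+2 -> E).
Hypotheses (oO : open Omega) (bO : bounded_set Omega) (O0 : Omega !=set0).
Hypothesis hmesh : conforming_mesh Omega a.
Local Notation T i := (cell (a i)).
Local Notation U := (spaceU R n N).
Local Notation Gamma := (bdry Omega).
Variable uh : U.
Hypothesis huh : inU Omega a uh.

Let mO := Omega_measurable oO.
Let finO := Omega_fin oO bO.
Let mT i := measurable_cell hmesh i.
Let oT i := @open_cell _ _ _ _ _ hmesh i.
Let finT i := cell_fin bO hmesh i.
Let sT i := @cell_sub _ _ _ _ _ hmesh i.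

Let cell_closure_sub i : closure (T i) `<=` closure Omega.
Proof. exact: closureS (@sT i). Qed.

Lemma bdryE : Gamma = closure Omega `\` Omega.
Proof. by rewrite /bdry ((interior_id _).1 oO). Qed.

Lemma measurable_closure : measurable (closure Omega).
Proof. exact: closed_measurable_rV (@closed_closure _ Omega). Qed.

Lemma measurable_bdry : measurable Gamma.
Proof. by rewrite bdryE; apply: measurableD; [exact: measurable_closure|exact: mO]. Qed.

Lemma facet_closure i k : hull (facet (a i) k) setT `<=` closure Omega.
Proof.
move=> x [t [t0 _ t1 xt]]; apply: (@cell_closure_sub i); rewrite (closure_cell hmesh).
exists (fun j => if unlift k j is Some l then t l else 0); split => //.
- by move=> j; case: unliftP.
- by move=> j [].
- by rewrite (bigD1_ord k) //= unlift_none add0r -[RHS]t1; apply: eq_bigr => l _; rewrite liftK.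
- rewrite (bigD1_ord k) //= unlift_none scale0r add0r xt.
  by apply: eq_bigr => l _; rewrite liftK.
Qed.

Lemma lipschitz_closure_H1 v : [lipschitz v x | x in closure Omega] -> H1 Omega v.
Proof. exact: lipschitz_H1. Qed.

Lemma test_lipschitz_in A B (phi : E -> R) : test_function A phi -> [lipschitz phi x | x in B].
Proof.
move=> /test_lipschitz/lipP[L [L0 hL]]; apply/lipP; exists L; split => // x y _ _.
exact: hL.
Qed.

Section density.
Variable c : 'I_N -> 'I_n.+2 -> R.
Hypothesis hc : forall i v, [lipschitz v x | x in closure (T i)] ->
  ntrU uh i v = \sum_k c i k * simplex_int (facet (a i) k) v.

Lemma gamman_lipschitz v : [lipschitz v x | x in closure Omega] ->
  gamman Omega a uh v = \sum_i \sum_k c i k * simplex_int (facet (a i) k) v.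
Proof.
move=> vL; have hv := lipschitz_closure_H1 vL; have [q [hq xq] ->] := gammanP huh.
rewrite (normal_trace_split bO hmesh hq hv); apply: eq_bigr => i _.
rewrite -xq; last exact: (H1_restr (@sT i) (mT i) hv).
apply: hc; have /lipP[L [L0 hL]] := vL; apply/lipP; exists L; split => // x y Tx Ty.
by apply: hL; exact: (@cell_closure_sub i).
Qed.

(* The facet contributions inside Omega cancel, because the normal trace on
   the skeleton of a field of H(div, Omega) is orthogonal to test functions. *)
Lemma gamman_density : exists s : E -> R,
  (forall i k, simplex_L2 (facet (a i) k) (zext Gamma s)) /\
  forall v, [lipschitz v x | x in closure Omega] ->
    gamman Omega a uh v = \sum_i bdry_int (a i) (zext Gamma (s * v)).
Proof.
pose I := ('I_N * 'I_n.+2)%type; pose F (i : I) := facet (a i.1) i.2; pose c' (i : I) := c i.1 i.2.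
have /choice[nu hnu] (i : I) := simplex_measure (F i).
have nu_fin i : (nu i setT < +oo)%E by have [] := hnu i.
have nuE i g : bmf g -> \int[nu i]_x g x = simplex_int (F i) g by have [_] := hnu i; exact.
have [lam hlam] := measure_comb_ex nu (fun=> ler01 : 0 <= (1 : R)).
have [s [bs hs]] := signed_density c' nu_fin hlam.
have cp0 i : 0 <= Num.max (c' i) 0 by rewrite le_max lexx orbT.
have cm0 i : 0 <= Num.max (- c' i) 0 by rewrite le_max lexx orbT.
(* The signed combination [J] of surface measures is a difference of two finite measures, which
   opens it to the uniqueness of measures on boxes. *)
have [m1 hm1] := measure_comb_ex nu cp0; have [m2 hm2] := measure_comb_ex nu cm0.
have m1fin := measure_comb_fin nu_fin hm1; have m2fin := measure_comb_fin nu_fin hm2.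
pose J g := \sum_i c' i * \int[nu i]_x g x.
have JE g : bmf g -> J g = \int[m1]_x g x - \int[m2]_x g x.
  move=> bg; rewrite (measure_combE nu_fin hm1 bg) (measure_combE nu_fin hm2 bg) -sumrB.
  apply: eq_bigr => i _; rewrite -mulrBl; congr (_ * _).
  by case: (lerP (c' i) 0) => h; case: (lerP (- c' i) 0) => h'; lra.
have J_simplex g : bmf g -> J g = \sum_i \sum_k c i k * simplex_int (facet (a i) k) g.
  by move=> bg; rewrite pair_bigA; apply: eq_bigr => i _; rewrite nuE.
have bbump (b e : E) m : bmf (bump b e m).
  split; last by exists 1 => x; rewrite ger0_norm ?bump_ge0 // bump_le1.
  have /test_boundsP[r [M tb]] := @bump_test _ _ b e (cbox b e) m (fun x h => h).
  exact: continuous_measurable_rV (tb_cont tb).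
have Jbump (b e : E) m : cbox b e `<=` Omega -> J (bump b e m) = 0.
  move=> beO; have tb := bump_test m beO; have [q [hq xq] ge] := gammanP huh.
  have tl := test_lipschitz_in (closure Omega) tb.
  have := J_simplex _ (bbump b e m); have := gamman_lipschitz tl; rewrite ge => <- ->.
  exact: (normal_trace_test oO finO hq tb).
(* The bumps of the box are test functions, on which [J] vanishes, and they tend to its indicator.
   Agreement on boxes then extends to all measurable subsets of Omega. *)
have Jbox (b e : E) : cbox b e `<=` Omega -> m1 (box b e) = m2 (box b e).
  move=> beO; have mb := measurable_box b e; have bb := bmf_indic R mb.
  have lim (m : {measure set E -> \bar R}) : (m setT < +oo)%E -> \int[m]_x bump b e k x @[k --> \oo] --> \int[m]_x (\1_(box b e) x : R).
    move=> mf; apply: (@Rdominated _ _ _ m (bump b e) _ (cst 1)).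
    - by move=> k; have [] := bbump b e k.
    - by have [] := bb.
    - by move=> x; exact: bump_cvg.
    - by apply: bmf_integrable mf _; exact: bmf_cst.
    - by move=> k x; rewrite ger0_norm ?bump_ge0 // bump_le1.
  have e12 : \int[m1]_x (\1_(box b e) x : R) = \int[m2]_x (\1_(box b e) x : R).
    apply: (cvg_lim_eq (lim m1 m1fin) (lim m2 m2fin)) => k.
    by apply/eqP; rewrite -subr_eq0 -JE // Jbump.
  have fineE (m : {measure set E -> \bar R}) : (m setT < +oo)%E ->
      (\int[m]_x (\1_(box b e) x : R))%:E = m (box b e).
    move=> mf; rewrite /Rintegral integral_indic // setIT fineK // ge0_fin_numE //.
    by apply: le_lt_trans mf; apply: le_measure; rewrite ?inE.
  by rewrite -(fineE _ m1fin) -(fineE _ m2fin) e12.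
have m12 := box_in_measure_unique oO m1fin Jbox.
have J0 g : bmf g -> (forall x, ~ Omega x -> g x = 0) -> J g = 0.
  move=> bg g0; rewrite JE // (_ : \int[m1]_x g x = \int[m2]_x g x) ?subrr //.
  have gE (m : {measure set E -> \bar R}) : \int[m]_x g x = \int[m]_(x in Omega) g x.
    rewrite [RHS]Rintegral_mkcond; apply: eq_Rintegral => x _; rewrite /patch.
    by case: ifPn => // /negP; rewrite inE => /g0.
  by rewrite !gE /Rintegral; congr fine; exact: eq_measure_integral.
have bzext (A : set E) (g : E -> R) : measurable A -> bmf g -> bmf (zext A g).
  move=> mA [mg [C gC]]; split.
    by apply/(measurable_restrictT _ mA); exact: measurable_funTS.
  exists C => x; have [Ax|Ax] := pselect (A x); first by rewrite zext_in.
  by rewrite zext_out // normr0; exact: le_trans (gC x).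
exists s; split.
  by move=> i k; apply: bmf_simplex_L2; apply: bzext => //; exact: measurable_bdry.
move=> v vL; have /lipP[L [L0 hL]] := vL.
have O0' : closure Omega !=set0 by have [x Ox] := O0; exists x; exact: subset_closure.
(* Only the values of v on the closure of Omega are controlled. Extended and then cut to the
   closure, v becomes a function G of the class [bmf] with the same facet integrals. *)
have [V [Vv VL]] := mcshane O0' L0 hL.
have bG : bmf (zext (closure Omega) V).
  split.
    apply/(measurable_restrictT _ measurable_closure); apply: measurable_funTS.
    exact: continuous_measurable_rV (lipschitz_continuous VL).
  have [y Oy] := O0'; have [r r0 Or] := bounded_rbox bO.
  have cOr : closure Omega `<=` rbox r.
    have cr : closed [set x : E | `|x| <= r].
      apply: (@preimage_closed _ _ (fun x : E => `|x|) [set y | y <= r]); last exact: closed_le.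
      by move=> x _; exact: norm_continuous.
    have h : Omega `<=` [set x : E | `|x| <= r] by move=> x /Or/rboxP; exact.
    move=> x /(closureS h); rewrite -((closure_id _).1 cr) => hx.
    exact/rboxP.
  exists (`|V y| + L * (r + r)) => x; have [Ox|Ox] := pselect (closure Omega x); last first.
    by rewrite zext_out // normr0 addr_ge0 // mulr_ge0 // addr_ge0.
  rewrite zext_in //; have h := VL x y.
  have h1 : `|x - y| <= r + r.
    by apply: le_trans (ler_normB _ _) _; apply: lerD; apply/(rboxP _ r0); exact: cOr.
  have h2 : L * `|x - y| <= L * (r + r) by rewrite ler_wpM2l.
  have := ler_normD (V x - V y) (V y); rewrite subrK; lra.
set G := zext (closure Omega) V in bG.
have Gv x : closure Omega x -> G x = v x by move=> Ox; rewrite /G zext_in // Vv.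
have bGO := bzext _ _ mO bG; have bGG := bzext _ _ measurable_bdry bG.
rewrite (gamman_lipschitz vL).
have -> : \sum_i \sum_k c i k * simplex_int (facet (a i) k) v = J G.
  rewrite J_simplex //; apply: eq_bigr => i _; apply: eq_bigr => k _; congr (_ * _).
  by apply: eq_simplex_int => x /facet_closure h; rewrite Gv.
(* G lives on the closure of Omega, the disjoint union of Gamma and Omega; its part in Omega
   contributes nothing by [J0]. *)
have JG : J G = J (zext Gamma G).
  have e : J G = J (zext Gamma G) + J (zext Omega G).
    rewrite /J -big_split; apply: eq_bigr => i _; rewrite /= -mulrDr; congr (_ * _).
    have i1 := bmf_integrable (nu_fin i) bGG; have i2 := bmf_integrable (nu_fin i) bGO.
    rewrite -(@RintegralD _ _ _ (nu i) setT _ _ measurableT i1 i2).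
    apply: eq_Rintegral => x _; have [Ox|Ox] := pselect (Omega x).
      by rewrite (zext_in G Ox) zext_out ?add0r // bdryE => -[].
    rewrite (zext_out G Ox) addr0; have [Cx|Cx] := pselect (closure Omega x).
      by rewrite zext_in // bdryE.
    by rewrite [RHS]zext_out /G ?zext_out // bdryE => -[].
  rewrite e (J0 (zext Omega G)) ?addr0 // => x Ox; by rewrite zext_out.
rewrite JG /J -hs //.
have bsG := bmfM bs bGG.
rewrite (measure_combE nu_fin hlam bsG); under eq_bigr do rewrite mul1r.
rewrite /bdry_int pair_bigA; apply: eq_bigr => i _; rewrite nuE //.
apply: eq_simplex_int => x _; have [Gx|Gx] := pselect (Gamma x).
  by rewrite /= !zext_in // Gv //; move: Gx; rewrite bdryE => -[].
by rewrite /= !zext_out // mulr0.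
Qed.

End density.

(** [gamman_fun] and [gamma0_fun] are arbitrary selections, so after existence only their defining
    properties count: the density represents gamma_n on Lipschitz functions, and the trace function
    is the restriction of a Lipschitz w with gamma_0 u_h - w in H^1_0(Omega), where gamma_n
    vanishes. *)
Lemma boundary_term : S1_skel a (trU uh) -> P0_skel a (ntrU uh) ->
  \sum_i eta2_bdry Omega a uh i = skel_pair uh uh.
Proof.
move=> [phi0 [_ _ hphi]] [c hc].
have [s0 hs0] := gamman_density hc.
have [sL2 sE] := @xgetPex _ 0 [set s | (forall i k, simplex_L2 (facet (a i) k) (zext Gamma s)) /\
    forall v, [lipschitz v y | y in closure Omega] ->
      gamman Omega a uh v = \sum_i bdry_int (a i) (zext Gamma (s * v))] (ex_intro _ s0 hs0).
rewrite -[xget _ _]/(gamman_fun Omega a uh) in sL2 sE.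
have /choice[z hz] i : exists z, [/\ [lipschitz z x | x in closure (T i)],
    forall x, bdry (T i) x -> z x = phi0 x & eq_trace (T i) (trU uh i) z].
  by have [_ [z ?]] := hphi i; exists z.
have [g0H g0T] := gamma0P huh; set g0 := gamma0 Omega a uh in g0H g0T.
(* Z uses the function of any closed cell containing x. Where two closed cells meet, x is on both
   boundaries and both functions equal [phi0], so the choice is immaterial; off all closed cells 0
   is a default. *)
pose pick x := if pselect (exists i, closure (T i) x) is left e then Some (sval (cid e)) else None.
pose Z x := if pick x is Some i then z i x else 0.
have ZE i x : closure (T i) x -> Z x = z i x.
  move=> Tx; rewrite /Z /pick; case: pselect => [e|ne]; last by case: ne; exists i.
  case: (cid e) => j Tj /=; have [->//|ji] := eqVneq j i.
  have b k l : closure (T k) x -> closure (T l) x -> k != l -> bdry (T k) x.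
    move=> Tk Tl kl; split => //; rewrite ((interior_id _).1 (@oT k)) => Tkx.
    by rewrite (cell_closure_eq hmesh Tkx Tl) eqxx in kl.
  have [_ zi _] := hz i; have [_ zj _] := hz j.
  by rewrite zi ?zj //; [exact: (b j i)|apply: (b i j) => //; rewrite eq_sym].
have ZL : [lipschitz Z x | x in closure Omega].
  apply: (mesh_lipschitz hmesh) => i; have [/lipP[L [L0 hL]] _ _] := hz i.
  by apply/lipP; exists L; split => // x y Tx Ty; rewrite (ZE i) // (ZE i) //; exact: hL.
have ZH := lipschitz_closure_H1 ZL.
(* On each cell both [g0] and Z have the trace [trU uh i], so [H10_cells] applies to their
   difference. *)
have Z0 : H10 Omega (g0 - Z).
  apply: (H10_cells oO bO hmesh); first by apply: (subB (ip_semi Omega)); exact: H1_L2.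
  move=> i; have [_ _ h1] := hz i; have h2 := subB (H10_sub (@oT i) (finT i)) h1 (g0T i).
  apply: eq_H10 h2 => x Tx; have := ZE i x (subset_closure Tx).
  rewrite !funBE => ->; lra.
have ex : exists phi, [lipschitz phi y | y in Gamma] /\ trace_is Omega g0 phi.
  exists Z; split.
    have /lipP[L [L0 hL]] := ZL; apply/lipP; exists L; split => // x y [Gx _] [Gy _].
    exact: hL.
  by split => //; exists Z.
have [_ [_ [w [wL wphi w0]]]] := @xgetPex _ 0 [set phi | [lipschitz phi y | y in Gamma] /\
    trace_is Omega g0 phi] ex.
rewrite -[xget _ _]/(gamma0_fun Omega a uh) in wphi.
have wH := lipschitz_closure_H1 wL.
rewrite -(gammaE bO hmesh huh huh) -/g0.
have -> : gamman Omega a uh g0 = gamman Omega a uh w.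
  have [q [hq _] ->] := gammanP huh; have := normal_trace_H10 oO finO hq w0.
  by rewrite (normal_traceB oO finO hq g0H wH) => /eqP; rewrite subr_eq0 => /eqP.
rewrite (sE _ wL); apply: eq_bigr => i _; rewrite /eta2_bdry; congr bdry_int.
apply/funext => x; have [Gx|Gx] := pselect (Gamma x); last by rewrite !zext_out.
by rewrite !zext_in // -[LHS]/(_ * _) -[RHS]/(_ * _) wphi.
Qed.

End boundary.

Theorem theorem6 (R : realType) (n : nat) (hn : n.+1 = 2%N \/ n.+1 = 3%N)
    (Omega : set 'rV[R]_n.+1)
    (hOmega : lipschitz_domain Omega) (hsc : simply_connected Omega) :
  exists2 Crel : R, 0 < Crel &
  forall (N : nat) (a : 'I_N -> 'I_n.+2 -> 'rV[R]_n.+1)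
    (hmesh : conforming_mesh Omega a)
    (f : 'rV[R]_n.+1 -> R) (hf : L2 Omega f)
    (beta : R) (hbeta : 2 <= beta)
    (u uh : spaceU R n N)
    (hu : Ks Omega a u)
    (hu_vi : forall v, Ks Omega a v ->
      a_s Omega a beta u (v - u) >= Fform Omega a f beta (v - u))
    (huh : Khs Omega a uh)
    (huh_vi : forall vh, Khs Omega a vh ->
      a_s Omega a beta uh (vh - uh) >= Fform Omega a f beta (vh - uh))
    (eta : R) (heta : 0 <= eta)
    (heta2 : eta ^+ 2 = \sum_i eta2_cell Omega a f beta uh i +
                        \sum_i eta2_bdry Omega a uh i),
  normU Omega a (u - uh) <= Crel * eta.
Proof.
have [oO O0 _ bO _] := hOmega.
exists 4 => // N a hmesh f hf beta hbeta u uh hu hu_vi [huh [iuh _ _ S1 P0]] _ eta heta heta2.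
apply: (dpg_reliability oO bO hmesh hf hbeta hu huh (hu_vi uh huh) heta).
by rewrite heta2 (boundary_term oO bO O0 hmesh iuh S1 P0).
Qed.
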